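(* Let $n\in\mathbb{N}$, $1\leq t\leq\infty$, and let $f=(f_1,\dots,f_n)\in\mathcal{H}(B_{\ell_t^n},\overline{\mathbb{D}}^n)$ have the series expansion $$f(z)=\sum_{s=0}^{\infty}\frac{D^sf(0)(z^s)}{s!},\qquad z\in B_{\ell_t^n},$$ where $D^0f(0)(z^0)=f(0)=a=(a_1,\dots,a_n)$ satisfies $|a_j|=\|a\|_\infty$ for all $j\in\{1,\dots,n\}$. Let $m_1,m_2\in\mathbb{N}$ and let $v_1,v_2:B_{\ell_t^n}\to B_{\ell_t^n}$ be Schwarz mappings having $z=0$ as a zero of order $m_1$ and $m_2$, respectively. Then, for $p\in(0,2]$, $m\in\mathbb{N}_0$, $q\in\mathbb{N}$ and $\mu,\nu\in[0,\infty)$ with $\mu+\nu>0$, we have $$\|f(v_1(z))\|_\infty^p+\mu\sum_{s=1}^{\infty}\frac{\|D^{qs+m}f(0)(z^{qs+m})\|_\infty}{(qs+m)!}+\nu\|f(v_2(z))-f(0)\|_\infty\leq 1$$ for all $z$ with $\|z\|_t=r\leq R_1$, where $R_1$ is the minimal root in $(0,1)$ of the equation $$2\mu\frac{r^{q+m}}{1-r^q}+2\nu\frac{r^{m_2}}{1-r^{m_2}}-p\left(\frac{1-r^{m_1}}{1+r^{m_1}}\right)=0.$$ The constant $R_1$ cannot be improved; that is, for fixed $n,t,p,q,m,m_1,m_2,\mu,\nu$, it cannot be replaced by any larger number so that the inequality still holds for all such $f,v_1,v_2$.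
   Context: $\mathbb{N}=\{1,2,\dots\}$, $\mathbb{N}_0=\mathbb{N}\cup\{0\}$, $\mathbb{D}$ is the open unit disk in $\mathbb{C}$. For $1\leq t<\infty$, $\ell_t^n$ is $\mathbb{C}^n$ with norm $\|z\|_t=(\sum_{j=1}^n|z_j|^t)^{1/t}$; for $t=\infty$, $\|z\|_\infty=\max_{1\leq j\leq n}|z_j|$. $B_{\ell_t^n}$ is the open unit ball of $\ell_t^n$ (so $B_{\ell_\infty^n}=\mathbb{D}^n$). $\mathcal{H}(B_{\ell_t^n},\overline{\mathbb{D}}^n)$ is the set of holomorphic mappings from $B_{\ell_t^n}$ to $\mathbb{C}^n$ with values in the closed unit polydisk $\overline{\mathbb{D}}^n$. $D^sf(0)$ is the $s$-th Fréchet derivative of $f$ at $0$, and $D^sf(0)(z^s)=D^sf(0)(z,\dots,z)$ ($s$ copies of $z$), with $D^0f(0)(z^0)=f(0)$. A Schwarz mapping is a holomorphic mapping $v:B_{\ell_t^n}\to B_{\ell_t^n}$ with $v(0)=0$. The point $z=0$ is a zero of order $k\in\mathbb{N}$ of $v$ if $v(0)=0$, $Dv(0)=0,\dots,D^{k-1}v(0)=0$, but $D^kv(0)\neq0$. *)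

(* Defs.v *)
From HB Require Import structures.
From mathcomp Require Import all_boot all_order all_algebra.
From mathcomp Require Import all_classical all_reals all_analysis.
From mathcomp Require Import complex.

Set Implicit Arguments.
Unset Strict Implicit.
Unset Printing Implicit Defensive.

Import Order.TTheory GRing.Theory Num.Theory.
Import numFieldNormedType.Exports.

Local Open Scope classical_set_scope.
Local Open Scope ring_scope.

(* The topology of R[i] is only inferred through a variable or constant of type
   numFieldType/numClosedFieldType, hence this name for R[i] as such a field. *)
Definition Cplx (R : realType) : numClosedFieldType := R[i].
Arguments Cplx : simpl never.

(* The topology of C^n = 'rV[Cplx R]_n (hence [differentiable] and ['d]) comes
   from the library sup norm, whose values lie in Cplx R. All norms on C^n being
   equivalent, it serves for every l_t. The norms below have values in R. *)

(* The case -oo is never used: the exponent always satisfies 1 <= t. *)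
Definition lnorm (R : realType) (n : nat) (t : \bar R) (z : 'rV[Cplx R]_n) : R :=
  match t with
  | r%:E => (\sum_(j < n) Normc.normc (z ord0 j) `^ r) `^ r^-1
  | +oo%E => \big[Num.max/0]_(j < n) Normc.normc (z ord0 j)
  | -oo%E => 0
  end.

Definition linf (R : realType) (n : nat) (z : 'rV[Cplx R]_n) : R := lnorm +oo%E z.

Definition lball (R : realType) (n : nat) (t : \bar R) : set 'rV[Cplx R]_n :=
  [set z | lnorm t z < 1].

(* Complex Fréchet differentiability at every point of U; used for open U. *)
Definition holomorphic (R : realType) (n : nat) (U : set 'rV[Cplx R]_n)
    (f : 'rV[Cplx R]_n -> 'rV[Cplx R]_n) : Prop :=
  forall z : 'rV[Cplx R]_n, U z -> differentiable f z.

(* [frechetD f x [:: h_1; ...; h_s]] is D^s f(x)(h_1, ..., h_s), under the usual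
   identification of L(E, L^(s-1)(E, F)) with the s-linear maps:
   D^s f(x)(h_1, ..., h_s) = D(y |-> D^(s-1) f(y)(h_2, ..., h_s))(x)(h_1). *)
Fixpoint frechetD (R : realType) (n : nat) (f : 'rV[Cplx R]_n -> 'rV[Cplx R]_n)
    (x : 'rV[Cplx R]_n) (hs : seq 'rV[Cplx R]_n) : 'rV[Cplx R]_n :=
  match hs with
  | [::] => f x
  | h :: hs' => 'd (fun y : 'rV[Cplx R]_n => frechetD f y hs') x h
  end.

(* D^s f(0)(z^s) *)
Definition frechetD0 (R : realType) (n : nat) (f : 'rV[Cplx R]_n -> 'rV[Cplx R]_n)
    (s : nat) (z : 'rV[Cplx R]_n) : 'rV[Cplx R]_n :=
  frechetD f 0 (nseq s z).

Definition schwarz_mapping (R : realType) (n : nat) (t : \bar R)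
    (v : 'rV[Cplx R]_n -> 'rV[Cplx R]_n) : Prop :=
  [/\ holomorphic (lball t) v,
      (forall z, lball t z -> lball t (v z)) &
      v 0 = 0].

Definition zero_of_order (R : realType) (n : nat) (k : nat)
    (v : 'rV[Cplx R]_n -> 'rV[Cplx R]_n) : Prop :=
  (forall hs, (size hs < k)%N -> frechetD v 0 hs = 0) /\
  (exists2 hs, size hs = k & frechetD v 0 hs <> 0).

Definition polydisk_valued (R : realType) (n : nat) (t : \bar R)
    (f : 'rV[Cplx R]_n -> 'rV[Cplx R]_n) : Prop :=
  holomorphic (lball t) f /\
  (forall z, lball t z -> forall j, Normc.normc (f z ord0 j) <= 1).

(* Extended-real valued, so that the inequality [bohr_sum <= 1] includes the
   convergence of the series when mu > 0. *)
Definition bohr_sum (R : realType) (n : nat) (p mu nu : R) (q m : nat)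
    (f v1 v2 : 'rV[Cplx R]_n -> 'rV[Cplx R]_n) (z : 'rV[Cplx R]_n) : \bar R :=
  ((linf (f (v1 z)) `^ p)%:E
   + mu%:E * \sum_(1 <= s <oo)
       (linf (frechetD0 f (q * s + m) z) / ((q * s + m)`!)%:R)%:E
   + (nu * linf (f (v2 z) - f 0))%:E)%E.

(* The inequality holds on ||z||_t <= rho (within the unit ball) for every
   admissible triple f, v_1, v_2. *)
Definition bohr_inequality_upto (R : realType) (n : nat) (t : \bar R)
    (p mu nu : R) (q m m1 m2 : nat) (rho : R) : Prop :=
  forall f v1 v2 : 'rV[Cplx R]_n -> 'rV[Cplx R]_n,
    polydisk_valued t f ->
    (forall j, Normc.normc (f 0 ord0 j) = linf (f 0)) ->
    schwarz_mapping t v1 -> zero_of_order m1 v1 ->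
    schwarz_mapping t v2 -> zero_of_order m2 v2 ->
    forall z, lball t z -> lnorm t z <= rho ->
      (bohr_sum p mu nu q m f v1 v2 z <= 1)%E.

Definition bohr_equation (R : realType) (p mu nu : R) (q m m1 m2 : nat)
    (r : R) : Prop :=
  2 * mu * (r ^+ (q + m) / (1 - r ^+ q))
  + 2 * nu * (r ^+ m2 / (1 - r ^+ m2))
  - p * ((1 - r ^+ m1) / (1 + r ^+ m1)) = 0.

Definition minimal_root (R : realType) (eqn : R -> Prop) (r : R) : Prop :=
  [/\ 0 < r < 1, eqn r & forall x, 0 < x < 1 -> eqn x -> r <= x].

(* Main.v *)
From HB Require Import structures.
Require Import Defs.
From mathcomp Require Import all_boot all_order all_algebra.
From mathcomp Require Import all_classical all_reals all_analysis.
From mathcomp Require Import complex.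
From mathcomp Require Import ring lra.
Import Order.TTheory GRing.Theory Num.Theory.
Import numFieldNormedType.Exports.
Local Open Scope classical_set_scope.
Local Open Scope ring_scope.
Set Implicit Arguments.
Unset Strict Implicit.
Unset Printing Implicit Defensive.

(* Put r = ||z||_t and a = |f_j(0)|. On complex lines through 0, Schwarz's lemma
   gives ||v_i(z)||_t <= r^(m_i), and Schwarz-Pick together with the coefficient
   bound |c_k| <= 1 - |c_0|^2 bounds the Bohr sum by 1 + (1 - a^2)/2 * g(r), where
   g is the left-hand side of the equation. As g increases on [0, 1), this is at
   most 1 up to the root of g. For r beyond the root, the maps with components
   f_j = (a - z_1)/(1 - a z_1), v_1 = - z_1^(m_1 - 1) z, v_2 = z_1^(m_2 - 1) z
   at z = r e_1 give a sum 1 + (1 - a) (g(r) + o(1)) as a -> 1.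

   The complex analysis uses no integral: Goursat's bisection is applied to
   trapezoid sums, so that the trapezoid means of f over |z| = r tend to f(0).
   Applied to f(z)/z^k this gives the Taylor coefficients and Cauchy's estimates;
   after composition with a disc automorphism it gives the maximum modulus
   principle. Cauchy's estimates bound the second order remainder of f uniformly,
   which makes a directional derivative of f a uniform limit of holomorphic
   difference quotients, hence holomorphic. *)

(** * Modulus and complex derivative *)

(** All three terms are governed by one factor, 1 - a^2. The hypothesis that the |a_j| agree makes
    this factor the same in every coordinate, so that coordinatewise bounds pass to the sup norm. In
    the first term, with B = ||f(v_1(z))|| and rho = r^(m_1), one has 1 - B^2 >= (1 - a^2)(1 -
    rho)/(1 + rho), and the concavity of y^(p/2), where p <= 2 enters, yields the coefficient p/2.
    Factoring out this 1/2 is the origin of the 2 before mu and nu in the equation. The order m_i is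
    used by dividing by z^(m_i) on a line. The l_t norm of the quotient is not the modulus of a
    holomorphic function, so the maximum principle is proved for vector-valued means, where
    convexity of the norm suffices. The D^s f(0) are iterated differentials on C^n; no coefficient
    can be estimated before derivatives are known to be holomorphic. Beyond the root, the series is
    cut at a finite index. The excess over 1 is then at least 1 - a times a rational function of a
    with positive denominator, and the sign of its numerator near a = 1 follows from continuity. *)

Section ComplexModulus.
Variable R : realType.
Local Notation C := (Cplx R).
Local Notation nc := (@Normc.normc R).
Implicit Types (x y z : C) (r : R).

Definition ofR (r : R) : C := (r%:C)%C.
Definition re (z : C) : R := complex.Re z.
Definition im (z : C) : R := complex.Im z.
Definition mkC (a b : R) : C := (a +i* b)%C.
Definition cj (z : C) : C := mkC (re z) (- im z).

Lemma complex_ext x y : re x = re y -> im x = im y -> x = y.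
Proof. by case: x y => a b [c d] /= -> ->. Qed.
Lemma reD x y : re (x + y) = re x + re y. Proof. by case: x y => a b []. Qed.
Lemma imD x y : im (x + y) = im x + im y. Proof. by case: x y => a b []. Qed.
Lemma reN x : re (- x) = - re x. Proof. by case: x. Qed.
Lemma imN x : im (- x) = - im x. Proof. by case: x. Qed.
Lemma reM x y : re (x * y) = re x * re y - im x * im y.
Proof. by case: x y => a b []. Qed.
Lemma imM x y : im (x * y) = re x * im y + im x * re y.
Proof. by case: x y => a b []. Qed.
Lemma re_mkC a b : re (mkC a b) = a. Proof. by []. Qed.
Lemma im_mkC a b : im (mkC a b) = b. Proof. by []. Qed.
Lemma re_ofR r : re (ofR r) = r. Proof. by []. Qed.
Lemma im_ofR r : im (ofR r) = 0. Proof. by []. Qed.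
Lemma re0 : re 0 = 0. Proof. by []. Qed.
Lemma im0 : im 0 = 0. Proof. by []. Qed.
Lemma re1 : re 1 = 1. Proof. by []. Qed.
Lemma im1 : im 1 = 0. Proof. by []. Qed.
Lemma re_cj x : re (cj x) = re x. Proof. by []. Qed.
Lemma im_cj x : im (cj x) = - im x. Proof. by []. Qed.

Definition reimE := (reD, imD, reN, imN, reM, imM, re_mkC, im_mkC, re_ofR,
  im_ofR, re0, im0, re1, im1, re_cj, im_cj).

Lemma ofR_is_zmod_morphism : zmod_morphism ofR.
Proof. by move=> a b; apply: complex_ext; rewrite !reimE // subrr. Qed.
Lemma ofR_is_monoid_morphism : monoid_morphism ofR.
Proof.
by split=> // a b; apply: complex_ext; rewrite !reimE ?mul0r ?mulr0 ?subr0 ?addr0.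
Qed.
HB.instance Definition _ := GRing.isZmodMorphism.Build R C ofR ofR_is_zmod_morphism.
HB.instance Definition _ :=
  GRing.isMonoidMorphism.Build R C ofR ofR_is_monoid_morphism.

Lemma norm_nc x : `|x| = ofR (nc x).
Proof. by rewrite (normc_def x); case: x. Qed.

Lemma ofR_inj : injective ofR.
Proof. by move=> a b /(congr1 re). Qed.

Lemma ler_ofR (a b : R) : (ofR a <= ofR b) = (a <= b).
Proof. by rewrite [LHS]lecR. Qed.
Lemma ltr_ofR (a b : R) : (ofR a < ofR b) = (a < b).
Proof. by rewrite [LHS]ltcR. Qed.

Lemma nc0 : nc (0 : C) = 0. Proof. exact: Normc.normc0. Qed.
Lemma nc1 : nc (1 : C) = 1. Proof. exact: Normc.normc1. Qed.
Lemma ncM x y : nc (x * y) = nc x * nc y. Proof. exact: Normc.normcM. Qed.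
Lemma ncV x : nc (x^-1) = (nc x)^-1. Proof. exact: Normc.normcV. Qed.
Lemma nc_sqr x : nc x ^+ 2 = re x ^+ 2 + im x ^+ 2.
Proof. by case: x => a b; rewrite /= sqr_sqrtr // addr_ge0 // sqr_ge0. Qed.
Lemma nc_ge0 x : 0 <= nc x.
Proof. by case: x => a b; rewrite /= sqrtr_ge0. Qed.
Lemma ncD x y : nc (x + y) <= nc x + nc y.
Proof. by rewrite -ler_ofR rmorphD /= -!norm_nc ler_normD. Qed.
Lemma ncN x : nc (- x) = nc x.
Proof. by apply: ofR_inj; rewrite -!norm_nc normrN. Qed.
Lemma ncB x y : nc (x - y) <= nc x + nc y.
Proof. by rewrite -[in leRHS](ncN y) ncD. Qed.
Lemma nc_distC x y : nc (x - y) = nc (y - x).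
Proof. by rewrite -ncN opprB. Qed.
Lemma nc_eq0 x : (nc x == 0) = (x == 0).
Proof.
by apply/eqP/eqP => [/Normc.eq0_normc //|->]; rewrite nc0.
Qed.
Lemma nc_gt0 x : (0 < nc x) = (x != 0).
Proof. by rewrite lt_def nc_ge0 andbT nc_eq0. Qed.
Lemma nc_ofR r : nc (ofR r) = `|r|.
Proof. by rewrite /= expr0n /= addr0 sqrtr_sqr. Qed.
Lemma ncX x k : nc (x ^+ k) = nc x ^+ k.
Proof. by elim: k => [|k IH]; rewrite ?expr0 ?nc1 // !exprS ncM IH. Qed.
Lemma nc_cj x : nc (cj x) = nc x.
Proof. by case: x => a b /=; rewrite sqrrN. Qed.
Lemma mulr_cj x : x * cj x = ofR (nc x ^+ 2).
Proof. by rewrite nc_sqr; apply: complex_ext; rewrite !reimE; ring. Qed.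
Lemma re_le_nc x : re x <= nc x.
Proof.
rewrite (le_trans (ler_norm _))// -(@ler_pXn2r _ 2) ?nnegrE ?nc_ge0//.
by rewrite real_normK ?num_real // nc_sqr lerDl sqr_ge0.
Qed.
Lemma re_abs_le_nc x : `|re x| <= nc x.
Proof.
rewrite -(@ler_pXn2r _ 2) ?nnegrE ?nc_ge0//.
by rewrite real_normK ?num_real // nc_sqr lerDl sqr_ge0.
Qed.
Lemma im_abs_le_nc x : `|im x| <= nc x.
Proof.
rewrite -(@ler_pXn2r _ 2) ?nnegrE ?nc_ge0//.
by rewrite real_normK ?num_real // nc_sqr lerDr sqr_ge0.
Qed.
Lemma nc_le_reim x : nc x <= `|re x| + `|im x|.
Proof.
rewrite -(@ler_pXn2r _ 2) ?nnegrE ?nc_ge0 ?addr_ge0//.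
rewrite nc_sqr sqrrD !real_normK ?num_real // -addrA lerD2l lerDr.
by rewrite mulrn_wge0 // mulr_ge0.
Qed.
Lemma nc_le_dist x y : nc x <= nc y + nc (x - y).
Proof. by rewrite -[x in leLHS](subrK y) addrC ncD. Qed.

(** The factor is conj(z)/|z|. It lets a modulus be read off from a real part, which is how the real
    mean value theorem reaches complex functions. *)
Lemma rotation z : exists2 u : C, nc u = 1 & re (u * z) = nc z.
Proof.
have [->|z0] := eqVneq z 0; first by exists 1; rewrite ?nc1 // mulr0 nc0.
have zp : nc z != 0 by rewrite nc_eq0.
exists (cj z / ofR (nc z)).
  by rewrite ncM ncV nc_ofR ger0_norm ?nc_ge0 // nc_cj divff.
rewrite mulrAC [_ * z]mulrC mulr_cj -fmorphV -rmorphM.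
by rewrite -[RHS]re_ofR; congr (re (ofR _)); rewrite expr2 mulfK.
Qed.

End ComplexModulus.

(** * Complex differentiability at a point and its calculus *)

Section ComplexDerivative.
Variable R : realType.
Local Notation C := (Cplx R).
Local Notation nc := (@Normc.normc R).
Implicit Types (f g : C -> C) (w z d : C).

Lemma continuous_atP f w : {for w, continuous f} <->
  forall e : R, 0 < e -> exists2 dl : R, 0 < dl &
    forall z, nc (z - w) < dl -> nc (f z - f w) <= e.
Proof.
split=> [cf e e0|H].
  have cf' : f @ w --> f w by [].
  have /cvgrPdist_le /(_ (ofR e)) := cf'.
  rewrite (_ : 0 = ofR 0)// ltr_ofR => /(_ e0) /nbhs_ballP[dl dl0 Hd].
  have dl0' : 0 < dl := dl0.
  have dlE : dl = ofR (nc dl) by rewrite -norm_nc gtr0_norm.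
  exists (nc dl); first by rewrite -ltr_ofR -dlE.
  move=> z hz; rewrite -ler_ofR -norm_nc distrC; apply: Hd.
  by rewrite /ball /= dlE norm_nc ltr_ofR nc_distC.
suff : f @ w --> f w by [].
apply/(@cvgrPdist_le _ _ _ (nbhs w)) => e e0.
have eE : e = ofR (nc e) by rewrite -norm_nc gtr0_norm.
have [|dl dl0 Hd] := H (nc e); first by rewrite -ltr_ofR -eE.
apply/nbhs_ballP; exists (ofR dl) => /=; first by rewrite -[0]/(ofR 0) ltr_ofR.
move=> z; rewrite /ball /= norm_nc ltr_ofR nc_distC => hz.
by rewrite distrC norm_nc eE ler_ofR; apply: Hd.
Qed.

Lemma cont_atD f g w : {for w, continuous f} -> {for w, continuous g} ->
  {for w, continuous (fun z => f z + g z)}.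
Proof.
move=> cf cg; suff : (fun z => f z + g z) @ w --> f w + g w by [].
exact: (@cvgD _ _ _ (nbhs w) _ f g (f w) (g w) cf cg).
Qed.

Lemma cont_atM f g w : {for w, continuous f} -> {for w, continuous g} ->
  {for w, continuous (fun z => f z * g z)}.
Proof.
move=> cf cg; suff : (fun z => f z * g z) @ w --> f w * g w by [].
exact: (@cvgM _ _ (nbhs w) _ f g (f w) (g w) cf cg).
Qed.

Lemma cont_at_cst (c : C) w : {for w, continuous (fun=> c)}.
Proof. exact: cst_continuous. Qed.

Lemma cont_atB f g w : {for w, continuous f} -> {for w, continuous g} ->
  {for w, continuous (fun z => f z - g z)}.
Proof.
move=> cf cg; suff : (fun z => f z - g z) @ w --> f w - g w by [].
exact: (@cvgB _ _ _ (nbhs w) _ f g (f w) (g w) cf cg).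
Qed.

Lemma cont_at_id w : {for w, continuous (fun z : C => z)}.
Proof. by move=> A. Qed.

(* Carathéodory's form of complex differentiability: the difference quotient
   extends continuously. *)
Definition hasder f w d := exists psi : C -> C,
  [/\ forall z, f z = f w + psi z * (z - w), {for w, continuous psi}
    & psi w = d].

Lemma hasder_eps f w d : hasder f w d ->
  forall e : R, 0 < e -> exists2 dl : R, 0 < dl &
    forall h, nc h < dl -> nc (f (w + h) - f w - d * h) <= e * nc h.
Proof.
move=> [psi [fE cpsi <-]] e e0.
have [dl dl0 H] := (continuous_atP _ _).1 cpsi e e0.
exists dl => // h hh.
have hw : w + h - w = h by ring.
rewrite fE hw (_ : _ - _ = (psi (w + h) - psi w) * h); last by ring.
by rewrite ncM ler_wpM2r ?nc_ge0// H ?hw.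
Qed.

Lemma eps_hasder f w d :
  (forall e : R, 0 < e -> exists2 dl : R, 0 < dl &
    forall h, nc h < dl -> nc (f (w + h) - f w - d * h) <= e * nc h) ->
  hasder f w d.
Proof.
move=> H; exists (fun z => if z == w then d else (f z - f w) / (z - w)); split.
- move=> z; case: eqP => [->|/eqP zw]; first by ring.
  by rewrite divfK ?subr_eq0 //; ring.
- apply/continuous_atP => e e0; have [dl dl0 Hd] := H e e0.
  exists dl => // z hz; rewrite eqxx; case: eqP => [_|/eqP zw].
    by rewrite subrr nc0 ltW.
  have zw0 : 0 < nc (z - w) by rewrite nc_gt0 subr_eq0.
  rewrite -(ler_pM2r zw0) -ncM mulrBl divfK ?subr_eq0 //.
  by have := Hd _ hz; rewrite (_ : w + (z - w) = z); last by ring.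
- by rewrite eqxx.
Qed.

Lemma hasder_near f g w d (dl : R) : 0 < dl ->
  (forall z, nc (z - w) < dl -> f z = g z) -> hasder f w d -> hasder g w d.
Proof.
move=> dl0 fg Hf; apply: eps_hasder => e e0.
have [dl' dl'0 H] := hasder_eps Hf e0.
exists (Num.min dl dl') => [|h]; first by rewrite lt_min dl0.
rewrite lt_min => /andP[h1 h2]; rewrite -!fg ?H ?subrr ?nc0 //.
by rewrite addrC addKr.
Qed.

Lemma hasder_cont f w d : hasder f w d -> {for w, continuous f}.
Proof.
move=> [psi [fE cpsi _]].
have -> : f = (fun z => f w + psi z * (z - w)) by apply/funext.
exact: (cont_atD (@cont_at_cst (f w) w)
  (cont_atM cpsi (cont_atB (@cont_at_id w) (@cont_at_cst w w)))).
Qed.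

Lemma hasder_cst (c : C) w : hasder (cst c) w 0.
Proof. by exists (cst 0); split=> [z||//]; [rewrite mul0r addr0|exact: cont_at_cst]. Qed.

Lemma hasder_id w : hasder id w 1.
Proof.
exists (cst 1); split=> [z||//]; [by rewrite mul1r addrC subrK|exact: cont_at_cst].
Qed.

Lemma hasderD f g w a b : hasder f w a -> hasder g w b ->
  hasder (fun z => f z + g z) w (a + b).
Proof.
move=> [p [fE cp <-]] [q [gE cq <-]]; exists (fun z => p z + q z); split=> [||//].
  by move=> z; rewrite fE gE; ring.
exact: (cont_atD cp cq).
Qed.

Lemma hasderM f g w a b : hasder f w a -> hasder g w b ->
  hasder (fun z => f z * g z) w (a * g w + f w * b).
Proof.
move=> hf hg; have cg := hasder_cont hg; case: hf hg.
move=> p [fE cp <-] [q [gE cq <-]].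
exists (fun z => p z * g z + f w * q z); split=> [||//].
  by move=> z; rewrite [in LHS]fE [in LHS](gE z) (gE z); ring.
exact: (cont_atD (cont_atM cp cg) (cont_atM (@cont_at_cst (f w) w) cq)).
Qed.

Lemma hasderZ (c : C) f w a : hasder f w a -> hasder (fun z => c * f z) w (c * a).
Proof.
by move=> hf; have := hasderM (hasder_cst c w) hf; rewrite mul0r add0r.
Qed.

Lemma hasderB f g w a b : hasder f w a -> hasder g w b ->
  hasder (fun z => f z - g z) w (a - b).
Proof.
move=> hf hg; have := hasderD hf (hasderZ (-1) hg).
by rewrite mulN1r; under eq_fun do rewrite mulN1r.
Qed.

Lemma hasder_comp f g w a b : hasder f w a -> hasder g (f w) b ->
  hasder (fun z => g (f z)) w (b * a).
Proof.
move=> hf; have cf := hasder_cont hf; case: hf.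
move=> p [fE cp <-] [q [gE cq <-]].
exists (fun z => q (f z) * p z); split=> [||//].
  by move=> z; rewrite [in LHS]gE [in X in _ + _ * X]fE; ring.
exact: (cont_atM (continuous_comp cf cq) cp).
Qed.

Lemma hasder_affine (a b : C) w : hasder (fun z => a + b * z) w b.
Proof.
by have := hasderD (hasder_cst a w) (hasderZ b (hasder_id w)); rewrite add0r mulr1.
Qed.

Lemma hasder_inv w : w != 0 -> hasder (fun z => z^-1) w (- w ^- 2).
Proof.
move=> w0.
apply: (@hasder_near (fun z => if z == 0 then 0 else z^-1) _ _ _ 1) => //.
  by move=> z _; case: eqP => // ->; rewrite invr0.
(* Carathéodory's identity must hold at z = 0 too, where the inverse is 0 by convention: 0 = w^-1 +
   psi(0) (0 - w) forces psi(0) = w^-2. *)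
exists (fun z => if z == 0 then w^-2 else - (z * w)^-1); split.
- move=> z; rewrite (negPf w0); case: eqP => [->|/eqP z0]; first by field.
  by field; rewrite z0 w0.
- have H : {for w, continuous (fun z : C => - (z * w)^-1)}.
    have cm : {for w, continuous (fun z : C => z * w)}.
      exact: (cont_atM (@cont_at_id w) (@cont_at_cst w w)).
    suff : (fun z : C => - (z * w)^-1) @ w --> - (w * w)^-1 by [].
    apply: (@cvgN _ _ _ (nbhs w)); apply: (@cvgV _ _ (nbhs w)) => //.
    by rewrite mulf_neq0.
  apply/continuous_atP => e e0.
  have [dl dl0 Hd] := (continuous_atP _ _).1 H e e0.
  exists (Num.min dl (nc w)) => [|z]; first by rewrite lt_min dl0 nc_gt0.
  rewrite lt_min => /andP[/Hd h1 h2]; rewrite (negPf w0).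
  case: eqP => // z0; move: h2.
  by rewrite z0 sub0r ncN ltxx.
- by rewrite (negPf w0) expr2.
Qed.

Lemma hasder_div f g w a b : g w != 0 -> hasder f w a -> hasder g w b ->
  hasder (fun z => f z / g z) w (a / g w - f w * (b / g w ^+ 2)).
Proof.
move=> g0 hf hg; have := hasderM hf (hasder_comp hg (hasder_inv g0)).
by congr (hasder _ _ (_ + _)); rewrite mulNr mulrN [_ * b]mulrC.
Qed.

Lemma hasderX f w a k : hasder f w a ->
  hasder (fun z => f z ^+ k) w (k%:R * f w ^+ k.-1 * a).
Proof.
move=> hf; elim: k => [|k IH].
  by under eq_fun do rewrite expr0; rewrite !mul0r; exact: hasder_cst.
have := hasderM hf IH; under eq_fun do rewrite -exprS.
congr (hasder _ _ _); case: k {IH} => [|k] /=; first by rewrite !expr0; ring.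
by rewrite exprS -[k.+2%:R]natr1; ring.
Qed.

Lemma hasder_horner (p : {poly C}) w : hasder (horner p) w p^`().[w].
Proof.
elim/poly_ind: p => [|p c IH].
  rewrite deriv0 horner0 (_ : horner 0 = cst 0) ?funeqE; first exact: hasder_cst.
  by move=> z /=; rewrite horner0.
rewrite derivMXaddC (_ : horner _ = fun z => p.[z] * z + c); last first.
  by apply/funext => z; rewrite !hornerE.
have := hasderD (hasderM IH (hasder_id w)) (hasder_cst c w).
by congr (hasder _ _ _); rewrite !hornerE addrC.
Qed.

Lemma hasder_unique f w a b : hasder f w a -> hasder f w b -> a = b.
Proof.
move=> ha hb; apply/eqP; rewrite -subr_eq0 -nc_eq0.
rewrite eq_le nc_ge0 andbT; apply/ler_addgt0Pl => e e0; rewrite addr0.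
have [dl dl0 H] := hasder_eps (hasderB ha hb) e0.
have hd : nc (ofR (dl / 2)) = dl / 2 by rewrite nc_ofR gtr0_norm ?divr_gt0.
have := H (ofR (dl / 2)); rewrite hd => /(_ _)/wrap[]; first by lra.
rewrite !subrr sub0r ncN ncM hd ler_pM2r ?divr_gt0 //.
Qed.

End ComplexDerivative.

(** * Goursat's theorem and the mean value property *)

Section SegmentMean.
Variable R : realType.
Local Notation C := (Cplx R).
Local Notation nc := (@Normc.normc R).

(* Trapezoid mean of g over the segment [z, z + v] with 2^N subintervals. *)
Fixpoint tmean (V : lmodType C) (g : C -> V) (N : nat) (z v : C) : V :=
  if N is N'.+1 then
    2^-1 *: (tmean g N' z (v / 2) + tmean g N' (z + v / 2) (v / 2))
  else 2^-1 *: (g z + g (z + v)).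

(** A trapezoid mean is built from values of [g] on the segment by midpoints alone, so every
    midpoint-closed property passes to it: norm bounds, distances to a point, positivity of the real
    part. *)
Lemma tmean_ind (V : lmodType C) (P : V -> Prop) (g : C -> V) N z v :
  (forall x y, P x -> P y -> P (2^-1 *: (x + y))) ->
  (forall t : R, 0 <= t <= 1 -> P (g (z + ofR t * v))) -> P (tmean g N z v).
Proof.
move=> hP; elim: N z v => [|N IH] z v hg /=.
  apply: hP.
    by have := hg 0; rewrite rmorph0 mul0r addr0; apply; rewrite lexx ler01.
  by have := hg 1; rewrite rmorph1 mul1r; apply; rewrite lexx ler01.
apply: hP; apply: IH => t /andP[t0 t1].
  rewrite (_ : _ * _ = ofR (t / 2) * v); first by apply: hg; lra.
  by rewrite rmorphM fmorphV rmorphMn rmorph1; field.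
rewrite (_ : _ + _ = z + ofR ((t + 1) / 2) * v); first by apply: hg; lra.
by rewrite rmorphM fmorphV rmorphMn rmorphD rmorph1; field.
Qed.

Lemma tmean_ext (V : lmodType C) (f g : C -> V) N z v :
  (forall t : R, 0 <= t <= 1 -> f (z + ofR t * v) = g (z + ofR t * v)) ->
  tmean f N z v = tmean g N z v.
Proof.
elim: N z v => [|N IH] z v fg /=; congr (_ *: (_ + _)).
- by have := fg 0; rewrite rmorph0 mul0r addr0; apply; rewrite lexx ler01.
- by have := fg 1; rewrite rmorph1 mul1r; apply; rewrite lexx ler01.
- apply: IH => t /andP[t0 t1].
  rewrite (_ : _ * _ = ofR (t / 2) * v); first by apply: fg; lra.
  by rewrite rmorphM fmorphV rmorphMn rmorph1; field.
- apply: IH => t /andP[t0 t1].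
  rewrite (_ : _ + _ = z + ofR ((t + 1) / 2) * v); first by apply: fg; lra.
  by rewrite rmorphM fmorphV rmorphMn rmorphD rmorph1; field.
Qed.

Lemma tmean_linear (V W : lmodType C) (L : V -> W) (g : C -> V) N z v :
  (forall x y, L (2^-1 *: (x + y)) = 2^-1 *: (L x + L y)) ->
  tmean (L \o g) N z v = L (tmean g N z v).
Proof. by move=> hL; elim: N z v => [|N IH] z v /=; rewrite hL // !IH. Qed.

Lemma tmeanD (V : lmodType C) (f g : C -> V) N z v :
  tmean (fun w => f w + g w) N z v = tmean f N z v + tmean g N z v.
Proof.
elim: N z v => [|N IH] z v /=; rewrite -scalerDr; congr (_ *: _).
  by rewrite addrACA.
by rewrite !IH addrACA.
Qed.

Lemma tmean_shift (V : lmodType C) (g : C -> V) N z a v :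
  tmean g N (z + a) v = tmean (fun w => g (w + a)) N z v.
Proof.
elim: N z v => [|N IH] z v /=; first by rewrite (addrAC z).
by rewrite -!IH (addrAC z).
Qed.

Definition cmean (g : C -> C) : nat -> C -> C -> C := @tmean C^o g.

Lemma cmean0 g z v : cmean g 0 z v = 2^-1 * (g z + g (z + v)).
Proof. by []. Qed.

Lemma cmeanS g N z v : cmean g N.+1 z (v + v) =
  2^-1 * (cmean g N z v + cmean g N (z + v) v).
Proof.
rewrite [LHS](_ : _ = 2^-1 * (cmean g N z ((v + v) / 2) +
  cmean g N (z + (v + v) / 2) ((v + v) / 2))) //.
by rewrite (_ : (v + v) / 2 = v) //; field.
Qed.

Lemma cmeanD f g N z v :
  cmean (fun w => f w + g w) N z v = cmean f N z v + cmean g N z v.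
Proof. exact: (@tmeanD C^o). Qed.

Lemma cmeanZ c g N z v : cmean (fun w => c * g w) N z v = c * cmean g N z v.
Proof.
apply: (@tmean_linear C^o C^o (fun x => c * x)) => x y.
by rewrite /GRing.scale /=; ring.
Qed.

Lemma cmean_ext f g N z v :
  (forall t : R, 0 <= t <= 1 -> f (z + ofR t * v) = g (z + ofR t * v)) ->
  cmean f N z v = cmean g N z v.
Proof. exact: (@tmean_ext C^o). Qed.

Lemma cmean_shift g N z a v :
  cmean g N (z + a) v = cmean (fun w => g (w + a)) N z v.
Proof. exact: (@tmean_shift C^o). Qed.

Lemma cmean_dist g N z v c (K : R) :
  (forall t : R, 0 <= t <= 1 -> nc (g (z + ofR t * v) - c) <= K) ->
  nc (cmean g N z v - c) <= K.
Proof.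
move=> hg; apply: (@tmean_ind C^o (fun x => nc (x - c) <= K)) => // x y hx hy.
rewrite /GRing.scale /= (_ : _ - c = 2^-1 * ((x - c) + (y - c))); last by field.
have n2 : nc (2^-1 : C) = 2^-1.
  by rewrite -(rmorph_nat (@ofR R)) ncV nc_ofR ger0_norm.
by rewrite ncM n2 ler_pdivrMl // (le_trans (ncD _ _)) // mulr_natl mulr2n lerD.
Qed.

Lemma cmean_bound g N z v (K : R) :
  (forall t : R, 0 <= t <= 1 -> nc (g (z + ofR t * v)) <= K) ->
  nc (cmean g N z v) <= K.
Proof.
by move=> hg; rewrite -[cmean _ _ _ _]subr0; apply: cmean_dist => t /hg; rewrite subr0.
Qed.

Lemma cmean_affine a b N z v :
  cmean (fun w => a + b * w) N z v = a + b * (z + v / 2).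
Proof.
elim: N z v => [|N IH] z v; first by rewrite cmean0; field.
by rewrite [in LHS](_ : v = v / 2 + v / 2) ?cmeanS ?IH; field.
Qed.

End SegmentMean.

(** * Goursat's bisection on squares *)

Section Goursat.
Variable R : realType.
Local Notation C := (Cplx R).
Local Notation nc := (@Normc.normc R).

Definition ii : C := mkC 0 1.

Lemma nc_ii : nc ii = 1.
Proof.
by apply/eqP; rewrite -(@eqrXn2 _ 2) ?nc_ge0 // nc_sqr /= expr0n expr1n add0r.
Qed.

(* Trapezoid sum of g(w) dw along the boundary of the square with lower left
   corner z and side l. *)
Definition sqsum (g : C -> C) (N : nat) (z l : C) : C :=
  l * (cmean g N z l + ii * cmean g N (z + l) (ii * l)
       - cmean g N (z + ii * l) l - ii * cmean g N z (ii * l)).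

(** An inner edge of the subdivision belongs to two subsquares, which traverse it in opposite
    directions, so it cancels; each outer edge splits by [cmeanS]. One refinement level is spent on
    the split, hence [N.+1] on the left. *)
Lemma sqsumS g N z h : sqsum g N.+1 z (h + h) =
  sqsum g N z h + sqsum g N (z + h) h + sqsum g N (z + ii * h) h
  + sqsum g N (z + h + ii * h) h.
Proof.
rewrite /sqsum [ii * (h + h)]mulrDr !cmeanS !addrA.
rewrite (addrAC z (ii * h) h) (addrAC z (ii * h) (ii * h)).
rewrite (addrAC (z + h) (ii * h) h) (addrAC (z + ii * h) (ii * h) h).
rewrite (addrAC z (ii * h) h).
by field.
Qed.

(** The trapezoid rule is exact on affine functions, and their midpoint values, weighted by the edge
    directions, cancel around the square. Hence [g] may be replaced by its first order remainder at
    a point. *)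
Lemma sqsumB_affine g a b N z l :
  sqsum g N z l = sqsum (fun w => g w + (- a + - b * w)) N z l.
Proof.
have E y v : cmean (fun w => g w + (- a + - b * w)) N y v =
    cmean g N y v + (- a + - b * (y + v / 2)).
  by rewrite cmeanD cmean_affine.
rewrite /sqsum !E.
by field.
Qed.

Lemma sqsum_bound g N z (l K : R) : 0 <= l ->
  (forall s t : R, 0 <= s <= 1 -> 0 <= t <= 1 ->
     nc (g (z + ofR (s * l) + ofR (t * l) * ii)) <= K) ->
  nc (sqsum g N z (ofR l)) <= 4 * K * l.
Proof.
move=> l0 hg; rewrite /sqsum ncM nc_ofR ger0_norm // mulrC ler_wpM2r //.
have i01 : 0 <= (0 : R) <= 1 by rewrite lexx ler01.
have i11 : 0 <= (1 : R) <= 1 by rewrite lexx ler01.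
have b1 : nc (cmean g N z (ofR l)) <= K.
  apply: cmean_bound => t ht; have := hg t 0 ht i01.
  by rewrite mul0r rmorph0 mul0r addr0 rmorphM.
have b2 : nc (cmean g N (z + ofR l) (ii * ofR l)) <= K.
  apply: cmean_bound => t ht; have := hg 1 t i11 ht.
  by rewrite mul1r [ii * _]mulrC mulrA rmorphM.
have b3 : nc (cmean g N (z + ii * ofR l) (ofR l)) <= K.
  apply: cmean_bound => t ht; have := hg t 1 ht i11.
  by rewrite mul1r addrAC [ii * _]mulrC rmorphM.
have b4 : nc (cmean g N z (ii * ofR l)) <= K.
  apply: cmean_bound => t ht; have := hg 0 t i01 ht.
  by rewrite mul0r rmorph0 addr0 [ii * _]mulrC mulrA rmorphM.
apply: le_trans (ncB _ _) _; rewrite ncM nc_ii mul1r.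
have := ncB (cmean g N z (ofR l) + ii * cmean g N (z + ofR l) (ii * ofR l))
  (cmean g N (z + ii * ofR l) (ofR l)).
have := ncD (cmean g N z (ofR l)) (ii * cmean g N (z + ofR l) (ii * ofR l)).
rewrite ncM nc_ii mul1r; lra.
Qed.

Lemma nested_intervals (a c : nat -> R) :
  (forall k, a k <= a k.+1) -> (forall k, a k.+1 + c k.+1 <= a k + c k) ->
  (forall k, 0 <= c k) -> exists x, forall k, a k <= x <= a k + c k.
Proof.
move=> ha hc c0.
have ma : {homo a : i j / (i <= j)%N >-> i <= j} by exact: homo_leq (@lexx _ _) le_trans ha.
have mb : {homo (fun k => a k + c k) : i j / (i <= j)%N >-> i >= j}.
  apply: (@homo_leq _ (fun k => a k + c k) (fun x y => x >= y)) => //.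
  by move=> x y z h1 h2; exact: le_trans h2 h1.
have hac i j : a i <= a j + c j.
  have [ij|/ltnW ji] := leqP i j; first by rewrite (le_trans (ma _ _ ij))// lerDl.
  by rewrite (le_trans _ (mb _ _ ji)) // lerDl.
exists (sup (range a)) => k; apply/andP; split.
  by apply: ub_le_sup; [exists (a 0%N + c 0%N) => _ [i _ <-]|exists k].
by apply: ge_sup; [exists (a 0%N); exists 0%N|move=> _ [i _ <-]].
Qed.

Lemma goursat (g : C -> C) z0 :
  (forall s t : R, 0 <= s <= 1 -> 0 <= t <= 1 ->
     exists d, hasder g (z0 + ofR s + ofR t * ii) d) ->
  forall e : R, 0 < e -> exists N0 : nat, forall N, (N0 <= N)%N ->
    nc (sqsum g N z0 1) <= e.
Proof.
move=> hg e e0; apply: contrapT => nsmall.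
pose l (k : nat) : R := 2^-1 ^+ k.
pose pt (p : R * R) : C := z0 + ofR p.1 + ofR p.2 * ii.
(* The bound is proportional to the area, so it adds up over four subsquares. Smallness is asked for
   all large N only, since no limit in N is available and the threshold may depend on the square. *)
pose small (k : nat) (p : R * R) := exists N0 : nat, forall N, (N0 <= N)%N ->
  nc (sqsum g N (pt p) (ofR (l k))) <= e * l k ^+ 2.
have lS k : l k = l k.+1 + l k.+1 by rewrite /l exprS; field.
have l_gt0 k : 0 < l k by rewrite exprn_gt0.
have split4 k p : ~ small k p -> exists b : bool * bool,
    ~ small k.+1 (p.1 + b.1%:R * l k.+1, p.2 + b.2%:R * l k.+1).
  move=> hp; apply: contrapT => /forallNP hb; apply: hp.
  have {}hb (b : bool * bool) : small k.+1 (p.1 + b.1%:R * l k.+1, p.2 + b.2%:R * l k.+1).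
    exact: contrapT (hb b).
  have [N1 h1] := hb (false, false); have [N2 h2] := hb (true, false).
  have [N3 h3] := hb (false, true); have [N4 h4] := hb (true, true).
  exists (maxn (maxn N1 N2) (maxn N3 N4)).+1 => -[|N] //.
  rewrite ltnS !geq_max => /andP[/andP[/h1 {}h1 /h2 {}h2] /andP[/h3 {}h3 /h4 {}h4]].
  rewrite {1}lS rmorphD sqsumS.
  have -> : pt p = pt (p.1 + (false, false).1%:R * l k.+1,
                        p.2 + (false, false).2%:R * l k.+1).
    by rewrite /pt /= !mul0r !addr0.
  rewrite (_ : pt _ + ofR _ = pt (p.1 + (true, false).1%:R * l k.+1,
     p.2 + (true, false).2%:R * l k.+1)); last first.
    by rewrite /pt /= !mul0r !addr0 mul1r rmorphD; ring.
  rewrite (_ : pt _ + ii * ofR _ = pt (p.1 + (false, true).1%:R * l k.+1,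
     p.2 + (false, true).2%:R * l k.+1)); last first.
    by rewrite /pt /= !mul0r !addr0 mul1r rmorphD; ring.
  rewrite (_ : pt _ + ii * ofR _ = pt (p.1 + (true, true).1%:R * l k.+1,
     p.2 + (true, true).2%:R * l k.+1)); last first.
    by rewrite /pt /= !mul0r !addr0 !mul1r !rmorphD; ring.
  move: h1 h2 h3 h4; set x1 := sqsum _ _ _ _; set x2 := sqsum _ _ _ _.
  set x3 := sqsum _ _ _ _; set x4 := sqsum _ _ _ _ => h1 h2 h3 h4.
  have := ncD (x1 + x2 + x3) x4; have := ncD (x1 + x2) x3; have := ncD x1 x2.
  have -> : e * l k ^+ 2 = 4 * (e * l k.+1 ^+ 2) by rewrite lS; ring.
  move: h1 h2 h3 h4; set q := e * _; lra.
have /choice[F hF] : forall kp : nat * (R * R), exists b : bool * bool,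
    ~ small kp.1 kp.2 -> ~ small kp.1.+1 (kp.2.1 + b.1%:R * l kp.1.+1,
                                           kp.2.2 + b.2%:R * l kp.1.+1).
  move=> [k p] /=; have [/split4[b hb]|hs] := pselect (~ small k p).
    by exists b.
  by exists (true, true).
pose P := fix P k : R * R := if k is k'.+1 then
  ((P k').1 + (F (k', P k')).1%:R * l k,
   (P k').2 + (F (k', P k')).2%:R * l k) else (0, 0).
have Psmall k : ~ small k (P k).
  elim: k => [|k IH]; last by exact: (hF (k, P k) IH).
  move=> [N0 hN]; apply: nsmall; exists N0 => N /hN.
  by rewrite /pt /= rmorph0 mul0r !addr0 /l expr0 expr1n mulr1 rmorph1.
have bl (b : bool) k : 0 <= b%:R * l k <= l k.
  by case: b; rewrite ?mul1r ?mul0r lexx ltW.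
have [||k|x hx] := @nested_intervals (fun k => (P k).1) l; [| |exact/ltW|].
- by move=> k /=; have := bl (F (k, P k)).1 k.+1; lra.
- by move=> k /=; have := bl (F (k, P k)).1 k.+1; rewrite (lS k); lra.
have [||k|y hy] := @nested_intervals (fun k => (P k).2) l; [| |exact/ltW|].
- by move=> k /=; have := bl (F (k, P k)).2 k.+1; lra.
- by move=> k /=; have := bl (F (k, P k)).2 k.+1; rewrite (lS k); lra.
have [||d hd] := hg x y.
- by have := hx 0%N; rewrite /= /l expr0; lra.
- by have := hy 0%N; rewrite /= /l expr0; lra.
(* On the square of side l the remainder is at most e/8 times 2 l, and [sqsum_bound] multiplies it
   by 4 l, giving e l^2. *)
have e8 : 0 < e / 8 by lra.
have [dl dl0 Hd] := hasder_eps hd e8.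
have [k hk] : exists k, 2 * l k < dl.
  have : l @ \oo --> (0 : R) by apply: cvg_expr; rewrite ger0_norm; lra.
  move/cvgrPdist_lt => /(_ (dl / 2)); rewrite divr_gt0 // => /(_ isT)[k _ hk].
  exists k; have := hk k (leqnn k) => /=.
  by rewrite sub0r normrN gtr0_norm // ltr_pdivlMr // mulrC.
apply: (Psmall k); exists 0%N => N _.
set w0 := z0 + ofR x + ofR y * ii in Hd.
rewrite (@sqsumB_affine _ (g w0 - d * w0) d).
have -> : e * l k ^+ 2 = 4 * (e / 8 * (2 * l k)) * l k by field.
apply: sqsum_bound => [|s t hs ht]; first exact: ltW.
set w := pt (P k) + _ + _.
rewrite (_ : g w + _ = g (w0 + (w - w0)) - g w0 - d * (w - w0)); last first.
  by rewrite (_ : w0 + (w - w0) = w); ring.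
have hw : nc (w - w0) <= 2 * l k.
  apply: le_trans (nc_le_reim _) _.
  have -> : re (w - w0) = (P k).1 + s * l k - x.
    by rewrite /w /w0 /pt !reimE; ring.
  have -> : im (w - w0) = (P k).2 + t * l k - y.
    by rewrite /w /w0 /pt !reimE; ring.
  have lk := l_gt0 k; have hxk := hx k; have hyk := hy k.
  have : 0 <= s * l k <= l k by nra.
  have : 0 <= t * l k <= l k by nra.
  move=> h1 h2; rewrite [2 * _]mulr_natl mulr2n lerD // ler_norml; lra.
apply: le_trans (Hd _ _) _; first exact: le_lt_trans hk.
by rewrite ler_wpM2l // ltW.
Qed.

End Goursat.

(** * The complex exponential and means over circles *)

Section MeanValueProperty.
Variable R : realType.
Local Notation C := (Cplx R).
Local Notation nc := (@Normc.normc R).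

Lemma derivable_eps (f : R -> R) (x d : R) : is_derive x 1 f d ->
  forall e : R, 0 < e -> exists2 dl : R, 0 < dl &
    forall h, `|h| < dl -> `|f (x + h) - f x - d * h| <= e * `|h|.
Proof.
move=> hd e e0; have [hdf hdE] := hd.
have /cvgrPdist_le /(_ e e0) := hdf.
rewrite -/(derive f x 1) hdE => /nbhs_ballP[dl /= dl0 H].
exists dl => // h hh; have [->|h0] := eqVneq h 0.
  by rewrite addr0 subrr mulr0 subrr !normr0 mulr0.
have := H h; rewrite /ball /= sub0r normrN => /(_ hh h0).
rewrite /GRing.scale /= mulr1 => hle.
rewrite -(ler_pM2r (_ : 0 < `|h|^-1)) ?invr_gt0 ?normr_gt0 //.
rewrite mulfK ?normr_eq0 // -normfV -normrM (le_trans _ hle) // -normrN.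
by rewrite le_eqVlt; apply/orP; left; apply/eqP; congr `|_|; rewrite [h + x]addrC; field.
Qed.

Definition cexp (w : C) : C := mkC (expR (re w) * cos (im w)) (expR (re w) * sin (im w)).

Lemma cexpD z w : cexp (z + w) = cexp z * cexp w.
Proof. by apply: complex_ext; rewrite /cexp !reimE expRD ?cosD ?sinD; ring. Qed.

Lemma nc_cexp w : nc (cexp w) = expR (re w).
Proof.
apply/eqP; rewrite -(@eqrXn2 _ 2) ?nc_ge0 ?expR_ge0 // nc_sqr !reimE.
by rewrite !exprMn -mulrDr cos2Dsin2 mulr1.
Qed.

Lemma cexp_ofR r : cexp (ofR r) = ofR (expR r).
Proof. by apply: complex_ext; rewrite /cexp !reimE ?cos0 ?sin0 ?mulr1 ?mulr0. Qed.

Lemma hasder_cexp w : hasder cexp w (cexp w).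
Proof.
suff H0 : hasder cexp 0 1.
  rewrite (_ : cexp = fun z => cexp w * cexp (- w + 1 * z)); last first.
    by apply/funext => z; rewrite -cexpD; congr cexp; ring.
  have H : hasder (fun z => - w + 1 * z) w 1 by exact: hasder_affine.
  have H1 : hasder cexp (- w + 1 * w) 1 by rewrite mul1r addNr.
  have := hasderZ (cexp w) (hasder_comp H H1).
  by congr (hasder _ _ _); rewrite -cexpD !mulr1; congr cexp; ring.
apply: eps_hasder => e e0.
(* With relative remainders at most e' for exp, sin and cos, the real part of the error is at most 3
   e' |h| and the imaginary part at most 5 e' |h|, together 8 e' |h|. The bound e' <= 1 controls the
   factors 1 + a and 1 + a + p. *)
have [e' [e'0 e'e e'1]] : exists e' : R, [/\ 0 < e', e' <= e / 8 & e' <= 1].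
  exists (Num.min (e / 8) 1); rewrite lt_min ltr01 andbT divr_gt0 //.
  by rewrite !ge_min !lexx orbT.
have [d1 d10 H1] := derivable_eps (is_derive_expR (0 : R)) e'0.
have [d2 d20 H2] := derivable_eps (is_derive_sin (0 : R)) e'0.
have [d3 d30 H3] := derivable_eps (is_derive_cos (0 : R)) e'0.
exists (Num.min (Num.min d1 d2) (Num.min d3 e')) => [|h].
  by rewrite !lt_min d10 d20 d30 e'0.
rewrite !lt_min => /andP[/andP[h1 h2] /andP[h3 h4]].
have ha := re_abs_le_nc h; have hb := im_abs_le_nc h.
have := H1 (re h) (le_lt_trans ha h1); have := H2 (im h) (le_lt_trans hb h2).
have := H3 (im h) (le_lt_trans hb h3).
rewrite !add0r expR0 sin0 cos0 oppr0 mul0r !subr0 !mul1r !addr0.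
move=> K3 K2 K1; apply: le_trans (nc_le_reim _) _; rewrite /cexp !reimE.
have : `|re h| <= e' by rewrite (le_trans ha) // ltW.
move: ha hb K1 K2 K3; set a := re h; set b := im h => ha hb K1 K2 K3 ae'.
have c1 : `|cos b| <= 1 by rewrite ler_norml cos_geN1 cos_le1.
rewrite expR0 cos0 sin0 mulr1 mulr0.
have -> : expR a * cos b - 1 - a = (expR a - 1 - a) * cos b + (1 + a) * (cos b - 1).
  by ring.
have -> : expR a * sin b - 0 - b =
    (1 + a + (expR a - 1 - a)) * (sin b - b) + (a + (expR a - 1 - a)) * b.
  by ring.
move: K1 K2 K3; set p := expR a - 1 - a; set q := sin b - b; set s := cos b - 1.
move=> K1 K2 K3.
have B1 : `|p * cos b + (1 + a) * s| <= e' * `|a| + 2 * (e' * `|b|).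
  apply: le_trans (ler_normD _ _) _; rewrite !normrM lerD //.
    by rewrite -[leRHS]mulr1 ler_pM.
  rewrite ler_pM // (le_trans (ler_normD _ _)) // normr1; lra.
have B2 : `|(1 + a + p) * q + (a + p) * b| <= 3 * (e' * `|b|) + 2 * e' * `|b|.
  apply: le_trans (ler_normD _ _) _; rewrite !normrM.
  have pe : `|p| <= e' by rewrite (le_trans K1) // ger_pMr //; lra.
  rewrite lerD // ler_pM //.
    have := ler_normD (1 + a) p; have := ler_normD 1 a; rewrite normr1; lra.
  have := ler_normD a p; lra.
have k1 : e' * `|a| <= e' * nc h by rewrite ler_wpM2l // ltW.
have k2 : e' * `|b| <= e' * nc h by rewrite ler_wpM2l // ltW.
have k3 : e' * nc h <= e / 8 * nc h by rewrite ler_wpM2r // nc_ge0.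
move: B1 B2; lra.
Qed.

Definition clim (u : nat -> C) (l : C) := forall e : R, 0 < e ->
  exists N0 : nat, forall N, (N0 <= N)%N -> nc (u N - l) <= e.

Lemma climD u v a b : clim u a -> clim v b -> clim (fun N => u N + v N) (a + b).
Proof.
move=> hu hv e e0; have e2 : 0 < e / 2 by lra.
have [N1 h1] := hu _ e2; have [N2 h2] := hv _ e2.
exists (maxn N1 N2) => N; rewrite geq_max => /andP[/h1 {}h1 /h2 {}h2].
rewrite (_ : _ - _ = (u N - a) + (v N - b)); last by ring.
by apply: le_trans (ncD _ _) _; lra.
Qed.

Lemma climZ c u a : clim u a -> clim (fun N => c * u N) (c * a).
Proof.
move=> hu e e0; have c1 : 0 < nc c + 1 by have := nc_ge0 c; lra.
have [N1 h1] := hu _ (divr_gt0 e0 c1); exists N1 => N /h1 {}h1.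
rewrite -mulrBr ncM; apply: le_trans (_ : (nc c + 1) * (e / (nc c + 1)) <= _).
  by rewrite ler_pM ?nc_ge0 // lerDl.
by rewrite mulrC divfK // gt_eqF.
Qed.

Lemma clim_cst a : clim (fun=> a) a.
Proof. by move=> e e0; exists 0%N => N _; rewrite subrr nc0 ltW. Qed.

Lemma clim_bound u l c (K : R) :
  (forall N, nc (u N - c) <= K) -> clim u l -> nc (l - c) <= K.
Proof.
move=> hu hl; apply/ler_addgt0Pl => e /hl[N hN].
rewrite (_ : l - c = (u N - c) - (u N - l)); last by ring.
by apply: le_trans (ncB _ _) _; rewrite addrC lerD // hN.
Qed.

Lemma clim_unique u a b : clim u a -> clim u b -> a = b.
Proof.
move=> ha hb; apply/eqP; rewrite -subr_eq0 -nc_eq0 eq_le nc_ge0 andbT.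
apply/ler_addgt0Pl => e e0; rewrite addr0.
have e2 : 0 < e / 2 by lra.
have [N1 h1] := ha _ e2; have [N2 h2] := hb _ e2.
have := h1 (maxn N1 N2) (leq_maxl _ _); have := h2 (maxn N1 N2) (leq_maxr _ _).
set x := u _ => h4 h3; rewrite (_ : a - b = (x - b) - (x - a)); last by ring.
by apply: le_trans (ncB _ _) _; lra.
Qed.

Lemma clim_ext u v a : u =1 v -> clim u a -> clim v a.
Proof. by move=> uv hu e /hu[N0 h]; exists N0 => N /h; rewrite uv. Qed.

(** Vertical segments of length 1 become circles and a shift by -1 divides the radius by exp(2 pi),
    so a unit square becomes a full annulus and a theorem about squares applies to it. *)
Definition circpt (r : R) (w : C) : C := ofR r * cexp (ofR (2 * pi) * w).

(* w runs over the segment [0, i], so the points run once around |z| = r. *)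
Definition circmean (f : C -> C) (N : nat) (r : R) : C :=
  cmean (fun w => f (circpt r w)) N 0 (ii R).

Lemma nc_circpt (r : R) w : 0 <= r -> nc (circpt r w) = r * expR (2 * pi * re w).
Proof.
move=> r0; rewrite /circpt ncM nc_cexp nc_ofR ger0_norm //.
by rewrite !reimE mul0r subr0.
Qed.

Lemma nc_circpt_seg (r t : R) : 0 <= r -> nc (circpt r (0 + ofR t * ii R)) = r.
Proof.
move=> r0; rewrite nc_circpt // !reimE.
by rewrite !(mulr0, mul0r, mulr1, mul1r, addr0, add0r, oppr0, expR0).
Qed.

Lemma circmean_bound f N (r K : R) c : 0 <= r ->
  (forall z, nc z = r -> nc (f z - c) <= K) -> nc (circmean f N r - c) <= K.
Proof.
by move=> r0 hf; apply: cmean_dist => t _; apply: hf; rewrite nc_circpt_seg.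
Qed.

Lemma circmean_ext f g N (r : R) : 0 <= r ->
  (forall z, nc z = r -> f z = g z) -> circmean f N r = circmean g N r.
Proof.
by move=> r0 fg; apply: cmean_ext => t _; apply: fg; rewrite nc_circpt_seg.
Qed.

Lemma circmeanD f g N r :
  circmean (fun z => f z + g z) N r = circmean f N r + circmean g N r.
Proof. exact: cmeanD. Qed.

Lemma circmeanZ c f N r : circmean (fun z => c * f z) N r = c * circmean f N r.
Proof. exact: cmeanZ. Qed.

(** Goursat's theorem for the pullback of [f] by [circpt] to the unit square with lower left corner
    -1: the horizontal edges cancel by periodicity, and the vertical ones are the circle means for
    the two radii. *)
Lemma circmean_step f (r : R) : 0 < r ->
  (forall z, r * expR (- (2 * pi)) <= nc z <= r -> exists d, hasder f z d) ->
  clim (fun N => circmean f N r - circmean f N (r * expR (- (2 * pi)))) 0.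
Proof.
move=> r0 hf; pose g w := f (circpt r w).
have pi0 : 0 < pi :> R := pi_gt0 R.
have hg : forall s t : R, 0 <= s <= 1 -> 0 <= t <= 1 ->
    exists d, hasder g (ofR (-1) + ofR s + ofR t * ii R) d.
  move=> s t /andP[s0 s1] ht; set w := _ + _.
  have hw : re w = s - 1 by rewrite /w !reimE; ring.
  have [|d hd] := hf (circpt r w).
    rewrite nc_circpt ?(ltW r0) // hw ler_pM2l // ler_expR; apply/andP; split.
      nra.
    by rewrite ger_pMr // expR_le1; nra.
  exists (d * (ofR r * (cexp (ofR (2 * pi) * w) * (ofR (2 * pi))))).
  apply: hasder_comp hd; apply: hasderZ.
  have h1 : hasder (fun z => 0 + ofR (2 * pi) * z) w (ofR (2 * pi)).
    exact: hasder_affine.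
  have h2 : hasder cexp (0 + ofR (2 * pi) * w) (cexp (ofR (2 * pi) * w)).
    by rewrite add0r; exact: hasder_cexp.
  by have := hasder_comp h1 h2; under eq_fun do rewrite add0r.
move=> e e0; have [N0 H] := goursat hg e0; exists N0 => N /H.
suff -> : sqsum g N (ofR (-1)) 1 =
    ii R * (circmean f N r - circmean f N (r * expR (- (2 * pi)))).
  by rewrite ncM nc_ii mul1r subr0.
have periodic w : circpt r (w + ii R) = circpt r w.
  rewrite /circpt mulrDr cexpD; congr (_ * _).
  rewrite (_ : cexp (ofR (2 * pi) * ii R) = 1) ?mulr1 //.
  apply: complex_ext; rewrite /cexp !reimE !(mulr0, mul0r, mulr1, mul1r, addr0, add0r,
    oppr0, expR0) mulr_natl ?cos2pi ?sin2pi //.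
rewrite /sqsum !mul1r mulr1.
rewrite [cmean g N (_ + ii R) 1]cmean_shift.
rewrite (_ : (fun w => g (w + ii R)) = g); last first.
  by apply/funext => w; rewrite /g periodic.
rewrite (_ : ofR (-1) + 1 = 0) ?rmorphN ?rmorph1 ?addNr //.
rewrite -[X in _ - ii R * cmean _ _ X _]add0r cmean_shift.
rewrite (_ : (fun w => g (w + -1)) = fun w => f (circpt (r * expR (- (2 * pi))) w)).
  by rewrite /circmean; ring.
apply/funext => w; rewrite /g; congr f.
rewrite /circpt mulrDr cexpD [ofR (r * _)]rmorphM.
rewrite (_ : ofR (2 * pi) * -1 = ofR (- (2 * pi))) ?cexp_ofR; first by ring.
by rewrite rmorphN mulrN1.
Qed.

(** Finitely many uses of [circmean_step] shrink the circle until continuity at 0 makes [f] nearly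
    [f 0] on it. Holomorphy off 0 with continuity at 0 is the situation of a quotient by z^k. *)
Lemma mean_value f (r : R) : 0 < r ->
  (forall z, 0 < nc z <= r -> exists d, hasder f z d) -> {for 0, continuous f} ->
  clim (circmean f ^~ r) (f 0).
Proof.
move=> r0 hf cf e e0; have e2 : 0 < e / 2 by lra.
have [dl dl0 Hd] := (continuous_atP _ _).1 cf _ e2.
pose q : R := expR (- (2 * pi)).
have q0 : 0 < q := expR_gt0 _.
have q1 : q < 1 by rewrite expR_lt1 oppr_lt0 mulr_gt0 // pi_gt0.
have [k hk] : exists k, r * q ^+ k < dl.
  have : (fun k => q ^+ k) @ \oo --> (0 : R) by apply: cvg_expr; rewrite gtr0_norm.
  move/cvgrPdist_lt => /(_ (dl / r)); rewrite divr_gt0 // => /(_ isT)[k _ hk].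
  exists k; have := hk k (leqnn k) => /=.
  by rewrite sub0r normrN gtr0_norm ?exprn_gt0 // ltr_pdivlMr // mulrC.
have rq j : 0 < r * q ^+ j by rewrite mulr_gt0 // exprn_gt0.
have step : clim (fun N => circmean f N r - circmean f N (r * q ^+ k)) 0.
  elim: k {hk} => [|k IH].
    by rewrite expr0 mulr1; under eq_fun do rewrite subrr; exact: clim_cst.
  have := climD IH (@circmean_step f (r * q ^+ k) (rq k) _).
  rewrite addr0 => H; apply: clim_ext (H _) => [N|z /andP[z1 z2]].
    by rewrite addrA subrK exprSr mulrA.
  apply: hf; rewrite (lt_le_trans _ z1) ?mulr_gt0 ?expR_gt0 ?exprn_gt0 //=.
  by rewrite (le_trans z2) // ger_pMr // exprn_ile1 // ltW.
have [N0 H] := step _ e2; exists N0 => N /H; rewrite subr0 => {}H.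
have hc : nc (circmean f N (r * q ^+ k) - f 0) <= e / 2.
  apply: circmean_bound => [|z hz]; first exact/ltW.
  by apply: Hd; rewrite subr0 hz.
rewrite (_ : _ - _ = (circmean f N r - circmean f N (r * q ^+ k)) +
  (circmean f N (r * q ^+ k) - f 0)); last by ring.
by apply: le_trans (ncD _ _) _; lra.
Qed.

(* The mean over |z| = r is asymptotically that over the larger circle |z| = s,
   which is at most s^-k in modulus. *)
Lemma circmean_negpow (r : R) k : 0 < r -> (0 < k)%N ->
  clim (circmean (fun z => z ^- k) ^~ r) 0.
Proof.
move=> r0 k0 e e0; have e2 : 0 < e / 2 by lra.
pose q : R := expR (- (2 * pi)).
have q0 : 0 < q := expR_gt0 _.
have q1 : q < 1 by rewrite expR_lt1 oppr_lt0 mulr_gt0 // pi_gt0.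
have rk0 : 0 < r ^+ k by rewrite exprn_gt0.
have [j hj] : exists j, (r * q^-1 ^+ j) ^- k <= e / 2.
  have : (fun j => (q ^+ k) ^+ j) @ \oo --> (0 : R).
    by apply: cvg_expr; rewrite gtr0_norm ?exprn_gt0 // exprn_ilt1 ?ltW // -lt0n.
  move/cvgrPdist_le => /(_ (r ^+ k * (e / 2))); rewrite mulr_gt0 // => /(_ isT)[j _ hj].
  exists j; have := hj j (leqnn j) => /=.
  rewrite sub0r normrN gtr0_norm ?exprn_gt0 // mulrC -ler_pdivrMr // => h.
  rewrite (le_trans _ h) // le_eqVlt; apply/orP; left; apply/eqP.
  by rewrite exprMn invfM exprVn exprVn invrK mulrC exprAC.
have rq i : 0 < r * q^-1 ^+ i by rewrite mulr_gt0 // exprn_gt0 // invr_gt0.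
pose f (z : C) : C := z ^- k.
have step : clim (fun N => circmean f N (r * q^-1 ^+ j) - circmean f N r) 0.
  elim: j {hj} => [|j IH].
    by rewrite expr0 mulr1; under eq_fun do rewrite subrr; exact: clim_cst.
  have := climD IH (@circmean_step f (r * q^-1 ^+ j.+1) (rq _) _).
  have -> : r * q^-1 ^+ j.+1 * expR (- (2 * pi)) = r * q^-1 ^+ j.
    by rewrite -/q exprSr mulrA divfK // gt_eqF.
  rewrite addr0 => H; apply: clim_ext (H _) => [N|z /andP[z1 z2]].
    by rewrite addrC addrA subrK.
  have zn0 : z != 0 by rewrite -nc_gt0 (lt_le_trans _ z1).
  exists (- (k%:R * z ^+ k.-1 * 1) / (z ^+ k) ^+ 2).
  have zk0 : z ^+ k != 0 by rewrite expf_neq0.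
  have := hasder_comp (hasderX k (hasder_id z)) (hasder_inv zk0).
  by congr (hasder _ _ _); rewrite mulNr mulNr mulrC.
have aux (a b : C) : nc b <= e / 2 -> nc (b - a - 0) <= e / 2 -> nc (a - 0) <= e.
  move=> h1; rewrite !subr0 => h2.
  rewrite (_ : a = b - (b - a)); last by ring.
  by apply: le_trans (ncB _ _) _; lra.
have [N0 H] := step _ e2; exists N0 => N /H; apply: aux.
rewrite -[circmean _ _ _]subr0; apply: circmean_bound => [|z hz]; first exact/ltW.
by rewrite subr0 ncV ncX hz.
Qed.

Lemma circmean_pow (r : R) k : 0 < r -> (0 < k)%N ->
  clim (circmean (fun z => z ^+ k) ^~ r) 0.
Proof.
move=> r0 k0; have hd (z : C) : hasder (fun z => z ^+ k) z (k%:R * z ^+ k.-1 * 1).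
  exact: (hasderX k (hasder_id z)).
have := @mean_value (fun z => z ^+ k) r r0 _ (hasder_cont (hd 0)).
by rewrite expr0n eqn0Ngt k0; apply => z _; exists (k%:R * z ^+ k.-1 * 1).
Qed.

End MeanValueProperty.

(** * Cauchy estimates and iterated Fréchet derivatives *)

Section CauchyEstimates.
Variable R : realType.
Local Notation C := (Cplx R).
Local Notation nc := (@Normc.normc R).

Lemma hasder_real (F : C -> C) (t : R) D : hasder F (ofR t) D ->
  is_derive t 1 (fun s => re (F (ofR s))) (re D).
Proof.
move=> hF; set g := fun s => _.
suff H : (fun h => h^-1 *: (g (h *: 1 + t) - g t)) @ 0^' --> re D.
  by split; [apply/cvg_ex; exists (re D)|apply/cvg_lim].
apply/cvgrPdist_le => e e0; have [dl dl0 Hd] := hasder_eps hF e0.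
apply/nbhs_ballP; exists dl => //= h; rewrite /ball /= sub0r normrN => hh h0.
have := Hd (ofR h); rewrite nc_ofR => /(_ hh) H.
rewrite /GRing.scale /= mulr1.
have hn0 : 0 < `|h| by rewrite normr_gt0.
rewrite -(ler_pM2r hn0) -normrM mulrBl -normrN.
apply: le_trans H; apply: le_trans (re_abs_le_nc _).
rewrite le_eqVlt; apply/orP; left; apply/eqP; congr `|_|.
rewrite !reimE mulr0 subr0 -rmorphD /g [h + t]addrC; field.
exact: h0.
Qed.

(** The difference is rotated onto the positive axis; the real mean value theorem is then applied to
    the real part of the rotated function on the segment. *)
Lemma mean_value_ineq (f : C -> C) w h (K : R) :
  (forall t : R, 0 <= t <= 1 ->
     exists2 d, hasder f (w + ofR t * h) d & nc d <= K) ->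
  nc (f (w + h) - f w) <= K * nc h.
Proof.
move=> hf; have [u u1 hu] := rotation (f (w + h) - f w).
pose F z := u * f (w + h * z); pose g (s : R) := re (F (ofR s)).
have hg (t : R) : 0 <= t <= 1 ->
    exists2 d, is_derive t 1 g d & d <= K * nc h.
  move=> /hf[d hd dK]; exists (re (u * (d * h))); last first.
    by rewrite (le_trans (re_le_nc _)) // !ncM u1 mul1r ler_wpM2r // nc_ge0.
  apply: (@hasder_real F); apply: hasderZ.
  apply: (@hasder_comp _ (fun z => w + h * z) f); first exact: hasder_affine.
  by rewrite mulrC.
have [||c cI] := @MVT _ g (fun x => 'D_1 g x) 0 1 ltr01.
- move=> x; rewrite in_itv /= => /andP[/ltW x0 /ltW x1].
  have [|d [hd _] _] := hg x; first by rewrite x0.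
  exact/derivableP.
- apply: derivable_within_continuous => x; rewrite in_itv /= => hx.
  by have [d [hd _] _] := hg x hx.
rewrite subr0 mulr1 => gE.
have {}cI : 0 <= c <= 1 by move: cI; rewrite in_itv /= => /andP[/ltW -> /ltW].
have [d [_ hd] dK] := hg c cI; rewrite hd in gE.
rewrite -hu mulrBr reD reN.
have -> : u * f (w + h) = F (ofR 1) by rewrite /F rmorph1 mulr1.
have -> : u * f w = F (ofR 0) by rewrite /F rmorph0 mulr0 addr0.
by rewrite -/(g 1) -/(g 0) gE.
Qed.

(** Degree below k leaves only negative powers of z in the quotient, whose means tend to 0; the
    induction splits (p z + c) / z^(k+1) into p / z^k and c / z^(k+1). *)
Lemma circmean_poly_div (p : {poly C}) k (r : R) : 0 < r -> (size p <= k)%N ->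
  clim (circmean (fun z => p.[z] / z ^+ k) ^~ r) 0.
Proof.
move=> r0; elim/poly_ind: p k => [|p c IH] k sp.
  apply: clim_ext (@clim_cst _ 0) => N.
  rewrite -(mul0r (circmean (fun=> 0) N r)) -circmeanZ.
  by apply: circmean_ext => [|z _]; rewrite ?ltW // horner0 !mul0r.
case: k sp => [|k]; first by rewrite leqn0 size_poly_eq0 => /eqP ->;
  apply: clim_ext (@clim_cst _ 0) => N;
  rewrite -(mul0r (circmean (fun=> 0) N r)) -circmeanZ;
  apply: circmean_ext => [|z _]; rewrite ?ltW // horner0 !mul0r.
rewrite size_MXaddC => sp.
have {sp} sp : (size p <= k)%N.
  move: sp; case: ifP => [/andP[/eqP-> _]|]; by rewrite ?size_poly0.
have := climD (IH _ sp) (climZ c (circmean_negpow r0 (ltn0Sn k))).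
rewrite mulr0 addr0; apply: clim_ext => N.
rewrite -circmeanZ -circmeanD; apply: circmean_ext => [|z hz]; first exact/ltW.
have z0 : z != 0 by rewrite -nc_gt0 hz.
by rewrite !hornerE exprSr; field; rewrite z0 expf_neq0.
Qed.

(** Cauchy's formula for a coefficient: f / z^k is [psi] plus negative powers of z. Off 0, [psi] is
    the quotient (f - p) / z^k, so the mean value property applies to it. *)
Lemma clim_coef (f psi : C -> C) (p : {poly C}) k (r : R) : 0 < r ->
  (size p <= k)%N -> (forall z, f z = p.[z] + psi z * z ^+ k) ->
  {for 0, continuous psi} ->
  (forall z, nc z <= r -> exists d, hasder f z d) ->
  clim (circmean (fun z => f z / z ^+ k) ^~ r) (psi 0).
Proof.
move=> r0 sp fE cpsi hf.
have hpsi z : 0 < nc z <= r -> exists d, hasder psi z d.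
  move=> /andP[z0 /hf[d hd]]; have zn0 : z != 0 by rewrite -nc_gt0.
  have zk0 : z ^+ k != 0 by rewrite expf_neq0.
  have := @hasder_div _ (fun z => f z - p.[z]) (fun z => z ^+ k) z _ _ zk0
    (hasderB hd (hasder_horner p z)) (hasderX k (hasder_id z)).
  (* The disc of radius |z| around z avoids 0. *)
  move=> H; eexists; apply: hasder_near (H) => [|y]; first exact: z0.
  move=> hy; have y0 : y != 0.
    by apply: contraTN hy => /eqP ->; rewrite sub0r ncN ltxx.
  by rewrite fE addrC addKr mulfK // expf_neq0.
have := climD (circmean_poly_div r0 sp) (mean_value r0 hpsi cpsi).
rewrite add0r; apply: clim_ext => N.
rewrite -circmeanD; apply: circmean_ext => [|z hz]; first exact/ltW.
have z0 : z != 0 by rewrite -nc_gt0 hz.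
by rewrite fE mulrDl mulfK // expf_neq0.
Qed.

(** Carathéodory's quotient function at [w] is continuous there with value [d], so [clim_coef] with
    k = 1 writes [d] as a limit of means of f(w + z) / z over |z| = s, and each integrand is at most
    M / s. *)
Lemma cauchy_estimate (f : C -> C) w d (s rho M : R) : 0 < s < rho ->
  (forall z, nc (z - w) < rho -> exists d, hasder f z d) ->
  (forall z, nc (z - w) < rho -> nc (f z) <= M) ->
  hasder f w d -> nc d <= M / s.
Proof.
move=> /andP[s0 srho] hf hM hd.
pose F z := f (w + 1 * z).
have hF z : nc z <= s -> exists d, hasder F z d.
  move=> hz; have [|d' hd'] := hf (w + 1 * z).
    by rewrite mul1r addrC addKr; exact: le_lt_trans srho.
  by exists (d' * 1);
  exact: (@hasder_comp _ (fun z => w + 1 * z) f z _ _ (@hasder_affine _ _ _ _) hd').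
have [psi [FE cpsi psi0]] : hasder F 0 d.
  rewrite -[d]mulr1; apply: (@hasder_comp _ (fun z => w + 1 * z) f).
    exact: hasder_affine.
  by rewrite mulr0 addr0.
have := @clim_coef F psi (F 0)%:P 1 s s0 (size_polyC_leq1 _) _ cpsi hF.
rewrite psi0 => /(_ _)/wrap[z|H].
  by rewrite hornerC FE subr0 expr1.
rewrite -[d]subr0; apply: clim_bound H => N.
apply: circmean_bound => [|z hz]; first exact/ltW.
rewrite subr0 ncM ncV expr1 hz ler_wpM2r ?invr_ge0 ?(ltW s0) // hM //.
by rewrite mul1r addrC addKr hz.
Qed.

(** The second derivative never appears. Cauchy's estimate with radius rho/4 makes [f] Lipschitz
    with constant 4 M / rho; the estimate with radius rho/8, applied to f(z + k) - f(z), bounds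
    f'(k) - f'(0) by 32 M |k| / rho^2; the mean value inequality for f(z) - d z concludes. *)
Lemma taylor2_estimate (f : C -> C) (rho M : R) d h : 0 < rho ->
  (forall z, nc z < rho -> exists d, hasder f z d) ->
  (forall z, nc z < rho -> nc (f z) <= M) ->
  hasder f 0 d -> nc h <= rho / 4 ->
  nc (f h - f 0 - d * h) <= 32 * M * (nc h / rho) ^+ 2.
Proof.
move=> rho0 hf hM hd hh.
have M0 : 0 <= M by apply: le_trans (nc_ge0 (f 0)) _; rewrite hM ?nc0.
have lip w k : nc w <= rho / 4 -> nc k <= rho / 4 ->
    nc (f (w + k) - f w) <= 4 * M / rho * nc k.
  move=> hw hk; apply: mean_value_ineq => t /andP[t0 t1].
  have hwk : nc (w + ofR t * k) <= rho / 2.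
    apply: le_trans (ncD _ _) _; rewrite ncM nc_ofR ger0_norm //.
    have := nc_ge0 k; nra.
  have [|d' hd'] := hf (w + ofR t * k); first by lra.
  exists d' => //.
  have near z : nc (z - (w + ofR t * k)) < rho / 2 -> nc z < rho.
    by move=> hz; have := nc_le_dist z (w + ofR t * k); lra.
  have -> : 4 * M / rho = M / (rho / 4) by field; rewrite gt_eqF.
  apply: (@cauchy_estimate f (w + ofR t * k) d' (rho / 4) (rho / 2)) => //.
  - by apply/andP; split; lra.
  - by move=> z /near; exact: hf.
  - by move=> z /near; exact: hM.
have lipD k e : nc k <= rho / 4 -> hasder f k e ->
    nc (e - d) <= 32 * M / rho ^+ 2 * nc k.
  move=> hk he.
  have -> : 32 * M / rho ^+ 2 * nc k = 4 * M / rho * nc k / (rho / 8).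
    by field; rewrite gt_eqF.
  have shift z e' : hasder f (z + k) e' -> hasder (fun y => f (k + 1 * y)) z e'.
    move=> H; rewrite -[e']mulr1; apply: (@hasder_comp _ (fun y => k + 1 * y) f).
      exact: hasder_affine.
    by rewrite mul1r addrC.
  apply: (@cauchy_estimate (fun z => f (k + 1 * z) - f z) 0 _ (rho / 8) (rho / 4)).
  - by apply/andP; split; lra.
  - move=> z; rewrite subr0 => hz.
    have [|e1 he1] := hf z; first by lra.
    have [|e2 he2] := hf (z + k); first by have := ncD z k; lra.
    by exists (e2 - e1); apply: hasderB he1; apply: shift.
  - move=> z; rewrite subr0 mul1r [k + z]addrC => hz.
    by apply: lip => //; exact: ltW.
  - by apply: hasderB hd; apply: shift; rewrite add0r.
have -> : 32 * M * (nc h / rho) ^+ 2 = 32 * M / rho ^+ 2 * nc h * nc h.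
  by field; rewrite gt_eqF.
rewrite (_ : f h - f 0 - d * h =
  (f (0 + h) - (0 + d * (0 + h))) - (f 0 - (0 + d * 0))); last by rewrite add0r; ring.
apply: (@mean_value_ineq (fun z => f z - (0 + d * z)) 0 h) => t /andP[t0 t1].
have th : nc (ofR t * h) <= nc h.
  by rewrite ncM nc_ofR ger0_norm // ler_piMl // nc_ge0.
have [|e he] := hf (ofR t * h); first by lra.
exists (e - d).
  by rewrite add0r; apply: (hasderB he); exact: hasder_affine.
apply: le_trans (lipD _ _ _ he) _; first by lra.
rewrite ler_wpM2l // divr_ge0 //; first exact: mulr_ge0.
by rewrite exprn_ge0 // ltW.
Qed.

End CauchyEstimates.

(** The library's differentiability includes continuity of the differential, so it is asked of [L];
    uniqueness then identifies the differential with [L]. *)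
Lemma differentiable_intro (K : numFieldType) (W : normedModType K)
    (f L : W -> W) (x : W) : linear L -> continuous L ->
  (forall e : K, 0 < e -> exists2 dl : K, 0 < dl &
    forall h, `|h| < dl -> `|f (x + h) - f x - L h| <= e * `|h|) ->
  differentiable f x /\ 'd f x = L :> (W -> W).
Proof.
move=> linL cL H.
pose L' : {linear W -> W} := HB.pack L (GRing.isLinear.Build _ _ _ _ L linL).
have small : f \o shift x = cst (f x) + (L' : W -> W) +o_ 0 id.
  apply/eqaddoP => e /H[dl dl0 Hd]; apply/nbhs_ballP; exists dl => //= h.
  rewrite -ball_normE /ball_ /= sub0r normrN => /Hd; congr (`| _ | <= _).
  transitivity (f (h + x) - (f x + L h)); last by [].
  by rewrite [h + x]addrC opprD addrA.
have dE : 'd f x = L :> (W -> W) := @diff_unique _ _ _ f L' x cL small.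
split; last exact: dE.
by apply/diff_locallyP; rewrite dE; split; [exact: cL|exact: small].
Qed.

(** * The sup norm on C^n and Fréchet differentiability *)

Section SupNorm.
Variables (R : realType) (n : nat).
Local Notation C := (Cplx R).
Local Notation nc := (@Normc.normc R).
Local Notation V := 'rV[C]_n.
Implicit Types (x y h : V).

Lemma linf_leP x (K : R) : 0 <= K ->
  reflect (forall j, nc (x ord0 j) <= K) (linf x <= K).
Proof.
move=> K0; apply: (iffP idP) => [h j|h]; last by apply: bigmax_le.
by apply: le_trans h; apply: le_bigmax.
Qed.

Lemma linf_ge0 x : 0 <= linf x.
Proof. exact: bigmax_ge_id. Qed.

Lemma nc_le_linf x j : nc (x ord0 j) <= linf x.
Proof. by move: j; apply/linf_leP; rewrite ?linf_ge0. Qed.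

Lemma linf0 : linf (0 : V) = 0.
Proof.
by apply/eqP; rewrite eq_le linf_ge0 andbT; apply/linf_leP => // j; rewrite mxE nc0.
Qed.

Lemma linfD x y : linf (x + y) <= linf x + linf y.
Proof.
apply/linf_leP => [|j]; first by rewrite addr_ge0 ?linf_ge0.
by rewrite mxE (le_trans (ncD _ _)) // lerD // nc_le_linf.
Qed.

Lemma linfN x : linf (- x) = linf x.
Proof.
suff le y : linf (- y) <= linf y by apply/le_anti; rewrite le -{1}[x]opprK le.
by apply/linf_leP => [|j]; rewrite ?linf_ge0 // mxE ncN nc_le_linf.
Qed.

Lemma linfB x y : linf (x - y) <= linf x + linf y.
Proof. by rewrite -(linfN y) linfD. Qed.

Lemma linf_eq0 x : linf x = 0 -> x = 0.
Proof.
move=> x0; apply/rowP => j; apply/eqP; rewrite mxE -nc_eq0 eq_le nc_ge0 andbT.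
by rewrite -x0 nc_le_linf.
Qed.

Lemma linf_gt0 x : x != 0 -> 0 < linf x.
Proof.
by move=> x0; rewrite lt_def linf_ge0 andbT; apply: contraNneq x0 => /linf_eq0 ->.
Qed.

Lemma linfZ_le c x : linf (c *: x) <= nc c * linf x.
Proof.
apply/linf_leP => [|j]; first by rewrite mulr_ge0 ?nc_ge0 ?linf_ge0.
by rewrite mxE ncM ler_wpM2l ?nc_ge0 // nc_le_linf.
Qed.

Lemma linfZ c x : linf (c *: x) = nc c * linf x.
Proof.
apply/le_anti; rewrite linfZ_le /=; have [->|c0] := eqVneq c 0.
  by rewrite nc0 mul0r linf_ge0.
have {1}-> : x = c^-1 *: (c *: x) by rewrite scalerA mulVf // scale1r.
rewrite (le_trans (ler_wpM2l (nc_ge0 _) (linfZ_le _ _))) //.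
by rewrite ncV mulVKf // nc_eq0.
Qed.

Lemma rV_normE x : `|x| = ofR (linf x).
Proof.
have normN (z : V) : (`|z| : C) = ofR (nc (`|z| : C)).
  by rewrite -norm_nc normr_id.
apply/le_anti/andP; split.
  suff : mx_norm x <= ofR (linf x) by [].
  have [N0|/mx_norm_neq0[[i j] /= NE]] := eqVneq (mx_norm x) 0.
    by rewrite N0 -[0]/(ofR 0) ler_ofR linf_ge0.
  rewrite NE ord1.
  by rewrite norm_nc ler_ofR nc_le_linf.
rewrite normN ler_ofR; apply/linf_leP => [|j]; first exact: nc_ge0.
rewrite -ler_ofR -normN -norm_nc.
suff : `|x ord0 j| <= mx_norm x by [].
rewrite mx_normE -[leLHS]nngE num_le.
exact: (le_bigmax _ _ (ord0, j)).
Qed.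

Lemma differentiable_eps (f : V -> V) x : differentiable f x ->
  forall e : R, 0 < e -> exists2 dl : R, 0 < dl &
    forall h, linf h < dl -> linf (f (x + h) - f x - 'd f x h) <= e * linf h.
Proof.
move=> /diff_locallyP[_ /eqaddoP H] e e0.
have e0' : 0 < ofR e by rewrite -[0]/(ofR 0) ltr_ofR.
have /nbhs_ballP[dl dl0 Hd] := H _ e0'.
have dl0' : 0 < dl := dl0.
have dlE : dl = ofR (nc dl) by rewrite -norm_nc gtr0_norm.
exists (nc dl) => [|h hh]; first by rewrite -ltr_ofR -dlE.
have := Hd h; rewrite -ball_normE /ball_ /= sub0r normrN rV_normE dlE ltr_ofR.
move=> /(_ hh); rewrite /shift /= !rV_normE -rmorphM ler_ofR /= => Hh.
apply: le_trans Hh; rewrite le_eqVlt; apply/orP; left; apply/eqP; congr linf.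
by transitivity (f (h + x) - (f x + 'd f x h)); rewrite // [h + x]addrC opprD addrA.
Qed.

Lemma eps_differentiable (f L : V -> V) x (K : R) :
  linear L -> (forall h, linf (L h) <= K * linf h) ->
  (forall e : R, 0 < e -> exists2 dl : R, 0 < dl &
    forall h, linf h < dl -> linf (f (x + h) - f x - L h) <= e * linf h) ->
  differentiable f x /\ 'd f x = L :> (V -> V).
Proof.
move=> linL LK H.
pose L' : {linear V -> V} := HB.pack L (GRing.isLinear.Build _ _ _ _ L linL).
have cL : continuous L'.
  apply: bounded_linear_continuous; apply/linear_boundedP.
  exists (ofR K); split; first by rewrite realE -[0]/(ofR 0) !ler_ofR le_total.
  move=> r Kr y; rewrite !rV_normE.
  apply: le_trans (_ : ofR (K * linf y) <= _); first by rewrite ler_ofR; exact: LK.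
  by rewrite rmorphM ler_wpM2r ?(ltW Kr) // -[0]/(ofR 0) ler_ofR linf_ge0.
apply: (differentiable_intro linL cL) => e e0.
have eE : e = ofR (nc e) by rewrite -norm_nc gtr0_norm.
have [|dl dl0 Hd] := H (nc e); first by rewrite -ltr_ofR -eE.
exists (ofR dl) => [|h]; first by rewrite -[0]/(ofR 0) ltr_ofR.
by rewrite eE !rV_normE -rmorphM ler_ofR ltr_ofR; exact: Hd.
Qed.

End SupNorm.

(** * Holomorphy of directional derivatives *)

Section HolomorphicDerivative.
Variables (R : realType) (n : nat).
Local Notation C := (Cplx R).
Local Notation nc := (@Normc.normc R).
Local Notation V := 'rV[C]_n.
Implicit Types (x y h k : V) (f g : V -> V).

Lemma harmonic_small (c e : R) : 0 < e -> exists i : nat, c * i.+1%:R^-1 <= e.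
Proof.
move=> e0; exists (Num.trunc (`|c| / e)).
rewrite ler_pdivrMr // (le_trans (ler_norm c)) // mulrC -ler_pdivrMr //.
by apply/ltW; rewrite truncnS_gt.
Qed.

Lemma le_harmonic (x y c : R) : (forall i : nat, x <= y + c * i.+1%:R^-1) -> x <= y.
Proof.
move=> H; apply/ler_addgt0Pr => e e0; have [i hi] := harmonic_small c e0.
by apply: le_trans (H i) _; rewrite lerD2l.
Qed.

(** The intervals of radius [e i] around [u i] meet pairwise, so the supremum of their left ends
    lies in all of them. *)
Lemma real_cauchy_limit (u e : nat -> R) :
  (forall i j, `|u i - u j| <= e i + e j) -> exists l, forall i, `|u i - l| <= e i.
Proof.
move=> H; have ub j : ubound (range (fun i => u i - e i)) (u j + e j).
  by move=> _ [i _ <-]; have := H i j; rewrite ler_norml => /andP[_]; lra.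
exists (sup (range (fun i => u i - e i))) => i.
have h1 : u i - e i <= sup (range (fun i => u i - e i)).
  by apply: ub_le_sup; [exists (u 0%N + e 0%N)|exists i].
have h2 : sup (range (fun i => u i - e i)) <= u i + e i.
  by apply: ge_sup; [exists (u 0%N - e 0%N); exists 0%N|exact: ub].
by rewrite ler_norml; lra.
Qed.

Lemma vec_cauchy_limit (u : nat -> V) (e : nat -> R) : (forall i, 0 <= e i) ->
  (forall i j, linf (u i - u j) <= e i + e j) ->
  exists l, forall i, linf (u i - l) <= 2 * e i.
Proof.
move=> e0 H.
have Hc j : exists l : C, forall i, nc (u i ord0 j - l) <= 2 * e i.
  have Hnc i i' : nc (u i ord0 j - u i' ord0 j) <= e i + e i'.
    by apply: le_trans (H i i'); have := nc_le_linf (u i - u i') j; rewrite !mxE.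
  have [a ha] := @real_cauchy_limit (fun i => re (u i ord0 j)) e (fun i i' =>
    le_trans (eq_ind_r (fun t => `|t| <= _) (re_abs_le_nc _)
      (esym (etrans (reD _ _) (congr1 _ (reN _))))) (Hnc i i')).
  have [b hb] := @real_cauchy_limit (fun i => im (u i ord0 j)) e (fun i i' =>
    le_trans (eq_ind_r (fun t => `|t| <= _) (im_abs_le_nc _)
      (esym (etrans (imD _ _) (congr1 _ (imN _))))) (Hnc i i')).
  exists (mkC a b) => i; apply: le_trans (nc_le_reim _) _.
  by rewrite !reimE mulr_natl mulr2n lerD.
have [l hl] := choice Hc.
exists (\row_j l j) => i; apply/linf_leP => [|j]; first by rewrite mulr_ge0.
by rewrite !mxE.
Qed.

Lemma hasder_line f x h w j : differentiable f (x + w *: h) ->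
  hasder (fun z => f (x + z *: h) ord0 j) w ('d f (x + w *: h) h ord0 j).
Proof.
move=> df; apply: eps_hasder => e e0.
(* Adding 1 keeps the divisor positive when h = 0. *)
have h1 : 0 < linf h + 1 by have := linf_ge0 h; lra.
have [dl dl0 Hd] := differentiable_eps df (divr_gt0 e0 h1).
exists (dl / (linf h + 1)) => [|z hz]; first exact: divr_gt0.
have zh : linf (z *: h) <= nc z * (linf h + 1).
  by rewrite linfZ ler_wpM2l ?nc_ge0 // lerDl.
have := Hd (z *: h) (le_lt_trans zh _); rewrite -ltr_pdivlMr // => /(_ hz) H.
rewrite [(w + z) *: h]scalerDl addrA.
set v := 'd f _ _ _ _.
have -> : f (x + w *: h + z *: h) ord0 j - f (x + w *: h) ord0 j - v * z =
  (f (x + w *: h + z *: h) - f (x + w *: h) - 'd f (x + w *: h) (z *: h)) ord0 j.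
  have dZ : 'd f (x + w *: h) (z *: h) = z *: 'd f (x + w *: h) h by rewrite linearZ.
  by rewrite dZ !mxE [v * z]mulrC.
apply: le_trans (nc_le_linf _ _) _; apply: le_trans H _.
apply: le_trans (_ : e / (linf h + 1) * (nc z * (linf h + 1)) <= _).
  by rewrite ler_wpM2l // divr_ge0 // ltW.
by rewrite mulrCA mulrC divfK ?gt_eqF // mulrC.
Qed.

Definition bounded_holo_ball g y (rho M : R) := forall k, linf k < rho ->
  differentiable g (y + k) /\ linf (g (y + k)) <= M.

Lemma bounded_holo_line g y rho M k j z : bounded_holo_ball g y rho M ->
  nc z * linf k < rho ->
  (exists d, hasder (fun z => g (y + z *: k) ord0 j) z d) /\
  nc (g (y + z *: k) ord0 j) <= M.
Proof.
move=> hg; rewrite -linfZ => /hg[dg gM]; split; last first.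
  exact: le_trans (nc_le_linf _ _) gM.
by exists ('d g (y + z *: k) k ord0 j); exact: hasder_line.
Qed.

Lemma hasder_line0 g y rho M k j : bounded_holo_ball g y rho M -> 0 < rho ->
  hasder (fun z => g (y + z *: k) ord0 j) 0 ('d g y k ord0 j).
Proof.
move=> hg rho0; have [|dg _] := hg 0; first by rewrite linf0.
rewrite addr0 in dg; have := @hasder_line g y k 0 j.
by rewrite scale0r addr0 => H; exact: H dg.
Qed.

(** Cauchy's estimate on the line y + z k, which stays in the ball for |z| < rho / |k|; half of that
    radius is used, hence the factor 2. *)
Lemma diff_bound g y (rho M : R) k : 0 < rho -> bounded_holo_ball g y rho M ->
  linf ('d g y k) <= 2 * M / rho * linf k.
Proof.
move=> rho0 hg.
have M0 : 0 <= M by have [|_] := hg 0; [rewrite linf0|exact/le_trans/linf_ge0].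
have [->|k0] := eqVneq k 0; first by rewrite linear0 linf0 mulr0.
have k1 := linf_gt0 k0.
apply/linf_leP => [|j]; first by rewrite mulr_ge0 ?divr_ge0 ?linf_ge0 ?mulr_ge0 ?(ltW rho0).
have -> : 2 * M / rho * linf k = M / (rho / 2 / linf k).
  by field; rewrite !gt_eqF.
apply: (@cauchy_estimate _ (fun z => g (y + z *: k) ord0 j) 0 _ _ (rho / linf k)).
- rewrite !divr_gt0 //= ltr_pM2r ?invr_gt0 //; lra.
- move=> z; rewrite subr0 ltr_pdivlMr // => hz.
  by have [] := bounded_holo_line j hg hz.
- move=> z; rewrite subr0 ltr_pdivlMr // => hz.
  by have [] := bounded_holo_line j hg hz.
- exact: hasder_line0 hg rho0.
Qed.

(** [taylor2_estimate] at the point 1 of the line y + z k, whose disc has radius rho / |k|; the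
    bound on [k] says that 1 is at most a quarter of that radius. *)
Lemma second_order_estimate g y (rho M : R) k : 0 < rho ->
  bounded_holo_ball g y rho M -> linf k <= rho / 4 ->
  linf (g (y + k) - g y - 'd g y k) <= 32 * M * (linf k / rho) ^+ 2.
Proof.
move=> rho0 hg hk.
have M0 : 0 <= M by have [|_] := hg 0; [rewrite linf0|exact/le_trans/linf_ge0].
have [->|k0] := eqVneq k 0.
  by rewrite linear0 addr0 subrr subr0 linf0 mul0r expr0n mulr0.
have k1 := linf_gt0 k0.
apply/linf_leP => [|j]; first by rewrite mulr_ge0 ?sqr_ge0 ?mulr_ge0.
have -> : linf k / rho = nc (1 : C) / (rho / linf k).
  by rewrite nc1; field; rewrite !gt_eqF.
have -> : (g (y + k) - g y - 'd g y k) ord0 j =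
    g (y + 1 *: k) ord0 j - g (y + 0 *: k) ord0 j - 'd g y k ord0 j * 1.
  by rewrite scale1r scale0r addr0 mulr1 !mxE.
apply: (@taylor2_estimate _ (fun z => g (y + z *: k) ord0 j)).
- exact: divr_gt0.
- move=> z; rewrite ltr_pdivlMr // => hz.
  by have [] := bounded_holo_line j hg hz.
- move=> z; rewrite ltr_pdivlMr // => hz.
  by have [] := bounded_holo_line j hg hz.
- exact: hasder_line0 hg rho0.
- by rewrite nc1 mulrAC ler_pdivlMr // mul1r.
Qed.

Lemma differentiable_shift f a y : differentiable f (y + a) ->
  differentiable (fun z => f (z + a)) y.
Proof.
move=> df; have da : differentiable (fun z : V => z + a) y.
  have di : differentiable (@id V) y by exact: (@ex_diff _ _ _ _ _ _ _ (is_diff_id y)).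
  exact: (@differentiableD _ V V id (cst a) y di (@differentiable_cst _ V V a y)).
exact: (differentiable_comp da df).
Qed.

Lemma differentiable_bounded f x : differentiable f x -> exists2 M : R, 0 <= M &
  exists2 rho : R, 0 < rho & forall k, linf k < rho -> linf (f (x + k)) <= M.
Proof.
move=> /differentiable_continuous cf.
have cf' : f @ x --> f x by [].
have /(@cvgrPdist_le _ _ _ (nbhs x)) /(_ 1 ltr01) /nbhs_ballP[dl dl0 Hd] := cf'.
have dl0' : 0 < dl := dl0.
have dlE : dl = ofR (nc dl) by rewrite -norm_nc gtr0_norm.
exists (linf (f x) + 1); first by rewrite addr_ge0 ?linf_ge0.
exists (nc dl) => [|k hk]; first by rewrite -ltr_ofR -dlE.
have : `|f x - f (x + k)| <= 1.
  apply: Hd; rewrite -ball_normE /ball_ /= opprD addrA subrr sub0r normrN.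
  by rewrite rV_normE dlE ltr_ofR.
rewrite rV_normE -[1]/(ofR 1) ler_ofR => h1.
rewrite -[f (x + k)](subKr (f x)); apply: le_trans (linfB _ _) _.
by rewrite lerD2l.
Qed.

(* The difference quotients of f in the direction h converge uniformly near x,
   and the second order estimate is uniform along them. *)
Lemma derivative_differentiable (f : V -> V) x h (rho M : R) : 0 < rho ->
  bounded_holo_ball f x rho M -> differentiable (fun y => 'd f y h) x.
Proof.
move=> rho0 hf.
have M0 : 0 <= M by have [|_] := hf 0; [rewrite linf0|exact/le_trans/linf_ge0].
have h1 : 0 < linf h + 1 by have := linf_ge0 h; lra.
(* The 8 keeps every increment within rho/8, a quarter of the radius rho/2 left around points at
   distance at most rho/2 from [x], as [second_order_estimate] demands. *)
pose c := rho / (8 * (linf h + 1)).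
have c0 : 0 < c by rewrite divr_gt0 // mulr_gt0.
have ch : c * linf h <= rho / 8.
  apply: le_trans (_ : c * (linf h + 1) <= _); first by rewrite ler_wpM2l ?(ltW c0) ?lerDl.
  by rewrite /c invfM mulrA divfK // gt_eqF.
pose ep (i : nat) := c * i.+1%:R^-1.
have ep0 i : 0 < ep i by rewrite mulr_gt0.
have epc i : ep i <= c by rewrite /ep ger_pMr // invf_le1 // ler1n.
have eph i : linf (ofR (ep i) *: h) <= rho / 8.
  by rewrite linfZ nc_ofR gtr0_norm // (le_trans _ ch) // ler_wpM2r // linf_ge0.
pose G y := 'd f y h.
pose g i y := (ofR (ep i))^-1 *: (f (y + ofR (ep i) *: h) - f y).
have ball y k r : linf (y - x) + r <= rho -> linf k < r ->
    differentiable f (y + k) /\ linf (f (y + k)) <= M.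
  move=> hy hk; have -> : y + k = x + (y - x + k) by rewrite addrA [x + _]addrC subrK.
  by apply: hf; have := linfD (y - x) k; lra.
pose A := 32 * M * (linf h / (rho / 2)) ^+ 2.
have A0 : 0 <= A by rewrite mulr_ge0 ?sqr_ge0 ?mulr_ge0.
have gG i y : linf (y - x) <= rho / 2 -> linf (g i y - G y) <= A * ep i.
  move=> hy; have hb : bounded_holo_ball f y (rho / 2) M.
    by move=> k; apply: ball; lra.
  have ei0 : ofR (ep i) != 0 :> C by rewrite -nc_eq0 nc_ofR normr_eq0 gt_eqF.
  have -> : g i y - G y = (ofR (ep i))^-1 *:
      (f (y + ofR (ep i) *: h) - f y - 'd f y (ofR (ep i) *: h)).
    have dZ : 'd f y (ofR (ep i) *: h) = ofR (ep i) *: 'd f y h by rewrite linearZ.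
    by rewrite scalerBr dZ scalerA mulVf // scale1r.
  rewrite linfZ ncV nc_ofR gtr0_norm // ler_pdivrMl //.
  apply: le_trans (second_order_estimate _ hb _) _; first by lra.
    by have := eph i; lra.
  rewrite linfZ nc_ofR gtr0_norm // /A le_eqVlt; apply/orP; left; apply/eqP.
  by field; rewrite gt_eqF.
pose B := 4 * M / rho * linf h + A * c.
have gB i y : linf (y - x) <= rho / 2 -> linf (g i y) <= B.
  move=> hy; have hb : bounded_holo_ball f y (rho / 2) M.
    by move=> k; apply: ball; lra.
  have H1 : linf (G y) <= 4 * M / rho * linf h.
    have -> : 4 * M / rho = 2 * M / (rho / 2) by field; rewrite gt_eqF.
    by apply: diff_bound hb; lra.
  rewrite -[g i y](subrK (G y)) addrC; apply: le_trans (linfD _ _) _.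
  by rewrite lerD // (le_trans (gG _ _ hy)) // ler_wpM2l // epc.
have gd i y : linf (y - x) <= rho / 2 -> differentiable (g i) y.
  move=> hy; have [||d1 _] := ball y (ofR (ep i) *: h) (rho / 4); first by lra.
    by have := eph i; lra.
  have [||d2 _] := ball y 0 (rho / 4); first by lra.
    by rewrite linf0; lra.
  rewrite addr0 in d2.
  have dB : differentiable (fun z => f (z + ofR (ep i) *: h) - f z) y.
    exact: (@differentiableB _ V V _ _ _ (differentiable_shift d1) d2).
  exact: (@differentiableZ _ V V _ _ _ dB).
have xx : linf (x - x) <= rho / 2 by rewrite subrr linf0; lra.
pose Dl (k : V) i := 8 * A / rho * linf k * ep i.
have Dl0 k i : 0 <= Dl k i.
  by rewrite mulr_ge0 ?(ltW (ep0 _)) // mulr_ge0 ?linf_ge0 // divr_ge0 ?(ltW rho0) // mulr_ge0.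
(* The difference of two quotients is uniformly small near [x], so [diff_bound] makes the difference
   of their differentials small. *)
have Dcauchy k i j : linf ('d (g i) x k - 'd (g j) x k) <= Dl k i + Dl k j.
  have hb : bounded_holo_ball (g i \- g j) x (rho / 4) (A * (ep i + ep j)).
    move=> k' hk'; have hx : linf (x + k' - x) <= rho / 2.
      by rewrite addrC addKr; lra.
    split; first exact: (differentiableB (gd i _ hx) (gd j _ hx)).
    rewrite /= (_ : _ - _ = (g i (x + k') - G (x + k')) - (g j (x + k') - G (x + k'))).
      by rewrite mulrDr (le_trans (linfB _ _)) // lerD // gG.
    by rewrite opprB addrA subrK.
  have rho4 : 0 < rho / 4 by lra.
  have dB := congr1 (@^~ k) (@diffB _ V V (g i) (g j) x (gd i x xx) (gd j x xx)).
  have H := eq_ind _ (fun v : V => linf v <= _) (diff_bound k rho4 hb) _ dB.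
  apply: le_trans H _; rewrite /Dl le_eqVlt; apply/orP; left; apply/eqP.
  by field; rewrite gt_eqF.
have /choice[L hL] : forall k, exists l, forall i, linf ('d (g i) x k - l) <= 2 * Dl k i.
  by move=> k; apply: vec_cauchy_limit.
have Llin : linear L.
  move=> a k k'; apply/eqP; rewrite -subr_eq0; apply/eqP/linf_eq0/le_anti.
  rewrite linf_ge0 andbT.
  pose K := 2 * (8 * A / rho * linf (a *: k + k')) * c +
    nc a * (2 * (8 * A / rho * linf k) * c) + 2 * (8 * A / rho * linf k') * c.
  apply: (@le_harmonic _ _ K) => i; rewrite add0r.
  have Dk : K * i.+1%:R^-1 = 2 * Dl (a *: k + k') i + nc a * (2 * Dl k i) + 2 * Dl k' i.
    by rewrite /K /Dl /ep; ring.
  rewrite Dk.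
  have dD : 'd (g i) x (a *: k + k') = a *: 'd (g i) x k + 'd (g i) x k'.
    by rewrite linearP.
  have -> : L (a *: k + k') - (a *: L k + L k') =
      - ('d (g i) x (a *: k + k') - L (a *: k + k')) +
      a *: ('d (g i) x k - L k) + ('d (g i) x k' - L k').
    rewrite dD scalerBr; apply/rowP => j; rewrite !mxE; ring.
  apply: le_trans (linfD _ _) _; rewrite lerD ?hL //.
  apply: le_trans (linfD _ _) _; rewrite linfN linfZ lerD ?hL //.
  by rewrite ler_wpM2l ?nc_ge0 ?hL.
have gball i : bounded_holo_ball (g i) x (rho / 2) B.
  move=> k hk; have hx : linf (x + k - x) <= rho / 2 by rewrite addrC addKr ltW.
  by split; [exact: gd|exact: gB].
have B0 : 0 <= B by apply: le_trans (gB 0%N x xx); exact: linf_ge0.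
have [] // := @eps_differentiable _ _ G L x
  (4 * B / rho + 2 * (8 * A / rho * ep 0)) Llin.
- move=> k; rewrite -[L k](subKr ('d (g 0%N) x k)).
  apply: le_trans (linfB _ _) _; rewrite mulrDl; apply: lerD.
    have -> : 4 * B / rho = 2 * B / (rho / 2) by field; rewrite gt_eqF.
    by apply: diff_bound (gball _); lra.
  apply: le_trans (hL k 0%N) _; rewrite /Dl le_eqVlt; apply/orP; left; apply/eqP.
  ring.
move=> e e0.
pose Q := 32 * B / (rho / 2) ^+ 2.
have Q0 : 0 <= Q by rewrite divr_ge0 ?sqr_ge0 ?mulr_ge0.
have Q1 : 0 < Q + 1 by lra.
exists (Num.min (rho / 8) (e / (Q + 1))) => [|k].
  by rewrite lt_min !divr_gt0.
rewrite lt_min => /andP[k8 ke].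
apply: le_trans (_ : Q * linf k ^+ 2 <= _); last first.
  rewrite expr2 mulrA ler_wpM2r ?linf_ge0 //.
  apply: le_trans (_ : (Q + 1) * linf k <= _); first by rewrite ler_wpM2r ?linf_ge0 ?lerDl.
  by rewrite mulrC -ler_pdivlMr // ltW.
apply: (@le_harmonic _ _ (2 * (A * c) + 2 * (8 * A / rho * linf k) * c)) => i.
have Ei : (2 * (A * c) + 2 * (8 * A / rho * linf k) * c) * i.+1%:R^-1 =
    A * ep i + A * ep i + 2 * Dl k i by rewrite /Dl /ep; ring.
rewrite Ei.
(* The increment of the derivative minus [L k] is the second order remainder of [g i] up to three
   errors that vanish as i grows. *)
have split4 (a b l p q d : V) :
    a - b - l = (p - q - d) - (p - a) + (q - b) + (d - l).
  by apply/rowP => j; rewrite !mxE; ring.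
rewrite (split4 _ _ _ (g i (x + k)) (g i x) ('d (g i) x k)).
have hx : linf (x + k - x) <= rho / 2 by rewrite addrC addKr; lra.
apply: le_trans (linfD _ _) _; rewrite [leRHS]addrA lerD ?hL //.
apply: le_trans (linfD _ _) _; rewrite [leRHS]addrA lerD ?gG //.
apply: le_trans (linfB _ _) _; rewrite lerD ?gG //.
apply: le_trans (second_order_estimate _ (gball i) _) _; first by lra.
  by lra.
rewrite /Q le_eqVlt; apply/orP; left; apply/eqP.
by field; rewrite gt_eqF.
Qed.

End HolomorphicDerivative.

(** * The norms of l_t *)

Section LtNorm.
Variable R : realType.
Local Notation C := (Cplx R).
Local Notation nc := (@Normc.normc R).

(* Young's inequality for x and 1. *)
Lemma bernoulli_powR (x s : R) : 0 <= x -> 1 <= s -> 1 + s * (x - 1) <= x `^ s.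
Proof.
move=> x0; rewrite le_eqVlt => /orP[/eqP<-|s1].
  by rewrite powRr1 // mul1r addrC subrK.
have s0 : 0 < s by lra.
have q0 : 0 < (1 - s^-1)^-1 by rewrite invr_gt0 subr_gt0 invf_lt1.
have := @conjugate_powR R x 1 s (1 - s^-1)^-1 x0 ler01 s0 q0.
rewrite invrK addrC subrK powR1 mulr1 mul1r => /(_ erefl) h.
have := ler_wpM2l (ltW s0) h.
rewrite mulrDr mulrBr mulr1 divff ?gt_eqF // mulrCA divff ?gt_eqF //; lra.
Qed.

(** After scaling by m = a u + b v, Bernoulli's inequality at u/m and v/m gives linear terms that
    cancel, because a (u/m) + b (v/m) = 1. *)
Lemma powR_jensen (r a b u v : R) : 1 <= r -> 0 <= a -> 0 <= b -> a + b = 1 ->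
  0 <= u -> 0 <= v -> (a * u + b * v) `^ r <= a * u `^ r + b * v `^ r.
Proof.
move=> r1 a0 b0 ab u0 v0; have r0 : r != 0 by rewrite gt_eqF //; lra.
have : 0 <= a * u + b * v by rewrite addr_ge0 // mulr_ge0.
rewrite le_eqVlt => /orP[/eqP<-|m0].
  by rewrite powR0 // addr_ge0 // mulr_ge0 // powR_ge0.
set m := _ + _ in m0 *.
have um : u = m * (u / m) by field; rewrite gt_eqF.
have vm : v = m * (v / m) by field; rewrite gt_eqF.
have u1 : 0 <= u / m by rewrite divr_ge0 // ltW.
have v1 : 0 <= v / m by rewrite divr_ge0 // ltW.
rewrite [in leRHS]um [in leRHS]vm (@powRM _ m (u / m)) ?(@powRM _ m (v / m)) ?(ltW m0) //.
have h1 := bernoulli_powR u1 r1; have h2 := bernoulli_powR v1 r1.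
have mE : a * (u / m) + b * (v / m) = 1.
  by rewrite !mulrA -mulrDl divff // gt_eqF.
have hm : 0 <= m `^ r := powR_ge0 _ _.
rewrite mulrCA [b * _]mulrCA -mulrDr -[leLHS]mulr1 ler_wpM2l //.
apply: le_trans (_ : a * (1 + r * (u / m - 1)) + b * (1 + r * (v / m - 1)) <= _).
  have -> : a * (1 + r * (u / m - 1)) + b * (1 + r * (v / m - 1)) =
    (a + b) + r * ((a * (u / m) + b * (v / m)) - (a + b)) by ring.
  by rewrite mE ab subrr mulr0 addr0.
by apply: lerD; apply: ler_wpM2l.
Qed.

Variables (n : nat) (t : \bar R).
Hypothesis t_ge1 : (1 <= t)%E.
Local Notation V := 'rV[C]_n.
Local Notation N := (@lnorm R n t).
Implicit Types (x y : V).

Lemma lnorm_spec : t = +oo%E \/ exists2 r : R, 1 <= r & t = r%:E.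
Proof.
move: t_ge1; case: t => [r||] //=; last by left.
by rewrite lee_fin => r1; right; exists r.
Qed.

Lemma lnorm_ge0 x : 0 <= N x.
Proof.
by have [->|[r _ ->]] := lnorm_spec; [exact: linf_ge0|exact: powR_ge0].
Qed.

Lemma lnormZ c x : N (c *: x) = nc c * N x.
Proof.
have [->|[r r1 ->]] := lnorm_spec; first exact: linfZ.
have r0 : r != 0 by rewrite gt_eqF //; lra.
rewrite /lnorm (eq_bigr (fun j => nc c `^ r * nc (x ord0 j) `^ r)); last first.
  by move=> j _; rewrite mxE ncM powRM ?nc_ge0.
rewrite -mulr_sumr powRM ?powR_ge0 ?sumr_ge0 //; last by move=> j _; exact: powR_ge0.
by rewrite -powRrM divff // powRr1 // nc_ge0.
Qed.

Lemma linf_le_lnorm x : linf x <= N x.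
Proof.
have [->|[r r1 ->]] := lnorm_spec; first by [].
have r0 : 0 < r by lra.
apply/linf_leP => [|j]; first exact: powR_ge0.
have -> : nc (x ord0 j) = (nc (x ord0 j) `^ r) `^ r^-1.
  by rewrite -powRrM divff ?gt_eqF // powRr1 // nc_ge0.
apply: ge0_ler_powR; rewrite ?invr_ge0 ?(ltW r0) ?nnegrE ?powR_ge0 //.
  by apply: sumr_ge0 => i _; exact: powR_ge0.
by rewrite (bigD1 j) //= lerDl sumr_ge0 // => i _; exact: powR_ge0.
Qed.

Lemma lnorm0 : N 0 = 0.
Proof. by have := lnormZ 0 0; rewrite scale0r nc0 mul0r. Qed.

Lemma lnorm_eq0 x : N x = 0 -> x = 0.
Proof.
by move=> x0; apply: linf_eq0; apply/le_anti; rewrite linf_ge0 -x0 linf_le_lnorm.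
Qed.

Lemma powR_sum_eq1 (r : R) x : 1 <= r -> lnorm r%:E x = 1 ->
  \sum_(j < n) nc (x ord0 j) `^ r = 1.
Proof.
move=> r1 x1; have r0 : r != 0 by rewrite gt_eqF //; lra.
have s0 : 0 <= \sum_(j < n) nc (x ord0 j) `^ r.
  by apply: sumr_ge0 => j _; exact: powR_ge0.
have <- : lnorm r%:E x `^ r = \sum_(j < n) nc (x ord0 j) `^ r.
  by rewrite /lnorm -powRrM mulVf // powRr1.
by rewrite x1 powR1.
Qed.

(** Minkowski's inequality from the convexity of the ball: x + y is N x + N y times a convex
    combination of the unit vectors x / N x and y / N y. For finite t, [powR_jensen] bounds the
    power sum of that combination by 1. *)
Lemma lnormD x y : N (x + y) <= N x + N y.
Proof.
have [x0|x0] := eqVneq (N x) 0.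
  by rewrite (lnorm_eq0 x0) lnorm0 !add0r.
have [y0|y0] := eqVneq (N y) 0.
  by rewrite (lnorm_eq0 y0) lnorm0 !addr0.
have a0 : 0 < N x by rewrite lt_def x0 lnorm_ge0.
have b0 : 0 < N y by rewrite lt_def y0 lnorm_ge0.
have s0 : 0 < N x + N y by rewrite addr_gt0.
pose u := (ofR (N x))^-1 *: x; pose v := (ofR (N y))^-1 *: y.
have u1 : N u = 1 by rewrite lnormZ ncV nc_ofR gtr0_norm // mulVf.
have v1 : N v = 1 by rewrite lnormZ ncV nc_ofR gtr0_norm // mulVf.
pose a := N x / (N x + N y); pose b := N y / (N x + N y).
have ab : a + b = 1 by rewrite -mulrDl divff // gt_eqF.
have a1 : 0 <= a by rewrite divr_ge0 // ltW.
have b1 : 0 <= b by rewrite divr_ge0 // ltW.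
have -> : x + y = ofR (N x + N y) *: (ofR a *: u + ofR b *: v).
  have ncf (r : R) : 0 < r -> ofR r != 0 :> C.
    by move=> r0; rewrite -nc_eq0 nc_ofR normr_eq0 gt_eqF.
  apply/rowP => j; rewrite !mxE /a /b !rmorphM !fmorphV; field.
  by rewrite -rmorphD !ncf.
rewrite lnormZ nc_ofR gtr0_norm // -[leRHS]mulr1 ler_pM2l //.
have wle j : nc ((ofR a *: u + ofR b *: v) ord0 j) <=
    a * nc (u ord0 j) + b * nc (v ord0 j).
  by rewrite !mxE (le_trans (ncD _ _)) // !ncM !nc_ofR !ger0_norm.
have [tE|[r r1 tE]] := lnorm_spec; rewrite tE in u1 v1 *.
  apply/linf_leP => // j; rewrite (le_trans (wle j)) // -ab lerD //.
    by rewrite ler_piMr // -u1; exact: nc_le_linf.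
  by rewrite ler_piMr // -v1; exact: nc_le_linf.
have r0 : 0 < r := lt_le_trans ltr01 r1.
rewrite [leRHS](_ : 1 = 1 `^ r^-1); last by rewrite powR1.
rewrite /lnorm; apply: ge0_ler_powR; rewrite ?invr_ge0 ?(ltW r0) ?nnegrE //.
  by apply: sumr_ge0 => j _; exact: powR_ge0.
have sE : 1 = a * (\sum_(j < n) nc (u ord0 j) `^ r) + b * \sum_(j < n) nc (v ord0 j) `^ r.
  by rewrite !powR_sum_eq1 // !mulr1.
rewrite sE !mulr_sumr -big_split /=.
apply: ler_sum => j _; apply: le_trans (powR_jensen r1 a1 b1 ab (nc_ge0 _) (nc_ge0 _)).
apply: (ge0_ler_powR (ltW r0) _ _ (wle j)); rewrite nnegrE; first exact: nc_ge0.
by apply: addr_ge0; apply: mulr_ge0 => //; exact: nc_ge0.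
Qed.

Lemma lnorm_sum (I : Type) (s : seq I) (F : I -> V) :
  N (\sum_(i <- s) F i) <= \sum_(i <- s) N (F i).
Proof.
elim/big_ind2: _ => [|x1 x2 y1 y2 h1 h2|//]; first by rewrite lnorm0.
by apply: le_trans (lnormD _ _) _; apply: lerD.
Qed.

Lemma lnorm_delta j : N (delta_mx ord0 j) = 1.
Proof.
have d i : nc (delta_mx ord0 j ord0 i : C) = (i == j)%:R.
  by rewrite mxE eqxx /=; case: eqP => _; rewrite ?nc1 ?nc0.
have [->|[r r1 ->]] := lnorm_spec.
  apply/le_anti/andP; split.
    by apply/linf_leP => // i; rewrite d; case: eqP; rewrite ?ler01.
  by have := nc_le_linf (delta_mx ord0 j : V) j; rewrite d eqxx.
have r0 : r != 0 by rewrite gt_eqF //; lra.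
rewrite /lnorm (bigD1 j) //= d eqxx powR1 big1 ?addr0 ?powR1 // => i ij.
by rewrite d (negPf ij) powR0.
Qed.

Lemma lnorm_le_linf x : N x <= n%:R * linf x.
Proof.
rewrite [x in leLHS]matrix_sum_delta big_ord1.
apply: le_trans (lnorm_sum _ _) _.
apply: le_trans (_ : \sum_(j < n) linf x <= _).
  by apply: ler_sum => j _; rewrite lnormZ lnorm_delta mulr1 nc_le_linf.
by rewrite sumr_const card_ord mulr_natl.
Qed.

Lemma lball_open x : lball t x ->
  exists2 rho : R, 0 < rho & forall h, linf h < rho -> lball t (x + h).
Proof.
rewrite /lball /= => x1; have n1 : 0 < n%:R + 1 :> R by rewrite ltr_wpDl.
exists ((1 - N x) / (n%:R + 1)) => [|h]; first by rewrite divr_gt0 // subr_gt0.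
rewrite ltr_pdivlMr // => hh; apply: le_lt_trans (lnormD _ _) _.
have := lnorm_le_linf h; have := linf_ge0 h; lra.
Qed.

End LtNorm.

(** * Taylor coefficients of bounded functions *)

Section TaylorCoefficients.
Variable R : realType.
Local Notation C := (Cplx R).
Local Notation nc := (@Normc.normc R).

(** A tower of successive derivatives, kept as data so that iterated Fréchet derivatives along a
    line fit directly. *)
Definition derivatives (rho : R) (D : nat -> C -> C) := forall k z, nc z < rho ->
  hasder (D k) z (D k.+1 z).

Definition taylor (D : nat -> C -> C) (s : nat) : {poly C} :=
  \poly_(k < s) (D k 0 / k`!%:R).

Lemma natC_neq0 k : (k.+1)%:R != 0 :> C.
Proof. by rewrite pnatr_eq0. Qed.

Lemma factC_neq0 k : k`!%:R != 0 :> C.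
Proof. by rewrite pnatr_eq0 -lt0n fact_gt0. Qed.

Lemma deriv_taylor D s : (taylor D s.+1)^`() = taylor (fun k => D k.+1) s.
Proof.
apply/polyP => i; rewrite coef_deriv !coef_poly ltnS; case: ifP => _.
  rewrite factS natrM -mulr_natr; field.
  by rewrite factC_neq0 nat1r natC_neq0.
by rewrite mul0rn.
Qed.

Lemma taylorS D s z : (taylor D s.+1).[z] = (taylor D s).[z] + D s 0 / s`!%:R * z ^+ s.
Proof. by rewrite !horner_poly big_ord_recr. Qed.

(** Induction on the order: differentiating the remainder gives the remainder of the shifted tower,
    by [deriv_taylor], and the mean value inequality gains one power of |z|. *)
Lemma taylor_peano rho D s : 0 < rho -> derivatives rho D ->
  forall e : R, 0 < e -> exists2 dl : R, 0 < dl & forall z, nc z < dl ->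
    nc (D 0%N z - (taylor D s.+1).[z]) <= e * nc z ^+ s.
Proof.
move=> rho0; elim: s D => [|s IH] D hD e e0.
  have [|dl dl0 Hd] := (continuous_atP _ _).1 (hasder_cont (hD 0%N 0 _)) e e0.
    by rewrite nc0.
  exists dl => // z hz; rewrite mulr1 horner_poly big_ord1 expr0 mulr1 fact0 divr1.
  by apply: Hd; rewrite subr0.
have hD' : derivatives rho (fun k => D k.+1) by move=> k; exact: hD.
have [dl dl0 Hd] := IH _ hD' e e0.
exists (Num.min dl rho) => [|z]; first by rewrite lt_min dl0.
rewrite lt_min => /andP[z1 z2].
rewrite exprSr mulrA.
have T0 : (taylor D s.+2).[0] = D 0%N 0.
  by rewrite horner_coef0 coef_poly fact0 divr1.
have -> : D 0%N z - (taylor D s.+2).[z] =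
    (D 0%N (0 + z) - (taylor D s.+2).[0 + z]) - (D 0%N 0 - (taylor D s.+2).[0]).
  by rewrite add0r T0 subrr subr0.
apply: (@mean_value_ineq _ (fun w => D 0%N w - (taylor D s.+2).[w])) => t /andP[t0 t1].
have tz : nc (0 + ofR t * z) <= nc z.
  by rewrite add0r ncM nc_ofR ger0_norm // ler_piMl // nc_ge0.
exists (D 1%N (0 + ofR t * z) - (taylor (fun k => D k.+1) s.+1).[0 + ofR t * z]).
  rewrite -deriv_taylor; apply: hasderB; last exact: hasder_horner.
  by apply: hD; exact: le_lt_trans tz _.
apply: le_trans (Hd _ (le_lt_trans tz z1)) _.
by rewrite ler_wpM2l ?(ltW e0) // lerXn2r ?nnegrE ?nc_ge0.
Qed.

(** Peano's estimate for the polynomial with s + 1 terms says precisely that the quotient, completed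
    at 0 by the s-th coefficient, is continuous there. *)
Lemma taylor_remainder rho D s : 0 < rho -> derivatives rho D ->
  exists psi : C -> C,
    [/\ forall z, D 0%N z = (taylor D s).[z] + psi z * z ^+ s,
        {for 0, continuous psi} & psi 0 = D s 0 / s`!%:R].
Proof.
move=> rho0 hD.
exists (fun z => if z == 0 then D s 0 / s`!%:R
                 else (D 0%N z - (taylor D s).[z]) / z ^+ s); split.
- move=> z; case: eqP => [->|/eqP z0]; last first.
    by rewrite divfK ?expf_neq0 // addrC subrK.
  rewrite horner_coef0 coef_poly; case: s => [|s].
    by rewrite expr0 fact0 divr1 mulr1 add0r.
  by rewrite fact0 divr1 expr0n mulr0 addr0.
- apply/continuous_atP => e e0; have [dl dl0 Hd] := taylor_peano s rho0 hD e0.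
  exists dl => // z; rewrite subr0 eqxx => hz; case: eqP => [_|/eqP z0].
    by rewrite subrr nc0 ltW.
  have zs0 : 0 < nc z ^+ s by rewrite exprn_gt0 // nc_gt0.
  rewrite -(ler_pM2r zs0) -ncX -ncM mulrBl divfK ?expf_neq0 // ncX.
  by have := Hd _ hz; rewrite taylorS opprD addrA.
- by rewrite eqxx.
Qed.

Lemma clim_taylor rho D s (r : R) : 0 < r < rho -> derivatives rho D ->
  clim (circmean (fun z => D 0%N z / z ^+ s) ^~ r) (D s 0 / s`!%:R).
Proof.
move=> /andP[r0 rrho] hD.
have [psi [E cpsi <-]] := taylor_remainder s (lt_trans r0 rrho) hD.
apply: (clim_coef r0 (size_poly _ _) E cpsi) => z hz.
by exists (D 1%N z); apply: hD; exact: le_lt_trans rrho.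
Qed.

Lemma taylor_division rho D s : 0 < rho -> derivatives rho D ->
  (forall k, (k < s)%N -> D k 0 = 0) ->
  exists psi : C -> C, (forall z, D 0%N z = psi z * z ^+ s) /\
    (forall z, nc z < rho -> exists d, hasder psi z d).
Proof.
(* Expanding to order s + 1 gives the quotient by z^s the form c_s + ps(z) z with [ps] continuous at
   0. This is Carathéodory's form, so the quotient is differentiable at 0 too. *)
move=> rho0 hD D0; have [ps [E cps ps0]] := taylor_remainder s.+1 rho0 hD.
have T0 z : (taylor D s).[z] = 0.
  by rewrite horner_poly big1 // => k _; rewrite D0 // mul0r mul0r.
exists (fun z => D s 0 / s`!%:R + ps z * z).
have DE z : D 0%N z = (D s 0 / s`!%:R + ps z * z) * z ^+ s.
  by rewrite E taylorS T0 add0r mulrDl exprS mulrA.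
split=> // z hz; have [->|z0] := eqVneq z 0.
  exists (ps 0); exists ps; split=> // y.
  by rewrite mulr0 addr0 subr0.
have zs0 : z ^+ s != 0 by rewrite expf_neq0.
have H := @hasder_div _ (D 0%N) (fun z => z ^+ s) z _ _ zs0 (hD _ _ hz)
  (hasderX s (hasder_id z)).
have nz0 : 0 < nc z by rewrite nc_gt0.
eexists; apply: (hasder_near nz0 _ H) => y hy.
have y0 : y != 0.
  by apply: contraTN hy => /eqP ->; rewrite sub0r ncN ltxx.
by rewrite DE mulfK // expf_neq0.
Qed.

Lemma circmean_re_ge0 (f : C -> C) N (r : R) : 0 <= r ->
  (forall z, nc z = r -> 0 <= re (f z)) -> 0 <= re (circmean f N r).
Proof.
move=> r0 hf; apply: (@tmean_ind _ C^o (fun x : C => 0 <= re x)) => [x y hx hy|s hs].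
  rewrite /GRing.scale /= (_ : 2^-1 = ofR 2^-1); last by rewrite fmorphV rmorph_nat.
  by rewrite reM reD re_ofR im_ofR mul0r subr0 mulr_ge0 // addr_ge0.
by apply: hf; rewrite nc_circpt_seg.
Qed.

Lemma nc_sqrD (a b : C) : nc (a + b) ^+ 2 = nc a ^+ 2 + nc b ^+ 2 + 2 * re (cj a * b).
Proof. by rewrite !nc_sqr !reimE; ring. Qed.

Lemma circmean_cst (c : C) N r : circmean (fun=> c) N r = c.
Proof.
apply/eqP; rewrite -subr_eq0 -nc_eq0 eq_le nc_ge0 andbT.
by apply: cmean_dist => t _; rewrite subrr nc0.
Qed.

Lemma clim_re_ge0 (u : nat -> C) l : (forall N, 0 <= re (u N)) -> clim u l -> 0 <= re l.
Proof.
move=> u0 hu; rewrite leNgt; apply/negP => l0.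
have e0 : 0 < - re l / 2 by rewrite divr_gt0 // oppr_gt0.
have [N /(_ N (leqnn N)) h] := hu _ e0.
have := le_trans (re_le_nc _) h; rewrite reD reN; have := u0 N; lra.
Qed.

(* Multiplication by f does not increase the L^2 norm over |z| = r, and the
   compression of this operator to span(1, z^s) is lower triangular. *)
Lemma compression_contraction rho D s (r : R) x y : 0 < r < rho -> (0 < s)%N ->
  derivatives rho D -> (forall z, nc z < rho -> nc (D 0%N z) <= 1) ->
  nc (x * D 0%N 0) ^+ 2 +
    r ^+ s ^+ 2 * nc (x * (D s 0 / s`!%:R) + y * D 0%N 0) ^+ 2 <=
  nc x ^+ 2 + r ^+ s ^+ 2 * nc y ^+ 2.
Proof.
move=> rr s0 hD D1; have /andP[r0 rrho] := rr.
have rs0 : 0 < r ^+ s by rewrite exprn_gt0.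
set q := r ^+ s ^+ 2; set c0 := D 0%N 0; set cs := _ / _.
set al := x * c0; set be := x * cs + y * c0.
have l0 : clim (circmean (D 0%N) ^~ r) c0.
  apply: (@mean_value _ (D 0%N)) => // [z /andP[_ hz]|].
    by exists (D 1%N z); apply: hD; exact: le_lt_trans rrho.
  by apply: (@hasder_cont _ _ _ (D 1%N 0)); apply: hD; rewrite nc0 (lt_trans r0).
have ls := clim_taylor s rr hD; rewrite -/cs in ls.
have lp : clim (circmean (fun z => D 0%N z * z ^+ s) ^~ r) 0.
  have hd z : nc z <= r -> hasder (fun z => D 0%N z * z ^+ s) z
      (D 1%N z * z ^+ s + D 0%N z * (s%:R * z ^+ s.-1 * 1)).
    move=> hz; apply: hasderM (hasderX s (hasder_id z)); apply: hD.
    exact: le_lt_trans rrho.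
  have := @mean_value _ (fun z => D 0%N z * z ^+ s) r r0 _ (hasder_cont (hd 0 _)).
  rewrite expr0n eqn0Ngt s0 mulr0; apply=> [z /andP[_ hz]|]; last by rewrite nc0 ltW.
  by eexists; exact: hd.
have lz := circmean_pow r0 s0; have lz' := circmean_negpow r0 s0.
(* With P = x + y z^s and T = al + be z^s, the real part of [W] on the circle is |P|^2 + |T|^2 - 2
   Re(conj(T) f P), which is nonnegative as |f| <= 1. Writing conj(z^s) as q / z^s leaves only terms
   whose means have known limits. Since al and be are the coefficients of 1 and z^s in f P, the
   limit is |x|^2 + q |y|^2 - |al|^2 - q |be|^2. *)
pose K := nc x ^+ 2 + q * nc y ^+ 2 + (nc al ^+ 2 + q * nc be ^+ 2).
pose k1 := 2 * (cj x * y + cj al * be).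
pose k2 := - (2 * (cj al * x + ofR q * cj be * y)).
pose k3 := - (2 * cj al * y); pose k4 := - (2 * ofR q * cj be * x).
pose f := D 0%N.
pose W z := ofR K + (k1 * z ^+ s + (k2 * f z + (k3 * (f z * z ^+ s) + k4 * (f z / z ^+ s)))).
have hW : clim (circmean W ^~ r) (ofR K + (k1 * 0 + (k2 * c0 + (k3 * 0 + k4 * cs)))).
  have := climD (clim_cst (ofR K)) (climD (climZ k1 lz) (climD (climZ k2 l0)
    (climD (climZ k3 lp) (climZ k4 ls)))).
  by apply: clim_ext => N; rewrite /W circmeanD circmean_cst !circmeanD !circmeanZ.
have W0 N : 0 <= re (circmean W N r).
  apply: circmean_re_ge0 => [|z hz]; first exact: ltW.
  have qE : q = nc (z ^+ s) ^+ 2 by rewrite ncX hz.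
  have zs0 : z ^+ s != 0 by rewrite -nc_gt0 ncX hz.
  have q0 : ofR q != 0 :> C by rewrite -nc_eq0 nc_ofR qE normrX expf_neq0 // normr_eq0 nc_eq0.
  have fz : nc (f z) <= 1 by apply: D1; rewrite hz.
  have -> : W z = ofR K + k1 * z ^+ s + k2 * f z + k3 * (f z * z ^+ s)
      - 2 * cj be * x * f z * cj (z ^+ s).
    have -> : cj (z ^+ s) = ofR q / z ^+ s by rewrite qE -mulr_cj mulrAC divff // mul1r.
    by rewrite /W /k4; field.
  have qu : ofR q = z ^+ s * cj (z ^+ s) by rewrite mulr_cj qE.
  move: (z ^+ s) (f z) fz qE qu => u v fz qE qu.
  have -> : ofR K + k1 * u + k2 * v + k3 * (v * u) - 2 * cj be * x * v * cj u =
      ofR (nc x ^+ 2 + nc (y * u) ^+ 2) + 2 * (cj x * (y * u)) +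
      (ofR (nc al ^+ 2 + nc (be * u) ^+ 2) + 2 * (cj al * (be * u))) -
      2 * ((cj al + cj be * cj u) * (v * (x + y * u))).
    have KE : ofR K = ofR (nc x ^+ 2 + nc (y * u) ^+ 2) +
        ofR (nc al ^+ 2 + nc (be * u) ^+ 2).
      rewrite -[RHS]rmorphD; congr ofR; rewrite (ncM y) (ncM be) !exprMn -qE /K; ring.
    by rewrite KE /k1 /k2 /k3 qu; ring.
  have cjE : cj al + cj be * cj u = cj (al + be * u).
    by apply: complex_ext; rewrite !reimE; ring.
  have re2 (a : C) : re (2 * a) = 2 * re a by rewrite mulr_natl mulr2n reD; ring.
  rewrite cjE reD reN !reD !re2 !re_ofR -!nc_sqrD.
  move: (x + y * u) (al + be * u) => P T.
  have -> : nc P ^+ 2 + nc T ^+ 2 - 2 * re (cj T * (v * P)) =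
      nc P ^+ 2 * (1 - nc v ^+ 2) + nc (T - v * P) ^+ 2.
    by rewrite nc_sqrD ncN mulrN reN ncM exprMn; ring.
  by rewrite addr_ge0 ?sqr_ge0 // mulr_ge0 ?sqr_ge0 // subr_ge0 expr_le1 ?nc_ge0.
have := clim_re_ge0 W0 hW.
have -> : ofR K + (k1 * 0 + (k2 * c0 + (k3 * 0 + k4 * cs))) =
    ofR K - 2 * (x * c0 * cj al) - 2 * ofR q * ((x * cs + y * c0) * cj be).
  by rewrite /k2 /k4; ring.
rewrite -/al -/be !mulr_cj.
have -> : ofR K - 2 * ofR (nc al ^+ 2) - 2 * ofR q * ofR (nc be ^+ 2) =
    ofR (K - 2 * nc al ^+ 2 - 2 * q * nc be ^+ 2).
  have two : 2 = ofR 2 :> C by rewrite rmorph_nat.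
  by apply: complex_ext; rewrite two !reimE; ring.
rewrite re_ofR /K; lra.
Qed.

(** The contraction is tested on x = 1 - |c_0|^2, y = c_s conj(c_0), for which x c_s + y c_0 = c_s;
    dividing by 1 - |c_0|^2 leaves |c_s|^2 r^(2s) <= (1 - |c_0|^2)^2. If |c_0| = 1 this division
    fails, and x = 1, y = 0 gives c_s = 0. *)
Lemma coefficient_bound rho D s (r : R) : 0 < r < rho -> (0 < s)%N ->
  derivatives rho D -> (forall z, nc z < rho -> nc (D 0%N z) <= 1) ->
  nc (D s 0 / s`!%:R) * r ^+ s <= 1 - nc (D 0%N 0) ^+ 2.
Proof.
move=> rr s0 hD D1; have /andP[r0 rrho] := rr.
have H x y := compression_contraction x y rr s0 hD D1.
set cs := _ / _ in H *; set c0 := D 0%N 0 in H *.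
have q0 : 0 < r ^+ s by rewrite exprn_gt0.
have a1 : nc c0 <= 1 by apply: D1; rewrite nc0 (lt_trans r0).
set ka := 1 - nc c0 ^+ 2.
have ka0 : 0 <= ka by rewrite subr_ge0 expr_le1 ?nc_ge0.
have [kaE|ka1] := eqVneq ka 0.
  have := H 1 0; rewrite !mul1r mul0r addr0 nc1 nc0 expr1n expr0n mulr0 addr0 kaE.
  rewrite -exprMn => h; have {h} : (r ^+ s * nc cs) ^+ 2 <= 0.
    by move: kaE h; rewrite /ka; lra.
  move=> h; have : (r ^+ s * nc cs) ^+ 2 == 0 by rewrite eq_le h sqr_ge0.
  by rewrite sqrf_eq0 mulrC => /eqP ->.
have {ka0 ka1} ka0 : 0 < ka by rewrite lt_def ka1.
have := H (ofR ka) (cs * cj c0).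
have -> : ofR ka * cs + cs * cj c0 * c0 = cs.
  rewrite -mulrA [cj _ * _]mulrC mulr_cj mulrC -mulrDr -rmorphD /ka subrK.
  by rewrite rmorph1 mulr1.
rewrite !ncM nc_cj nc_ofR gtr0_norm // => h.
rewrite -(ler_pXn2r (_ : (0 < 2)%N)) ?nnegrE ?(ltW ka0) ?mulr_ge0 ?nc_ge0 ?(ltW q0) //.
rewrite -(ler_pM2l ka0); move: h; rewrite !exprMn.
have -> : nc c0 ^+ 2 = 1 - ka by rewrite /ka; ring.
lra.
Qed.

End TaylorCoefficients.

(** * Maximum modulus, Schwarz and Schwarz-Pick *)

Section SchwarzLemma.
Variables (R : realType) (n : nat) (t : \bar R).
Hypothesis t_ge1 : (1 <= t)%E.
Local Notation C := (Cplx R).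
Local Notation nc := (@Normc.normc R).
Local Notation V := 'rV[C]_n.
Local Notation N := (@lnorm R n t).

Lemma frechetD_holomorphic (f : V -> V) hs : holomorphic (lball t) f ->
  holomorphic (lball t) (fun y => frechetD f y hs).
Proof.
move=> hf; elim: hs => [|h hs IH] //= x hx.
have [r1 r10 H1] := lball_open t_ge1 hx.
have [M M0 [r2 r20 H2]] := differentiable_bounded (IH x hx).
apply: (@derivative_differentiable _ _ (fun y => frechetD f y hs) x h (Num.min r1 r2) M).
  by rewrite lt_min r10.
move=> k; rewrite lt_min => /andP[k1 k2]; split; last exact: H2.
by apply: IH; exact: H1.
Qed.

(** Along the line spanned by [h], one more copy of [h] in the argument list is one more derivative
    in z; the condition on [rho] keeps the points z h in the ball. *)
Lemma frechetD_derivatives (f : V -> V) h j (rho : R) :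
  holomorphic (lball t) f -> rho * N h <= 1 ->
  derivatives rho (fun k z => frechetD f (z *: h) (nseq k h) ord0 j).
Proof.
move=> hf hrho k z hz.
have hb : lball t (0 + z *: h).
  rewrite add0r /lball /= lnormZ //.
  have := lnorm_ge0 t_ge1 h; rewrite le_eqVlt => /orP[/eqP<-|N0].
    by rewrite mulr0.
  by apply: lt_le_trans hrho; rewrite ltr_pM2r.
have := hasder_line j (frechetD_holomorphic (nseq k h) hf hb).
rewrite add0r; congr (hasder _ _ _).
by apply/funext => y; rewrite add0r.
Qed.

Definition moebius (w z : C) : C := (z + w) / (1 + cj w * z).

Lemma moebius_den w z : nc w < 1 -> nc z < 1 -> 1 + cj w * z != 0.
Proof.
move=> w1 z1; rewrite -nc_gt0; have := nc_le_dist 1 (1 + cj w * z).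
rewrite nc1 opprD addrA subrr sub0r ncN ncM nc_cj.
have := nc_ge0 w; have := nc_ge0 z; nra.
Qed.

Lemma moebius_norm w z : nc w < 1 -> nc z < 1 ->
  (1 - nc (moebius w z) ^+ 2) * nc (1 + cj w * z) ^+ 2 =
  (1 - nc w ^+ 2) * (1 - nc z ^+ 2).
Proof.
move=> w1 z1; rewrite /moebius ncM ncV mulrBl mul1r exprMn exprVn.
rewrite divfK ?expf_neq0 ?nc_eq0 ?moebius_den //.
by rewrite !nc_sqr !reimE; ring.
Qed.

Lemma moebius_lt1 w z : nc w < 1 -> nc z < 1 -> nc (moebius w z) < 1.
Proof.
move=> w1 z1; have d0 : 0 < nc (1 + cj w * z) ^+ 2.
  by rewrite exprn_gt0 // nc_gt0 moebius_den.
have := moebius_norm w1 z1.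
have h : 0 < (1 - nc w ^+ 2) * (1 - nc z ^+ 2).
  by rewrite mulr_gt0 // subr_gt0 expr_lt1 ?nc_ge0.
move=> H; rewrite -H pmulr_lgt0 // subr_gt0 in h.
by rewrite -(@expr_lt1 _ 2 (nc _)) ?nc_ge0.
Qed.

(* The mean over |z| = r of G composed with the disc automorphism that sends
   0 to w is G(w), and this automorphism sends |z| = r near the unit circle. *)
Lemma max_modulus (G : C -> V) (s K : R) : 0 <= s < 1 ->
  (forall z j, nc z < 1 -> exists d, hasder (fun y => G y ord0 j) z d) ->
  (forall z, s <= nc z < 1 -> N (G z) <= K) ->
  forall w, nc w < 1 -> N (G w) <= K.
Proof.
move=> /andP[s0 s1] hG hK w w1.
(* Since |1 + conj(w) z| >= 1 - |w|, [moebius_norm] bounds 1 - |image|^2 by (1 - r^2) / (1 - |w|)^2.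
   The radius r = 1 - ka/2 satisfies 1 - r^2 <= ka, which puts the image in s <= |z| < 1. *)
pose ka := (1 - s ^+ 2) * (1 - nc w) ^+ 2.
have w0 := nc_ge0 w.
have ka01 : 0 < ka <= 1.
  have s2 : s ^+ 2 < 1 by rewrite expr_lt1.
  have s20 : 0 <= s ^+ 2 := sqr_ge0 s.
  have q1 : (1 - nc w) ^+ 2 <= 1.
    by rewrite expr_le1 ?subr_ge0 ?(ltW w1) // gerBl.
  have q0 : 0 < (1 - nc w) ^+ 2 by rewrite exprn_gt0 // subr_gt0.
  by rewrite /ka; move: s2 s20 q1 q0; set a := s ^+ 2; set b := _ ^+ 2;
    move=> *; apply/andP; split; nra.
pose r := 1 - ka / 2.
have [r0 r1 rka] : [/\ 0 < r, r < 1 & 1 - r ^+ 2 <= ka].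
  by rewrite /r; move/andP: ka01 => [k0 k1]; split; [lra|lra|nra].
pose F y := G (moebius w y).
have hs z : nc z = r -> N (F z) <= K.
  move=> hz; have z1 : nc z < 1 by rewrite hz.
  apply: hK; rewrite moebius_lt1 // andbT.
  rewrite -(@ler_pXn2r _ 2) ?nnegrE ?nc_ge0 //.
  have := moebius_norm w1 z1; rewrite hz.
  set d := nc (1 + cj w * z) ^+ 2; set m := nc _ ^+ 2.
  have dw : (1 - nc w) ^+ 2 <= d.
    rewrite /d ler_pXn2r ?nnegrE ?nc_ge0 ?subr_ge0 ?(ltW w1) //.
    have := nc_le_dist 1 (1 + cj w * z).
    rewrite nc1 opprD addrA subrr sub0r ncN ncM nc_cj.
    have := nc_ge0 z; nra.
  have m1 : m < 1 by rewrite expr_lt1 ?nc_ge0 // moebius_lt1.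
  have dp : 0 < (1 - nc w) ^+ 2 by rewrite exprn_gt0 // subr_gt0.
  move: rka; rewrite /ka => h1 h2.
  have h3 : (1 - m) * (1 - nc w) ^+ 2 <= (1 - s ^+ 2) * (1 - nc w) ^+ 2.
    apply: le_trans h1; apply: le_trans (_ : (1 - m) * d <= _).
      by rewrite ler_wpM2l // subr_ge0 ltW.
    rewrite h2 ger_pMl; last by rewrite subr_gt0 expr_lt1 // ltW.
    by rewrite gerBl sqr_ge0.
  by move: h3; rewrite ler_pM2r //; lra.
have hF j z : nc z < 1 -> exists d, hasder (fun y => F y ord0 j) z d.
  move=> z1; have [d hd] := hG (moebius w z) j (moebius_lt1 w1 z1).
  have h1 : hasder (fun y => y + w) z (1 + 0).
    by apply: hasderD; [exact: hasder_id|exact: hasder_cst].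
  have h2 : hasder (fun y => 1 + cj w * y) z (cj w) by exact: hasder_affine.
  have h3 := @hasder_div _ (fun y => y + w) (fun y => 1 + cj w * y) z _ _
    (moebius_den w1 z1) h1 h2.
  by eexists; exact: (@hasder_comp _ (moebius w) (fun y => G y ord0 j) z _ _ h3 hd).
(* The norm is convex, so the vector of means obeys the bound K; coordinatewise it tends to G(w). *)
pose u k : V := tmean (fun y => F (circpt r y)) k 0 (ii R).
have uE k j : u k ord0 j = circmean (fun z => F z ord0 j) k r.
  rewrite /circmean /cmean /u.
  have := @tmean_linear R V C^o (fun x : V => x ord0 j)
    (fun y => F (circpt r y)) k 0 (ii R).
  by move=> <- // x y; rewrite !mxE.
have uK k : N (u k) <= K.
  apply: (@tmean_ind _ _ (fun x => N x <= K)) => [x y hx hy|y hy].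
    rewrite lnormZ // (_ : 2^-1 = ofR 2^-1); last by rewrite fmorphV rmorph_nat.
    rewrite nc_ofR gtr0_norm // ler_pdivrMl //.
    by apply: le_trans (lnormD t_ge1 _ _) _; rewrite mulr_natl mulr2n lerD.
  by apply: hs; rewrite nc_circpt_seg // ltW.
have lim j : clim (fun k => u k ord0 j) (G w ord0 j).
  have <- : F 0 = G w.
    by rewrite /F /moebius mulr0 addr0 divr1 add0r.
  have hd0 : exists d, hasder (fun y => F y ord0 j) 0 d by apply: hF; rewrite nc0.
  case: hd0 => d0 hd0.
  have := mean_value r0 (_ : forall z, 0 < nc z <= r -> _) (hasder_cont hd0).
  move=> /(_ (fun z hz => hF j z (le_lt_trans (andP hz).2 r1))).
  by apply: clim_ext => k; rewrite uE.
apply/ler_addgt0Pr => e e0.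
have n1 : 0 < n%:R + 1 :> R by rewrite ltr_wpDl.
have /choice[N0 hN0] : forall j, exists N0 : nat, forall k, (N0 <= k)%N ->
    nc (u k ord0 j - G w ord0 j) <= e / (n%:R + 1).
  by move=> j; apply: lim; exact: divr_gt0.
pose k := (\max_j N0 j)%N.
have hk : linf (u k - G w) <= e / (n%:R + 1).
  apply/linf_leP => [|j]; first by rewrite divr_ge0 // ltW.
  by rewrite !mxE; apply: hN0; exact: leq_bigmax.
rewrite -[G w](subKr (u k)).
apply: le_trans (lnormD t_ge1 _ _) _; rewrite lerD //.
rewrite -scaleN1r lnormZ // ncN nc1 mul1r.
apply: le_trans (lnorm_le_linf t_ge1 _) _.
apply: le_trans (_ : (n%:R + 1) * (e / (n%:R + 1)) <= _); last first.
  by rewrite mulrC divfK // gt_eqF.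
by apply: ler_pM => //; rewrite ?linf_ge0 // lerDl.
Qed.

Lemma exprn_lipschitz (r s : R) k : 0 <= r -> r <= s -> s <= 1 ->
  s ^+ k - r ^+ k <= k%:R * (s - r).
Proof.
move=> r0 rs s1; elim: k => [|k IH]; first by rewrite !expr0 subrr mul0r.
have -> : s ^+ k.+1 - r ^+ k.+1 = s * (s ^+ k - r ^+ k) + r ^+ k * (s - r).
  by rewrite !exprS; ring.
have rk : r ^+ k <= 1 by rewrite exprn_ile1 // (le_trans rs).
have sk : r ^+ k <= s ^+ k by rewrite lerXn2r // ?nnegrE ?(le_trans r0).
rewrite -natr1 mulrDl mul1r lerD //.
  by apply: le_trans IH; rewrite ler_piMl // subr_ge0.
by rewrite ler_piMl // subr_ge0.
Qed.

(** Serves estimates on lines, proved first for z / s with N z < s < 1: letting s decrease to N z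
    also covers z = 0, where division by N z fails. *)
Lemma le_pow_right (r c y : R) k : 0 <= r < 1 -> 0 <= c ->
  (forall s, r < s < 1 -> y <= c * s ^+ k) -> y <= c * r ^+ k.
Proof.
move=> /andP[r0 r1] c0 H; apply: (@le_harmonic _ _ _ (c * k%:R * (1 - r))) => i.
pose d : R := i.+2%:R^-1.
have d0 : 0 < d by rewrite invr_gt0.
have d1 : d < 1 by rewrite invf_lt1 // ltr1n.
have di : d <= i.+1%:R^-1 by rewrite lef_pV2 ?posrE // ler_nat.
pose s := r + (1 - r) * d.
have rs : r < s by rewrite ltrDl mulr_gt0 // subr_gt0.
have s1 : s < 1 by rewrite /s; nra.
apply: le_trans (H s _) _; first by rewrite rs.
have h := exprn_lipschitz k r0 (ltW rs) (ltW s1).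
apply: le_trans (_ : c * (r ^+ k + k%:R * (s - r)) <= _).
  by rewrite ler_wpM2l //; lra.
rewrite mulrDr lerD2l /s addrC addKr -!mulrA ler_wpM2l // ler_wpM2l //.
by rewrite ler_wpM2l // subr_ge0 ltW.
Qed.

Lemma le_pow_left (x : R) k : 0 <= x -> (forall s, 0 < s < 1 -> x * s ^+ k <= 1) -> x <= 1.
Proof.
move=> x0 H; apply: (@le_harmonic _ _ _ (x * k%:R)) => i.
pose d : R := i.+2%:R^-1.
have d0 : 0 < d by rewrite invr_gt0.
have d1 : d < 1 by rewrite invf_lt1 // ltr1n.
have di : d <= i.+1%:R^-1 by rewrite lef_pV2 ?posrE // ler_nat.
have s0 : 0 <= 1 - d by rewrite subr_ge0 ltW.
have h := exprn_lipschitz k s0 (_ : 1 - d <= 1) (lexx 1).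
have {}h : 1 - (1 - d) ^+ k <= k%:R * d.
  by have := h (_ : is_true _); rewrite expr1n subKr; apply; rewrite gerBl ltW.
have h2 : x * (1 - d) ^+ k <= 1 by apply: H; lra.
have : x * (1 - k%:R * d) <= 1.
  by apply: le_trans h2; rewrite ler_wpM2l //; lra.
rewrite mulrBr mulr1 lerBlDr => /le_trans; apply; rewrite lerD2l mulrA.
by rewrite ler_wpM2l // mulr_ge0.
Qed.

(** Division by z^m leaves a holomorphic G with N (G z) <= s^-m for s <= |z| < 1, hence on the whole
    disc by the maximum principle; then s tends to 1. *)
Lemma schwarz_vector (D : 'I_n -> nat -> C -> C) (v : C -> V) m :
  (forall j, derivatives 1 (D j)) -> (forall z j, v z ord0 j = D j 0%N z) ->
  (forall j k, (k < m)%N -> D j k 0 = 0) ->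
  (forall z, nc z < 1 -> N (v z) <= 1) ->
  forall z, nc z < 1 -> N (v z) <= nc z ^+ m.
Proof.
move=> hD vE D0 v1 z z1.
have /choice[psi hpsi] : forall j, exists psi : C -> C,
    (forall z, D j 0%N z = psi z * z ^+ m) /\
    (forall z, nc z < 1 -> exists d, hasder psi z d).
  by move=> j; apply: taylor_division (hD j) (D0 j).
pose G y : V := \row_j psi j y.
have vG y : v y = y ^+ m *: G y.
  by apply/rowP => j; rewrite vE !mxE (hpsi j).1 mulrC.
suff G1 : N (G z) <= 1 by rewrite vG lnormZ // ncX ler_piMr // exprn_ge0 ?nc_ge0.
apply: (@le_pow_left _ m) => [|s /andP[s0 s1]]; first exact: lnorm_ge0.
have sm0 : 0 < s ^+ m by rewrite exprn_gt0.
rewrite -ler_pdivlMr // div1r.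
apply: (@max_modulus G s (s ^+ m)^-1) z1; first by rewrite ltW.
  move=> y j y1; have [d hd] := (hpsi j).2 y y1; exists d.
  by apply: (hasder_near ltr01 _ hd) => w _; rewrite mxE.
move=> y /andP[sy y1]; have := v1 y y1.
rewrite vG lnormZ // ncX -div1r ler_pdivlMr // => h; apply: le_trans h.
by rewrite mulrC ler_wpM2r ?lnorm_ge0 // lerXn2r ?nnegrE ?nc_ge0 ?(ltW s0).
Qed.

End SchwarzLemma.

(** * The Schwarz-Pick lemma on the disc *)

Section SchwarzPick.
Variable R : realType.
Local Notation C := (Cplx R).
Local Notation nc := (@Normc.normc R).

Lemma differentiable_rV1 (f : C -> C) (x : 'rV[C]_1) d : hasder f (x ord0 ord0) d ->
  differentiable (fun z : 'rV[C]_1 => \row_(j < 1) f (z ord0 j)) x.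
Proof.
move=> hf; pose L (h : 'rV[C]_1) : 'rV[C]_1 := d *: h.
have linf1 (z : 'rV[C]_1) : linf z = nc (z ord0 ord0).
  apply/le_anti; rewrite nc_le_linf andbT; apply/linf_leP => [|j].
    exact: nc_ge0.
  by rewrite (ord1 j).
have linL : linear L by move=> a u v; rewrite /L scalerDr !scalerA mulrC.
have LK h : linf (L h) <= nc d * linf h by rewrite linfZ.
apply: (@eps_differentiable _ _ _ L x (nc d) linL LK _).1 => e e0.
 have [dl dl0 Hd] := hasder_eps hf e0.
exists dl => // h; rewrite !linf1 => /Hd; by rewrite !mxE.
Qed.

(** A function on the disc is viewed as a map of the one-dimensional ball, so that its higher
    derivatives come from [frechetD_derivatives]. *)
Lemma derivatives_exist (f : C -> C) :
  (forall z, nc z < 1 -> exists d, hasder f z d) ->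
  exists2 D : nat -> C -> C, derivatives 1 D & D 0%N = f.
Proof.
move=> hf; pose F (z : 'rV[C]_1) : 'rV[C]_1 := \row_j f (z ord0 j).
have oo : (1 <= +oo :> \bar R)%E by rewrite leey.
have hF : holomorphic (lball +oo%E) F.
  move=> x hx; have [|d hd] := hf (x ord0 ord0).
    by apply: le_lt_trans hx; exact: nc_le_linf.
  exact: differentiable_rV1 hd.
pose e : 'rV[C]_1 := delta_mx ord0 ord0.
have e1 : @lnorm R 1 +oo%E e = 1 by exact: lnorm_delta.
exists (fun k z => frechetD F (z *: e) (nseq k e) ord0 ord0).
  apply: (@frechetD_derivatives _ _ +oo%E oo F e ord0 1 hF).
  by rewrite e1 mulr1.
by apply/funext => z /=; rewrite !mxE !eqxx mulr1.
Qed.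

Lemma schwarz_scalar (f : C -> C) :
  (forall z, nc z < 1 -> exists d, hasder f z d) -> f 0 = 0 ->
  (forall z, nc z < 1 -> nc (f z) <= 1) ->
  forall z, nc z < 1 -> nc (f z) <= nc z.
Proof.
move=> hf f0 f1 z z1; have [D hD DE] := derivatives_exist hf.
have oo : (1 <= +oo :> \bar R)%E by rewrite leey.
pose v y : 'rV[C]_1 := \row_j f y.
have vE y : @lnorm R 1 +oo%E (v y) = nc (f y).
  apply/le_anti/andP; split.
    by apply/linf_leP => [|j]; rewrite ?nc_ge0 // mxE.
  by have := nc_le_linf (v y) ord0; rewrite mxE.
rewrite -vE -[leRHS]expr1.
apply: (@schwarz_vector _ _ _ oo (fun=> D) v 1) => //.
- by move=> y j; rewrite mxE DE.
- by move=> _ k; rewrite ltnS leqn0 => /eqP ->; rewrite DE.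
- by move=> y y1; rewrite vE; exact: f1.
Qed.

(* For l < 1 the Moebius map is applied to l f, so that no case |f 0| = 1
   arises; then l tends to 1. *)
Lemma schwarz_pick (f : C -> C) :
  (forall z, nc z < 1 -> exists d, hasder f z d) ->
  (forall z, nc z < 1 -> nc (f z) <= 1) ->
  forall z, nc z < 1 -> nc (f z - f 0) <= nc z * nc (1 - cj (f 0) * f z).
Proof.
move=> hf f1 z z1; set c0 := f 0.
have c1 : nc c0 <= 1 by apply: f1; rewrite nc0.
have main (l : R) : 0 <= l < 1 ->
    l * nc (f z - c0) <= nc z * nc (1 - cj (ofR l * c0) * (ofR l * f z)).
  move=> /andP[l0 l1].
  have nl y : nc y <= 1 -> nc (ofR l * y) < 1.
    by move=> hy; rewrite ncM nc_ofR ger0_norm //; have := nc_ge0 y; nra.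
  pose a := ofR l * c0.
  have na : nc (- a) < 1 by rewrite ncN nl.
  pose H y := moebius (- a) (ofR l * f y).
  have den y : nc y < 1 -> 1 - cj a * (ofR l * f y) != 0.
    move=> y1; have := moebius_den na (nl _ (f1 y y1)).
    by rewrite (_ : cj (- a) = - cj a) ?mulNr //; apply: complex_ext; rewrite !reimE.
  have HE y : H y = (ofR l * f y - a) / (1 - cj a * (ofR l * f y)).
    rewrite /H /moebius (_ : cj (- a) = - cj a) ?mulNr //.
    by apply: complex_ext; rewrite !reimE.
  have : nc (H z) <= nc z.
    apply: schwarz_scalar z1; last by move=> y y1; rewrite ltW // moebius_lt1 // nl // f1.
      move=> y y1; have [d hd] := hf y y1.
      have h1 := hasderB (hasderZ (ofR l) hd) (hasder_cst a y).
      have h2 := hasderB (hasder_cst 1 y) (hasderZ (cj a) (hasderZ (ofR l) hd)).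
      have h3 := @hasder_div _ (fun y => ofR l * f y - a)
        (fun y => 1 - cj a * (ofR l * f y)) y _ _ (den y y1) h1 h2.
      by eexists; apply: (hasder_near ltr01 _ h3) => w _; rewrite HE.
    by rewrite HE subrr mul0r.
  rewrite HE ncM ncV -mulrBr ncM nc_ofR ger0_norm // ler_pdivrMr //.
  by rewrite nc_gt0 den.
(* The 4 collects two errors of 2 / (i + 1): one from the factor |1 - conj(c0) f(z)|, one from the
   factor l on the left. *)
apply: (@le_harmonic _ _ _ 4) => i.
pose d : R := i.+1%:R^-1.
have d0 : 0 < d by rewrite invr_gt0.
have d1 : d <= 1 by rewrite invf_le1 // ler1n.
have := main (1 - d) (_ : is_true _); rewrite subr_ge0 d1 gtrBl d0 => /(_ isT).
set l := 1 - d => h.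
have fz1 := f1 z z1.
have h2 : nc (1 - cj (ofR l * c0) * (ofR l * f z)) <= nc (1 - cj c0 * f z) + 2 * d.
  have -> : 1 - cj (ofR l * c0) * (ofR l * f z) =
      (1 - cj c0 * f z) + ofR (1 - l ^+ 2) * (cj c0 * f z).
    have -> : cj (ofR l * c0) = ofR l * cj c0 by apply: complex_ext; rewrite !reimE; ring.
    have -> : ofR (1 - l ^+ 2) = 1 - ofR l * ofR l.
      by apply: complex_ext; rewrite !reimE; ring.
    by ring.
  apply: le_trans (ncD _ _) _; rewrite lerD2l ncM nc_ofR ncM nc_cj.
  have -> : 1 - l ^+ 2 = d * (2 - d) by rewrite /l; ring.
  rewrite ger0_norm; last by nra.
  have : nc c0 * nc (f z) <= 1 by rewrite mulr_ile1 ?nc_ge0.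
  have : 0 <= nc c0 * nc (f z) by rewrite mulr_ge0 ?nc_ge0.
  nra.
have h3 := ncB (f z) c0.
have h4 := nc_ge0 z; have h5 := nc_ge0 (1 - cj c0 * f z).
have h6 : nc z * nc (1 - cj (ofR l * c0) * (ofR l * f z)) <=
    nc z * nc (1 - cj c0 * f z) + 2 * d.
  apply: le_trans (_ : nc z * (nc (1 - cj c0 * f z) + 2 * d) <= _).
    by rewrite ler_wpM2l.
  by rewrite mulrDr lerD2l ler_piMl ?mulr_ge0 ?(ltW z1) // ltW.
have h7 : d * nc (f z - c0) <= d * 2 by rewrite ler_wpM2l ?(ltW d0) //; lra.
by move: h h6 h7; rewrite /l -/d; lra.
Qed.

End SchwarzPick.

(** * The Bohr inequality *)

Section BohrInequality.
Variables (R : realType) (n : nat) (t : \bar R).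
Hypothesis t_ge1 : (1 <= t)%E.
Local Notation C := (Cplx R).
Local Notation nc := (@Normc.normc R).
Local Notation V := 'rV[C]_n.
Local Notation N := (@lnorm R n t).

Lemma lnorm_rescale (z : V) (s : R) : N z < s ->
  N (ofR s^-1 *: z) < 1 /\ ofR s *: (ofR s^-1 *: z) = z.
Proof.
move=> zs; have s0 : 0 < s by apply: le_lt_trans zs; exact: lnorm_ge0.
rewrite lnormZ // nc_ofR gtr0_norm ?invr_gt0 // mulrC ltr_pdivrMr // mul1r; split=> //.
by rewrite scalerA -rmorphM divff ?gt_eqF // rmorph1 scale1r.
Qed.

Lemma lnorm_line (h : V) (z : C) : N h < 1 -> nc z < 1 -> lball t (z *: h).
Proof.
rewrite /lball /= lnormZ // => h1 z1; have := lnorm_ge0 t_ge1 h.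
have := nc_ge0 z; nra.
Qed.

(** On the line through h = z / s, with N z < s < 1, [v] becomes a vector function on the disc that
    vanishes to order m at 0. At the point s it takes the value v(z), so N (v z) <= s^m, and s
    decreases to N z. *)
Lemma schwarz_mapping_bound (v : V -> V) m z : schwarz_mapping t v ->
  zero_of_order m v -> lball t z -> N (v z) <= N z ^+ m.
Proof.
move=> [hv vb v0] [hz _] zb; rewrite -[leRHS]mul1r.
apply: le_pow_right => [|//|s /andP[zs s1]]; first by rewrite lnorm_ge0.
have [h1 hE] := lnorm_rescale zs; set h := _ *: z in h1 hE.
have s0 : 0 < s by apply: le_lt_trans zs; exact: lnorm_ge0.
have ns : nc (ofR s) = s by rewrite nc_ofR gtr0_norm.
rewrite mul1r -ns -{1}hE.
apply: (@schwarz_vector _ _ _ t_ge1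
  (fun j k y => frechetD v (y *: h) (nseq k h) ord0 j) (fun y => v (y *: h))) => //.
- move=> j; apply: (frechetD_derivatives t_ge1 j hv).
  by rewrite mul1r ltW.
- by move=> j k km; rewrite scale0r hz ?size_nseq // mxE.
- by move=> y y1; rewrite ltW //; apply: vb; exact: lnorm_line.
- by rewrite ns.
Qed.

Lemma line_hasder (f : V -> V) h j (y : C) : holomorphic (lball t) f -> N h < 1 ->
  nc y < 1 -> exists d, hasder (fun y => f (y *: h) ord0 j) y d.
Proof.
move=> hf h1 y1; exists ('d f (0 + y *: h) h ord0 j).
have := @hasder_line _ _ f 0 h y j.
under eq_fun do rewrite add0r; apply; apply: hf.
by rewrite add0r; exact: lnorm_line.
Qed.

Lemma schwarz_pick_ball (f : V -> V) j w : polydisk_valued t f -> lball t w ->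
  nc (f w ord0 j - f 0 ord0 j) <=
  N w * nc (1 - cj (f 0 ord0 j) * f w ord0 j).
Proof.
move=> [hf f1] wb; rewrite mulrC -[N w]expr1.
apply: le_pow_right => [||s /andP[zs s1]]; rewrite ?lnorm_ge0 ?nc_ge0 //.
have [h1 hE] := lnorm_rescale zs; set h := _ *: w in h1 hE.
have s0 : 0 < s by apply: le_lt_trans zs; exact: lnorm_ge0.
have ns : nc (ofR s) = s by rewrite nc_ofR gtr0_norm.
rewrite expr1 mulrC -[X in X * _]ns -hE -[0](scale0r h).
apply: (@schwarz_pick _ (fun y => f (y *: h) ord0 j)).
- by move=> y y1; exact: line_hasder.
- by move=> y y1; apply: f1; exact: lnorm_line.
- by rewrite ns.
Qed.

Lemma coefficient_bound_ball (f : V -> V) j z k : (0 < k)%N ->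
  polydisk_valued t f -> lball t z ->
  nc (frechetD0 f k z ord0 j) / k`!%:R <=
  (1 - nc (f 0 ord0 j) ^+ 2) * N z ^+ k.
Proof.
move=> k0 [hf f1] zb; have a1 : nc (f 0 ord0 j) <= 1.
  by apply: f1; rewrite /lball /= lnorm0 ?ltr01.
apply: le_pow_right => [||s /andP[zs s1]]; first by rewrite lnorm_ge0.
  by rewrite subr_ge0 expr_le1 ?nc_ge0.
have N0 := lnorm_ge0 t_ge1 z.
(* Two radii are needed on the line y z: 1/s' for a disc mapped into the ball, and 1/s < 1/s' for
   the circle of the coefficient bound. Both make sense for z = 0. *)
pose s' := (N z + s) / 2.
have [s'0 zs' s's] : [/\ 0 < s', N z < s' & s' < s] by rewrite /s'; split; lra.
have s0 : 0 < s by lra.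
pose D k y := frechetD f (y *: z) (nseq k z) ord0 j.
have hD : derivatives s'^-1 D.
  apply: (frechetD_derivatives t_ge1 j hf).
  by rewrite mulrC ler_pdivrMr // mul1r ltW.
have D1 y : nc y < s'^-1 -> nc (D 0%N y) <= 1.
  move=> hy; apply: f1; rewrite /lball /= lnormZ //.
  have : nc y * s' < 1 by rewrite -ltr_pdivlMr // div1r.
  by apply: le_lt_trans; rewrite ler_wpM2l ?nc_ge0 // ltW.
have rr : 0 < s^-1 < s'^-1 by rewrite invr_gt0 s0 ltf_pV2.
have := coefficient_bound rr k0 hD D1.
rewrite /D scale0r /= exprVn ler_pdivrMr ?exprn_gt0 // ncM ncV.
by rewrite -(rmorph_nat (@ofR R)) nc_ofR ger0_norm.
Qed.

Lemma coefficient_bound_linf (f : V -> V) z k : (0 < k)%N ->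
  polydisk_valued t f -> (forall j, nc (f 0 ord0 j) = linf (f 0)) -> lball t z ->
  linf (frechetD0 f k z) / k`!%:R <= (1 - linf (f 0) ^+ 2) * N z ^+ k.
Proof.
move=> k0 hf ha zb; have kf : 0 < k`!%:R :> R by rewrite ltr0n fact_gt0.
(* An index is used to see that the right-hand side is nonnegative; for n = 0 all norms vanish. *)
rewrite ler_pdivrMr //; case: (pickP 'I_n) => [j0 _|n0]; last first.
  have l0 x : @linf R n x = 0.
    apply/le_anti; rewrite linf_ge0 andbT; apply/linf_leP => // j.
    by have := n0 j.
  by rewrite !l0 expr0n subr0 mul1r mulr_ge0 ?exprn_ge0 ?lnorm_ge0 // ltW.
have H j := coefficient_bound_ball j k0 hf zb.
apply/linf_leP => [|j]; last by rewrite -ler_pdivrMr // -(ha j).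
apply: le_trans (nc_ge0 _) (_ : nc (frechetD0 f k z ord0 j0) <= _).
by rewrite -ler_pdivrMr // -(ha j0).
Qed.

(** After squaring, Re(conj(c) b) enters with the factor 1 - rho^2 >= 0 and may be replaced by |c|
    |b|. This leaves (|b| - |c|)^2 <= rho^2 (1 - |c| |b|)^2, and a square root is taken. *)
Lemma pick_modulus (c b : C) (rho : R) : nc c <= 1 -> nc b <= 1 -> 0 <= rho < 1 ->
  nc (b - c) <= rho * nc (1 - cj c * b) ->
  nc b * (1 + nc c * rho) <= nc c + rho.
Proof.
move=> c1 b1 /andP[r0 r1] h.
have h2 : nc (b - c) ^+ 2 <= rho ^+ 2 * nc (1 - cj c * b) ^+ 2.
  by rewrite -exprMn ler_pXn2r ?nnegrE ?mulr_ge0 ?nc_ge0.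
have e1 : nc (b - c) ^+ 2 = nc b ^+ 2 + nc c ^+ 2 - 2 * re (cj c * b).
  by rewrite !nc_sqr !reimE; ring.
have e2 : nc (1 - cj c * b) ^+ 2 = 1 + nc c ^+ 2 * nc b ^+ 2 - 2 * re (cj c * b).
  by rewrite !nc_sqr !reimE; ring.
have hx : re (cj c * b) <= nc c * nc b by rewrite (le_trans (re_le_nc _)) // ncM nc_cj.
rewrite e1 e2 in h2; move: (re _) hx h2 => X hx h2.
have c0 := nc_ge0 c; have b0 := nc_ge0 b.
move: (nc c) (nc b) c0 b0 c1 b1 hx h2 {h e1 e2} => A B A0 B0 A1 B1 hx h2.
have r2 : 0 <= 1 - rho ^+ 2 by rewrite subr_ge0 expr_le1 // ltW.
have h3 : (B - A) ^+ 2 <= (rho * (1 - A * B)) ^+ 2.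
  have := ler_wpM2l r2 hx; nra.
have AB : 0 <= rho * (1 - A * B) by rewrite mulr_ge0 // subr_ge0 mulr_ile1.
have : B - A <= rho * (1 - A * B).
  apply: le_trans (ler_norm _) _; rewrite -(@ler_pXn2r _ 2) ?nnegrE //.
  by rewrite real_normK ?num_real.
lra.
Qed.

(** Writing 1 - conj(c) b = (1 - |c|^2) - conj(c) (b - c) puts the difference on both sides; as |c|
    <= 1, it is absorbed with factor rho. *)
Lemma pick_difference (c b : C) (rho : R) : nc c <= 1 -> 0 <= rho < 1 ->
  nc (b - c) <= rho * nc (1 - cj c * b) ->
  nc (b - c) <= (1 - nc c ^+ 2) * (rho / (1 - rho)).
Proof.
move=> c1 /andP[r0 r1] h.
have h1 : nc (1 - cj c * b) <= (1 - nc c ^+ 2) + nc c * nc (b - c).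
  have -> : 1 - cj c * b = ofR (1 - nc c ^+ 2) - cj c * (b - c).
    have -> : ofR (1 - nc c ^+ 2) = 1 - c * cj c.
      by rewrite mulr_cj -[1 in RHS]/(ofR 1) -rmorphB.
    by ring.
  apply: le_trans (ncB _ _) _; rewrite nc_ofR ncM nc_cj ger0_norm //.
  by rewrite subr_ge0 expr_le1 ?nc_ge0.
rewrite mulrA ler_pdivlMr ?subr_gt0 //.
have h2 := ler_wpM2l r0 h1.
have h3 : rho * (nc c * nc (b - c)) <= rho * nc (b - c).
  by rewrite ler_wpM2l // ler_piMl // nc_ge0.
lra.
Qed.

(** Bernoulli's inequality with exponent 1/s, applied to y^s. *)
Lemma powR_le_affine (y s : R) : 0 <= y -> 0 < s <= 1 -> y `^ s <= 1 + s * (y - 1).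
Proof.
move=> y0 /andP[s0 s1].
have h1 : 1 <= s^-1 by rewrite invf_ge1.
have := bernoulli_powR (powR_ge0 y s) h1.
rewrite -powRrM divff ?gt_eqF // powRr1 // => h.
have := ler_wpM2l (ltW s0) h.
by rewrite mulrDr mulr1 mulrA divff ?gt_eqF // mul1r; lra.
Qed.

(** Since 1 + a rho <= 1 + rho, the Pick bound gives 1 - B^2 >= (1 - a^2)(1 - rho)/(1 + rho). The
    power y^(p/2), concave because p <= 2, lies below its tangent at 1, and y = B^2. *)
Lemma powR_pick_bound (a B rho p : R) : 0 <= a <= 1 -> 0 <= B -> 0 <= rho < 1 ->
  0 < p <= 2 -> B * (1 + a * rho) <= a + rho ->
  B `^ p <= 1 - p / 2 * ((1 - a ^+ 2) * ((1 - rho) / (1 + rho))).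
Proof.
move=> /andP[a0 a1] B0 /andP[r0 r1] /andP[p0 p2] hB.
have d0 : 0 < 1 + a * rho by rewrite ltr_pwDl ?mulr_ge0.
have d1 : 0 < 1 + rho by lra.
have B2 : B ^+ 2 <= 1 - (1 - a ^+ 2) * ((1 - rho) / (1 + rho)).
  have hB2 : B ^+ 2 * (1 + a * rho) ^+ 2 <= (a + rho) ^+ 2.
    by rewrite -exprMn ler_pXn2r // nnegrE; [rewrite mulr_ge0 // ltW|rewrite addr_ge0].
  have da : (1 + a * rho) ^+ 2 <= (1 + rho) ^+ 2.
    by rewrite ler_pXn2r ?nnegrE ?(ltW d0) ?(ltW d1) // lerD2l ler_piMl.
  have k0 : 0 <= (1 - a ^+ 2) * (1 - rho ^+ 2).
    by rewrite mulr_ge0 // subr_ge0 expr_le1 // ltW.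
  have q0 : 0 < (1 + a * rho) ^+ 2 by rewrite exprn_gt0.
  have h1 : (1 - a ^+ 2) * ((1 - rho) / (1 + rho)) <=
      (1 - a ^+ 2) * (1 - rho ^+ 2) / (1 + a * rho) ^+ 2.
    have -> : (1 - a ^+ 2) * ((1 - rho) / (1 + rho)) =
        (1 - a ^+ 2) * (1 - rho ^+ 2) / (1 + rho) ^+ 2.
      by field; rewrite gt_eqF.
    by rewrite ler_wpM2l // lef_pV2 // posrE exprn_gt0.
  have h2 : B ^+ 2 <= 1 - (1 - a ^+ 2) * (1 - rho ^+ 2) / (1 + a * rho) ^+ 2.
    rewrite -(ler_pM2r q0) (le_trans hB2) // mulrBl divfK ?gt_eqF // mul1r.
    by rewrite le_eqVlt; apply/orP; left; apply/eqP; ring.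
  lra.
have BE : B `^ p = (B ^+ 2) `^ (p / 2).
  by rewrite -[B ^+ 2]powR_mulrn // -powRrM; congr powR; field.
have p21 : 0 < p / 2 <= 1 by apply/andP; split; lra.
rewrite BE (le_trans (powR_le_affine (sqr_ge0 B) p21)) //.
have p20 : 0 <= p / 2 by lra.
have := ler_wpM2l p20 B2; lra.
Qed.

Lemma geometric_sum (r : R) q m M : (0 < q)%N -> 0 <= r < 1 ->
  \sum_(1 <= s < M.+1) r ^+ (q * s + m) =
  r ^+ (q + m) * (1 - r ^+ q ^+ M) / (1 - r ^+ q).
Proof.
move=> q0 /andP[r0 r1].
have rq1 : r ^+ q < 1 by rewrite exprn_ilt1 // -lt0n.
elim: M => [|M IH]; first by rewrite big_geq // expr0 subrr mulr0 mul0r.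
rewrite big_nat_recr //= IH mulnS !exprD -exprM exprS exprM; field.
by rewrite gt_eqF // subr_gt0.
Qed.

Lemma geometric_tail (r : R) q m M : (0 < q)%N -> 0 <= r < 1 ->
  \sum_(1 <= s < M) r ^+ (q * s + m) <= r ^+ (q + m) / (1 - r ^+ q).
Proof.
move=> q0 r01; have /andP[r0 r1] := r01.
have rq1 : r ^+ q < 1 by rewrite exprn_ilt1 // -lt0n.
have d0 : 0 < 1 - r ^+ q by rewrite subr_gt0.
have rm0 k : 0 <= r ^+ k by rewrite exprn_ge0.
case: M => [|M]; first by rewrite big_geq // divr_ge0 // ltW.
rewrite geometric_sum // ler_pM2r ?invr_gt0 // ler_piMr // gerBl exprn_ge0 //.
Qed.

Lemma bohr_inequality (p mu nu : R) (q m m1 m2 : nat)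
    (f v1 v2 : V -> V) z :
  0 < p -> p <= 2 -> (0 < q)%N -> (0 < m1)%N -> (0 < m2)%N -> 0 <= mu -> 0 <= nu ->
  polydisk_valued t f -> (forall j, nc (f 0 ord0 j) = linf (f 0)) ->
  schwarz_mapping t v1 -> zero_of_order m1 v1 ->
  schwarz_mapping t v2 -> zero_of_order m2 v2 -> lball t z ->
  2 * mu * (N z ^+ (q + m) / (1 - N z ^+ q)) + 2 * nu * (N z ^+ m2 / (1 - N z ^+ m2))
    - p * ((1 - N z ^+ m1) / (1 + N z ^+ m1)) <= 0 ->
  (bohr_sum p mu nu q m f v1 v2 z <= 1)%E.
Proof.
move=> p0 p2 q0 m10 m20 mu0 nu0 hf ha hv1 hz1 hv2 hz2 zb hg.
have z0 := lnorm_ge0 t_ge1 z.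
have zlt : N z < 1 := zb.
have pow1 k : (0 < k)%N -> 0 <= N z ^+ k < 1.
  by move=> k0; rewrite exprn_ge0 //= exprn_ilt1 // -lt0n.
set a := linf (f 0) in ha.
have a1 : 0 <= a <= 1.
  rewrite linf_ge0; apply/linf_leP => // j; apply: hf.2.
  by rewrite /lball /= lnorm0.
have T1 : linf (f (v1 z)) `^ p <=
    1 - p / 2 * ((1 - a ^+ 2) * ((1 - N z ^+ m1) / (1 + N z ^+ m1))).
  have vb : lball t (v1 z) by case: hv1 => _ + _; apply.
  apply: powR_pick_bound => //; first exact: linf_ge0.
    exact: pow1.
    by rewrite p0.
  have d0 : 0 < 1 + a * N z ^+ m1.
    by case/andP: a1 => a0 _; rewrite ltr_pwDl ?mulr_ge0 ?exprn_ge0.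
  rewrite -ler_pdivlMr //; apply/linf_leP => [|j].
    by case/andP: a1 => a0 _; rewrite divr_ge0 ?(ltW d0) // addr_ge0 ?exprn_ge0.
  rewrite ler_pdivlMr // -(ha j); apply: pick_modulus; rewrite ?pow1 //.
  - by rewrite ha; case/andP: a1.
  - exact: hf.2.
  apply: le_trans (schwarz_pick_ball j hf vb) _.
  by rewrite ler_wpM2r ?nc_ge0 // schwarz_mapping_bound.
have T2 : linf (f (v2 z) - f 0) <= (1 - a ^+ 2) * (N z ^+ m2 / (1 - N z ^+ m2)).
  have vb : lball t (v2 z) by case: hv2 => _ + _; apply.
  have /andP[k0 k1] := pow1 _ m20.
  have a2 : 0 <= 1 - a ^+ 2 by case/andP: a1 => a0 a1; rewrite subr_ge0 expr_le1.
  apply/linf_leP => [|j]; first by rewrite mulr_ge0 // divr_ge0 // subr_ge0 ltW.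
  rewrite !mxE -(ha j); apply: pick_difference; rewrite ?pow1 //.
    by rewrite ha; case/andP: a1.
  apply: le_trans (schwarz_pick_ball j hf vb) _.
  by rewrite ler_wpM2r ?nc_ge0 // schwarz_mapping_bound.
have a2 : 0 <= 1 - a ^+ 2 by case/andP: a1 => a0 a1; rewrite subr_ge0 expr_le1.
have T3 : (\sum_(1 <= s <oo)
    (linf (frechetD0 f (q * s + m) z) / ((q * s + m)`!)%:R)%:E <=
    ((1 - a ^+ 2) * (N z ^+ (q + m) / (1 - N z ^+ q)))%:E)%E.
  apply: lime_le.
    apply: is_cvg_nneseries => s _ _.
    by rewrite lee_fin divr_ge0 ?linf_ge0.
  apply: nearW => M; rewrite sumEFin lee_fin.
  apply: le_trans (_ : (1 - a ^+ 2) * \sum_(1 <= s < M) N z ^+ (q * s + m) <= _).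
    rewrite mulr_sumr; apply: ler_sum_nat => s /andP[s1 _].
    by apply: coefficient_bound_linf => //; rewrite addn_gt0 muln_gt0 q0 s1.
  by rewrite ler_wpM2l // geometric_tail // z0.
rewrite /bohr_sum.
apply: le_trans (_ : ((1 - p / 2 * ((1 - a ^+ 2) * ((1 - N z ^+ m1) / (1 + N z ^+ m1))))%:E
  + mu%:E * ((1 - a ^+ 2) * (N z ^+ (q + m) / (1 - N z ^+ q)))%:E
  + (nu * ((1 - a ^+ 2) * (N z ^+ m2 / (1 - N z ^+ m2))))%:E)%E <= _)%E.
  apply: leeD; last by rewrite lee_fin ler_wpM2l.
  apply: leeD; first by rewrite lee_fin.
  by apply: lee_wpmul2l; rewrite ?lee_fin.
rewrite -EFinM -!EFinD lee_fin.
have := ler_wpM2l a2 hg; rewrite mulr0; lra.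
Qed.

End BohrInequality.

(** * Monotonicity and the root of the Bohr equation *)

Section BohrRadius.
Variables (R : realType) (p mu nu : R) (q m m1 m2 : nat).
Hypotheses (p_gt0 : 0 < p) (q_gt0 : (0 < q)%N) (m1_gt0 : (0 < m1)%N)
  (m2_gt0 : (0 < m2)%N) (mu_ge0 : 0 <= mu) (nu_ge0 : 0 <= nu)
  (munu_gt0 : 0 < mu + nu).

(** Unfolds to the left-hand side of [bohr_equation], so roots of one are roots of the other by
    conversion. *)
Definition bohr_fun (r : R) : R :=
  2 * mu * (r ^+ (q + m) / (1 - r ^+ q)) + 2 * nu * (r ^+ m2 / (1 - r ^+ m2))
  - p * ((1 - r ^+ m1) / (1 + r ^+ m1)).

Lemma exprn_lt1_pos k (r : R) : (0 < k)%N -> 0 <= r < 1 -> 0 <= r ^+ k < 1.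
Proof. by move=> k0 /andP[r0 r1]; rewrite exprn_ge0 //= exprn_ilt1 // -lt0n. Qed.

Lemma frac_homo k l (x y : R) : (0 < l)%N -> 0 <= x -> x <= y -> y < 1 ->
  x ^+ k / (1 - x ^+ l) <= y ^+ k / (1 - y ^+ l).
Proof.
move=> l0 x0 xy y1; have y0 := le_trans x0 xy.
have /andP[_ yl1] := @exprn_lt1_pos l y l0 (introT andP (conj y0 y1)).
have xl : x ^+ l <= y ^+ l by rewrite lerXn2r ?nnegrE.
apply: ler_pM; rewrite ?exprn_ge0 ?invr_ge0 ?lerXn2r ?nnegrE //; first by lra.
by rewrite lef_pV2 ?posrE; lra.
Qed.

Lemma bohr_fun_homo (x y : R) : 0 <= x -> x <= y -> y < 1 -> bohr_fun x <= bohr_fun y.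
Proof.
move=> x0 xy y1; have y0 := le_trans x0 xy.
have h1 := @frac_homo (q + m) q x y q_gt0 x0 xy y1.
have h2 := @frac_homo m2 m2 x y m2_gt0 x0 xy y1.
have h3 : x ^+ m1 <= y ^+ m1 by rewrite lerXn2r ?nnegrE.
have xm : 0 <= x ^+ m1 by rewrite exprn_ge0.
have h4 : (1 - y ^+ m1) / (1 + y ^+ m1) <= (1 - x ^+ m1) / (1 + x ^+ m1).
  rewrite ler_pdivrMr; last by lra.
  rewrite mulrAC ler_pdivlMr; last by lra.
  move: (x ^+ m1) (y ^+ m1) h3 xm => u v; nra.
have k1 : 0 <= 2 * mu by rewrite mulr_ge0.
have k2 : 0 <= 2 * nu by rewrite mulr_ge0.
rewrite /bohr_fun lerB ?lerD ?ler_wpM2l // ?(ltW p_gt0) //.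
Qed.

(** Strictness comes from the last term, as p > 0; the other two contribute weak monotonicity, since
    mu or nu may be 0. *)
Lemma bohr_fun_lt (x y : R) : 0 <= x -> x < y -> y < 1 -> bohr_fun x < bohr_fun y.
Proof.
move=> x0 xy y1; have y0 := le_trans x0 (ltW xy).
have h1 := @frac_homo (q + m) q x y q_gt0 x0 (ltW xy) y1.
have h2 := @frac_homo m2 m2 x y m2_gt0 x0 (ltW xy) y1.
have h3 : x ^+ m1 < y ^+ m1 by rewrite ltrXn2r ?nnegrE // -lt0n.
have xm : 0 <= x ^+ m1 by rewrite exprn_ge0.
have h4 : (1 - y ^+ m1) / (1 + y ^+ m1) < (1 - x ^+ m1) / (1 + x ^+ m1).
  rewrite ltr_pdivrMr; last by lra.
  rewrite mulrAC ltr_pdivlMr; last by lra.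
  move: (x ^+ m1) (y ^+ m1) h3 xm => u v; nra.
have k1 : 0 <= 2 * mu by rewrite mulr_ge0.
have k2 : 0 <= 2 * nu by rewrite mulr_ge0.
by rewrite /bohr_fun ler_ltB ?lerD ?ler_wpM2l ?ltr_pM2l.
Qed.

(* Near 1 both fractions are at least 1 / (2 L d), where r = 1 - d. *)
Lemma bohr_fun_pos : exists2 b : R, 0 < b < 1 & 0 <= bohr_fun b.
Proof.
pose L : R := (q + m + m2 + q)%:R.
have L0 : 0 < L by rewrite ltr0n !addn_gt0 q_gt0.
have L1 : 1 <= L by rewrite ler1n !addn_gt0 q_gt0.
(* L is at least q + m, q and m2, so 1 - (1 - d)^l <= L d <= 1/2 for these exponents and each
   fraction is at least 1 / (2 L d). The last condition makes (mu + nu) / (L d) at least p, which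
   dominates the subtracted term. *)
have [d [d0 dL dp]] : exists d : R, [/\ 0 < d, d * (2 * L) <= 1 & d * (L * p) <= mu + nu].
  exists (Num.min (1 / (2 * L)) ((mu + nu) / (L * p))); split.
  - by rewrite lt_min !divr_gt0 ?mulr_gt0.
  - by rewrite -ler_pdivlMr ?mulr_gt0 // ge_min lexx.
  - by rewrite -ler_pdivlMr ?mulr_gt0 // ge_min lexx orbT.
have d1 : d < 1 by nra.
exists (1 - d); first by apply/andP; split; lra.
have frac k l : (0 < l)%N -> (k <= q + m + m2 + q)%N -> (l <= q + m + m2 + q)%N ->
    1 / (2 * (L * d)) <= (1 - d) ^+ k / (1 - (1 - d) ^+ l).
  move=> l0 kL lL.
  have lip i : (i <= q + m + m2 + q)%N -> 1 - (1 - d) ^+ i <= L * d.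
    move=> iL; have := @exprn_lipschitz R (1 - d) 1 i.
    rewrite expr1n subKr => h; apply: le_trans (h _ _ _) _; try lra.
    by rewrite ler_wpM2r ?ler_nat // ltW.
  have := lip k kL; have := lip l lL.
  have /andP[_ rl1] : 0 <= (1 - d) ^+ l < 1 by apply: exprn_lt1_pos => //; lra.
  move: ((1 - d) ^+ k) ((1 - d) ^+ l) rl1 => u v v1 hv hu.
  have Ld : 0 < L * d by rewrite mulr_gt0.
  rewrite ler_pdivrMr ?mulr_gt0 // mulrAC ler_pdivlMr; last by lra.
  nra.
have f1 := @frac (q + m)%N q q_gt0.
have f2 := @frac m2 m2 m2_gt0.
have {}f1 := f1 (leq_trans (leq_addr m2 _) (leq_addr q _)) (leq_addl _ _).
have m2L : (m2 <= q + m + m2 + q)%N by rewrite addnAC leq_addl.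
have {}f2 := f2 m2L m2L.
have rm : 0 <= (1 - d) ^+ m1 < 1 by apply: exprn_lt1_pos => //; lra.
have f3 : (1 - (1 - d) ^+ m1) / (1 + (1 - d) ^+ m1) <= 1.
  by move/andP: rm => [a b]; rewrite ler_pdivrMr ?mul1r; lra.
rewrite /bohr_fun subr_ge0.
apply: le_trans (_ : p * 1 <= _); first by rewrite ler_wpM2l // ltW.
apply: le_trans (_ : 2 * mu * (1 / (2 * (L * d))) + 2 * nu * (1 / (2 * (L * d))) <= _).
  have aux (l : R) : 0 < l ->
      2 * mu * (1 / (2 * l)) + 2 * nu * (1 / (2 * l)) = (mu + nu) / l.
    by move=> l0; field; rewrite gt_eqF.
  rewrite aux ?mulr_gt0 //.
  by rewrite mulr1 ler_pdivlMr ?mulr_gt0 //; lra.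
by rewrite lerD // ler_wpM2l // mulr_ge0.
Qed.

(** Clearing denominators gives a polynomial with the sign of [bohr_fun] on [0, 1), to which
    [poly_ivt] applies: [bohr_fun] is -p at 0 and nonnegative at the point of [bohr_fun_pos]. *)
Lemma bohr_root : exists r : R, [/\ 0 < r < 1 & bohr_fun r = 0].
Proof.
have [b /andP[b0 b1] gb] := bohr_fun_pos.
pose P : {poly R} := (2 * mu)%:P * 'X^(q + m) * (1 - 'X^m2) * (1 + 'X^m1)
  + (2 * nu)%:P * 'X^m2 * (1 - 'X^q) * (1 + 'X^m1)
  - p%:P * (1 - 'X^m1) * (1 - 'X^q) * (1 - 'X^m2).
have PE (x : R) : 0 <= x < 1 ->
    P.[x] = bohr_fun x * ((1 - x ^+ q) * (1 - x ^+ m2) * (1 + x ^+ m1)) /\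
    0 < (1 - x ^+ q) * (1 - x ^+ m2) * (1 + x ^+ m1).
  move=> x01; have /andP[a1 a2] := exprn_lt1_pos q_gt0 x01.
  have /andP[c1 c2] := exprn_lt1_pos m2_gt0 x01.
  have /andP[e1 e2] := exprn_lt1_pos m1_gt0 x01.
  have n1 : 0 < 1 - x ^+ q by lra.
  have n2 : 0 < 1 - x ^+ m2 by lra.
  have n3 : 0 < 1 + x ^+ m1 by lra.
  split; last by rewrite !mulr_gt0.
  have -> : P.[x] = 2 * mu * x ^+ (q + m) * (1 - x ^+ m2) * (1 + x ^+ m1) +
      2 * nu * x ^+ m2 * (1 - x ^+ q) * (1 + x ^+ m1) -
      p * (1 - x ^+ m1) * (1 - x ^+ q) * (1 - x ^+ m2) by rewrite /P !hornerE.
  rewrite /bohr_fun; field.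
  by rewrite !gt_eqF.
have z0 : 0 <= (0 : R) < 1 by rewrite lexx ltr01.
have b01 : 0 <= b < 1 by rewrite (ltW b0) b1.
have [P0 D0] := PE 0 z0; have [Pb Db] := PE b b01.
have g0 : bohr_fun 0 = - p.
  rewrite /bohr_fun !expr0n !eqn0Ngt m1_gt0 m2_gt0 addn_gt0 q_gt0 /=.
  by rewrite !mul0r !mulr0 !addr0 sub0r subr0 divr1 mulr1.
have Pneg : P.[0] <= 0 by rewrite P0 g0 nmulr_rle0 ?oppr_lt0 // ltW.
have Ppos : 0 <= P.[b] by rewrite Pb mulr_ge0 // ltW.
have [x /andP[x0 xb] /rootP Px] :=
  @poly_ivt _ P 0 b (ltW b0) (introT andP (conj Pneg Ppos)).
have x1 : x < 1 := le_lt_trans xb b1.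
have x01 : 0 <= x < 1 by rewrite x0 x1.
have [PxE Dx] := PE x x01.
have gx : bohr_fun x = 0.
  move: PxE; rewrite Px => /esym/eqP; rewrite mulf_eq0 (gt_eqF Dx) orbF.
  by move/eqP.
exists x; split => //; rewrite x1 andbT lt_def x0 andbT.
apply: contraTneq p_gt0 => x00; move: gx; rewrite x00 g0 => /eqP.
by rewrite oppr_eq0 => /eqP ->; rewrite ltxx.
Qed.

End BohrRadius.

(** * Sharpness *)

Section ExtremalMaps.
Variables (R : realType) (n : nat) (t : \bar R).
Hypothesis t_ge1 : (1 <= t)%E.
Local Notation C := (Cplx R).
Local Notation nc := (@Normc.normc R).
Local Notation V := 'rV[C]_n.
Local Notation N := (@lnorm R n t).

(** One shape covers both kinds of extremal maps: b = 0, c = 1 for the monomial maps, and b the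
    all-ones row, c = 0 for the Blaschke maps. This is why their definitions carry trivial summands
    and factors. *)
Lemma differentiable_scale_affine (psi : C -> C) (b : V) (c : C) i (x : V) d :
  hasder psi (x ord0 i) d ->
  differentiable (fun z : V => psi (z ord0 i) *: (b + c *: z)) x.
Proof.
move=> hpsi; set A := fun z : V => b + c *: z.
pose L (h : V) : V := (c * psi (x ord0 i)) *: h + (d * h ord0 i) *: A x.
have linL : linear L.
  move=> a u v; rewrite /L !mxE; apply/rowP => j; rewrite !mxE; ring.
have LK h : linf (L h) <= (nc (c * psi (x ord0 i)) + nc d * linf (A x)) * linf h.
  apply: le_trans (linfD _ _) _; rewrite !linfZ ncM mulrDl lerD //.
  rewrite mulrAC ler_wpM2r ?linf_ge0 // ncM ler_wpM2l ?nc_ge0 //.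
  exact: nc_le_linf.
apply: (eps_differentiable linL LK _).1 => e e0.
pose K := linf (A x) + nc c + 1.
have K0 : 0 < K by have := linf_ge0 (A x); have := nc_ge0 c; rewrite /K; lra.
have eK : 0 < e / K by exact: divr_gt0.
have [d1 d10 H1] := hasder_eps hpsi eK.
have [d2 d20 H2] := (continuous_atP _ _).1 (hasder_cont hpsi) _ eK.
exists (Num.min d1 d2) => [|h]; first by rewrite lt_min d10.
rewrite lt_min => /andP[h1 h2].
have hi := nc_le_linf h i.
have {}H1 := H1 _ (le_lt_trans hi h1).
have {}H2 := H2 (x ord0 i + h ord0 i).
rewrite addrC addKr in H2; have {}H2 := H2 (le_lt_trans hi h2).
rewrite mxE.
have -> : psi (x ord0 i + h ord0 i) *: (b + c *: (x + h)) -
    psi (x ord0 i) *: A x - L h =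
    (psi (x ord0 i + h ord0 i) - psi (x ord0 i) - d * h ord0 i) *: A x +
    ((psi (x ord0 i + h ord0 i) - psi (x ord0 i)) * c) *: h.
  by rewrite /L /A; apply/rowP => j; rewrite !mxE; ring.
apply: le_trans (linfD _ _) _; rewrite !linfZ ncM.
apply: le_trans (_ : e / K * linf h * linf (A x) + e / K * nc c * linf h <= _).
  apply: lerD.
    rewrite ler_wpM2r ?linf_ge0 //; apply: le_trans H1 _.
    by rewrite ler_wpM2l // ltW.
  by rewrite ler_wpM2r ?linf_ge0 // ler_wpM2r ?nc_ge0.
rewrite mulrAC -mulrDl -mulrDr ler_wpM2r ?linf_ge0 // mulrAC ler_pdivrMr //.
by rewrite ler_wpM2l ?(ltW e0) // /K lerDl.
Qed.

(** Differentiating G(c y) = c^(k+1) G(y) in y gives c DG(c y) = c^(k+1) DG(y), and one factor c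
    cancels. This is carried out on lines with [hasder_unique]. *)
Lemma homogeneous_derivative (G : V -> V) (k : nat) (h : V) :
  holomorphic (lball t) G ->
  (forall (c : C) (y : V), c != 0 -> nc c < 1 -> lball t y -> G (c *: y) = c ^+ k.+1 *: G y) ->
  forall (c : C) (y : V), c != 0 -> nc c < 1 -> lball t y ->
    'd G (c *: y) h = c ^+ k *: 'd G y h.
Proof.
move=> hG hom c y c0 c1 yb.
have cyb : lball t (c *: y).
  by rewrite /lball /= lnormZ //; apply: le_lt_trans (yb : N y < 1);
    rewrite ler_piMl ?lnorm_ge0 // ltW.
apply/rowP => j.
have [rho rho0 hrho] := lball_open t_ge1 yb.
have line (x v : V) : lball t x ->
    hasder (fun z => G (x + z *: v) ord0 j) 0 ('d G x v ord0 j).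
  move=> xb; have := @hasder_line _ _ G x v 0 j.
  by rewrite scale0r addr0 => H; exact: H (hG _ xb).
have h1 := line _ (c *: h) cyb.
have h2 := hasderZ (c ^+ k.+1) (line _ h yb).
have near : 0 < rho / (linf h + 1) by rewrite divr_gt0 // ltr_wpDl ?linf_ge0.
have h3 : hasder (fun z => c ^+ k.+1 * G (y + z *: h) ord0 j) 0
    ('d G (c *: y) (c *: h) ord0 j).
  apply: (hasder_near near _ h1) => z; rewrite subr0 => hz.
  have -> : c *: y + z *: (c *: h) = c *: (y + z *: h).
    by rewrite scalerDr !scalerA [z * c]mulrC.
  rewrite hom // ?mxE //; apply: hrho; rewrite linfZ.
  apply: le_lt_trans (_ : nc z * (linf h + 1) < _).
    by rewrite ler_wpM2l ?nc_ge0 // lerDl.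
  by rewrite -ltr_pdivlMr // ltr_wpDl ?linf_ge0.
have E := hasder_unique h3 h2.
have dZ : 'd G (c *: y) (c *: h) = c *: 'd G (c *: y) h by rewrite linearZ.
have E1 := congr1 (fun v : V => v ord0 j) dZ.
rewrite mxE E exprS -mulrA in E1.
by rewrite mxE (mulfI c0 E1).
Qed.

(** D^j G is homogeneous of degree k - j, so at 0 the factor c = 1/2 forces it to vanish for j < k.
    For j = k, G(z e) / z^k is the constant G(e), which is therefore the k-th Taylor coefficient
    along e. *)
Lemma homogeneous_zero_of_order (G : V -> V) (k : nat) (e : V) :
  (0 < k)%N -> holomorphic (lball t) G ->
  (forall (c : C) (y : V), G (c *: y) = c ^+ k *: G y) -> N e = 1 -> G e <> 0 ->
  zero_of_order k G.
Proof.
move=> k0 hG hom e1 Ge.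
have homD hs : (size hs <= k)%N -> forall (c : C) (y : V), c != 0 -> nc c < 1 -> lball t y ->
    frechetD G (c *: y) hs = c ^+ (k - size hs) *: frechetD G y hs.
  elim: hs => [|h hs IH] /= hk c y c0 c1 yb; first by rewrite subn0 hom.
  have E : (k - size hs)%N = (k - (size hs).+1).+1 by rewrite subnSK.
  apply: (homogeneous_derivative h (frechetD_holomorphic t_ge1 hs hG)) => //.
  by move=> c' y' *; rewrite -E IH // ltnW.
have b0 : lball t (0 : V) by rewrite /lball /= lnorm0.
split=> [hs hk|].
  have two : (2 : C) != 0 by rewrite pnatr_eq0.
  have h2 : nc (2^-1 : C) < 1.
    by rewrite -(rmorph_nat (@ofR R)) ncV nc_ofR gtr0_norm // invf_lt1 // ltr1n.
  have := homD hs (ltnW hk) 2^-1 0 (invr_neq0 two) h2 b0.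
  rewrite scaler0 => /eqP; rewrite -subr_eq0 -{1}[frechetD G 0 hs]scale1r -scalerBl.
  rewrite scaler_eq0 subr_eq0 => /orP[/eqP h|/eqP //].
  have : nc (1 : C) < 1.
    by rewrite h ncX exprn_ilt1 ?nc_ge0 // subn_eq0 -ltnNge.
  by rewrite nc1 ltxx.
exists (nseq k e); first by rewrite size_nseq.
move=> D0; apply: Ge; apply/rowP => j; rewrite [RHS]mxE.
have hD : derivatives 1 (fun i z => frechetD G (z *: e) (nseq i e) ord0 j).
  by apply: (frechetD_derivatives t_ge1 j hG); rewrite e1 mulr1.
have h01 : 0 < (2^-1 : R) < 1 by rewrite invr_gt0 ltr0n invf_lt1 // ltr1n.
have := clim_taylor k h01 hD; rewrite scale0r D0 mxE mul0r => h.
have r0 : 0 < (2^-1 : R) by case/andP: h01.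
apply: clim_unique _ h; apply: clim_ext (clim_cst (G e ord0 j)) => i.
rewrite -(circmean_cst (G e ord0 j) i 2^-1).
apply: circmean_ext => [|z hz]; first exact: ltW.
have z0 : z != 0 by rewrite -nc_gt0 hz.
by rewrite /= hom mxE mulrAC divff ?mul1r // expf_neq0.
Qed.

Section Monomial.
Variables (i : 'I_n) (k : nat) (c : C).
Hypotheses (k_gt0 : (0 < k)%N) (c1 : nc c = 1).

(** The vector factor z maps the l_t ball into itself for every t, because |z_i| <= N z < 1. On the
    axis, r e_i goes to c r^k e_i, so the sign of c = -1 or c = 1 fixes the point fed to the
    Blaschke map. *)
Definition monomial_map (z : V) : V := (c * z ord0 i ^+ k.-1) *: (0 + 1 *: z).

Lemma monomial_schwarz : schwarz_mapping t monomial_map.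
Proof.
split.
- move=> z _; apply: (@differentiable_scale_affine (fun y => c * y ^+ k.-1)).
  exact: (hasderZ c (hasderX k.-1 (hasder_id (z ord0 i)))).
- move=> z zb; rewrite /lball /= /monomial_map add0r scale1r lnormZ // ncM c1 mul1r ncX.
  apply: le_lt_trans (zb : N z < 1); rewrite ler_piMl ?lnorm_ge0 //.
  rewrite exprn_ile1 ?nc_ge0 //; apply: le_trans (nc_le_linf _ _) _.
  by apply: le_trans (linf_le_lnorm t_ge1 _) _; exact: ltW.
- by rewrite /monomial_map scaler0 addr0 scaler0.
Qed.

Lemma monomial_zero_of_order : zero_of_order k monomial_map.
Proof.
have [hol _ _] := monomial_schwarz.
apply: (@homogeneous_zero_of_order _ k (delta_mx ord0 i)) => //.
- move=> a y; rewrite /monomial_map !add0r !scale1r !scalerA mxE exprMn.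
  by rewrite -{3}(prednK k_gt0) exprSr; congr (_ *: _); ring.
- exact: lnorm_delta.
- rewrite /monomial_map => /rowP/(_ i); rewrite !mxE !eqxx expr1n !mulr1 add0r mulr1.
  by move=> c0; move: c1; rewrite c0 nc0 => /esym/eqP; rewrite oner_eq0.
Qed.

Lemma monomial_map_axis (r : R) :
  monomial_map (ofR r *: delta_mx ord0 i) = (c * ofR (r ^+ k)) *: delta_mx ord0 i.
Proof.
rewrite /monomial_map add0r scale1r scalerA !mxE !eqxx mulr1; congr (_ *: _).
by rewrite -{2}(prednK k_gt0) exprSr rmorphM rmorphXn mulrA.
Qed.

End Monomial.

Section MoebiusMap.
Variables (i : 'I_n) (a : R).
Hypothesis a01 : 0 < a < 1.

Definition blaschke (y : C) : C := (ofR a - y) / (1 - ofR a * y).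

(** All components coincide, so |f_j(0)| = a for every j, as admissible maps require. *)
Definition blaschke_map (z : V) : V := blaschke (z ord0 i) *: (const_mx 1 + 0 *: z).

Lemma blaschke_den (y : C) : nc y < 1 -> 1 - ofR a * y != 0.
Proof.
move=> y1; rewrite -nc_gt0; have := nc_le_dist 1 (1 - ofR a * y).
rewrite nc1 opprB addrCA subrr addr0 ncM nc_ofR; case/andP: a01 => a0 a1.
rewrite gtr0_norm //; have := nc_ge0 y; nra.
Qed.

Lemma hasder_blaschke (y : C) : nc y < 1 -> exists d, hasder blaschke y d.
Proof.
move=> y1.
have h1 := hasderB (hasder_cst (ofR a) y) (hasder_id y).
have h2 := hasderB (hasder_cst 1 y) (hasderZ (ofR a) (hasder_id y)).
have := @hasder_div _ (fun y => ofR a - y) (fun y => 1 - ofR a * y) y _ _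
  (blaschke_den y1) h1 h2.
by move=> h; eexists; exact: h.
Qed.

Lemma blaschke_le1 (y : C) : nc y < 1 -> nc (blaschke y) <= 1.
Proof.
move=> y1; have aC : nc (- ofR a) < 1.
  by case/andP: a01 => a0 a1; rewrite ncN nc_ofR gtr0_norm.
have -> : blaschke y = - moebius (- ofR a) y.
  have -> : moebius (- ofR a) y = (y - ofR a) / (1 - ofR a * y).
    rewrite /moebius; congr (_ / (1 + _)).
    by rewrite (_ : cj (- ofR a) = - ofR a) ?mulNr //; apply: complex_ext; rewrite !reimE ?oppr0.
  by rewrite /blaschke -[RHS]mulNr opprB.
by rewrite ncN ltW // moebius_lt1.
Qed.

Lemma blaschke_mapE z j : blaschke_map z ord0 j = blaschke (z ord0 i).
Proof. by rewrite /blaschke_map scale0r addr0 !mxE mulr1. Qed.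

Lemma coord_lt1 (z : V) : lball t z -> nc (z ord0 i) < 1.
Proof.
move=> zb; apply: le_lt_trans (nc_le_linf _ _) _.
by apply: le_lt_trans (linf_le_lnorm t_ge1 _) zb.
Qed.

Lemma blaschke_polydisk : polydisk_valued t blaschke_map.
Proof.
split=> [z zb|z zb j].
  have [d hd] := hasder_blaschke (coord_lt1 zb).
  exact: differentiable_scale_affine hd.
by rewrite blaschke_mapE; exact/blaschke_le1/coord_lt1.
Qed.

Lemma linf_const (x : V) y : (forall j, x ord0 j = y) -> linf x = nc y.
Proof.
move=> xy; apply/le_anti/andP; split; last by rewrite -(xy i) nc_le_linf.
by apply/linf_leP => [|j]; rewrite ?nc_ge0 // xy.
Qed.

Lemma linf_constB (x w : V) (y u : C) : (forall j, x ord0 j = y) ->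
  (forall j, w ord0 j = u) -> linf (x - w) = nc (y - u).
Proof. by move=> xy wu; apply: linf_const => j; rewrite !mxE xy wu. Qed.

(** On the axis the map is a - (1 - a^2) times the sum over s >= 1 of a^(s-1) y^s. The coefficient
    is identified without an infinite series, by uniqueness of the limit of circle means of f /
    y^k. *)
Lemma blaschke_coefficient (r : R) k : 0 < r < 1 -> (0 < k)%N ->
  linf (frechetD0 blaschke_map k (ofR r *: delta_mx ord0 i)) / k`!%:R =
  (1 - a ^+ 2) * a ^+ k.-1 * r ^+ k.
Proof.
move=> /andP[r0 r1] k0; case/andP: a01 => a0 a1.
set z := ofR r *: _.
have Nz : N z = r by rewrite lnormZ // lnorm_delta // mulr1 nc_ofR gtr0_norm.
pose cf : R := (1 - a ^+ 2) * a ^+ k.-1 * r ^+ k.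
suff H j : frechetD0 blaschke_map k z ord0 j = - ofR cf * k`!%:R.
  have kf : k`!%:R != 0 :> R by rewrite pnatr_eq0 -lt0n fact_gt0.
  rewrite (linf_const H) ncM ncN nc_ofR -(rmorph_nat (@ofR R)) nc_ofR normr_nat mulfK //.
  by rewrite ger0_norm // /cf !mulr_ge0 ?exprn_ge0 ?(ltW a0) ?(ltW r0) // subr_ge0 expr_le1 // ltW.
have hD : derivatives 1 (fun s y => frechetD blaschke_map (y *: z) (nseq s z) ord0 j).
  apply: (frechetD_derivatives t_ge1 j blaschke_polydisk.1).
  by rewrite Nz mul1r ltW.
have h01 : 0 < (2^-1 : R) < 1 by rewrite invr_gt0 ltr0n invf_lt1 // ltr1n.
have l1 := clim_taylor k h01 hD.
have half0 : 0 < (2^-1 : R) by case/andP: h01.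
rewrite scale0r in l1.
suff l2 : clim (circmean (fun y => frechetD blaschke_map (y *: z) (nseq 0 z) ord0 j
    / y ^+ k) ^~ 2^-1) (- ofR cf).
  by rewrite /frechetD0 -(clim_unique l1 l2) divfK // factC_neq0.
(* [P] holds the terms of degree below k, and [psi] times y^k is the whole geometric tail, with
   ratio b y. *)
pose b := ofR (a * r).
pose P : {poly C} := (ofR a)%:P - (ofR ((1 - a ^+ 2) * r)) *: ((\poly_(s < k.-1) b ^+ s) * 'X).
pose psi y := - ofR cf / (1 - b * y).
have den (y : C) : nc y < 1 -> 1 - b * y != 0.
  move=> y1; rewrite /b rmorphM -mulrA; apply: blaschke_den.
  by rewrite ncM nc_ofR gtr0_norm //; have := nc_ge0 y; nra.
have geo y : (\poly_(s < k.-1) b ^+ s).[y] * (1 - b * y) = 1 - (b * y) ^+ k.-1.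
  rewrite horner_poly (eq_bigr (fun s : 'I_k.-1 => (b * y) ^+ s)); last first.
    by move=> s _; rewrite exprMn.
  by rewrite -[RHS]opprB subrX1 mulrC -[RHS]mulNr opprB.
pose F y := P.[y] + psi y * y ^+ k.
have sP : (size P <= k)%N.
  apply: leq_trans (size_polyD _ _) _; rewrite geq_max size_polyN; apply/andP; split.
    by apply: leq_trans (size_polyC_leq1 _) _.
  apply: leq_trans (size_scale_leq _ _) _; apply: leq_trans (size_polyMleq _ _) _.
  by rewrite size_polyX addn2 /= -[in leqRHS](prednK k0) ltnS size_poly.
have dpsi (y : C) : nc y < 1 -> exists d, hasder psi y d.
  move=> y1; have h1 := hasderB (hasder_cst 1 y) (hasderZ b (hasder_id y)).
  have := @hasder_div _ (fun=> - ofR cf) (fun y => 1 - b * y) y _ _ (den _ y1)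
    (hasder_cst _ y) h1.
  by move=> h; eexists; exact: h.
have dF (y : C) : nc y <= 2^-1 -> exists d, hasder F y d.
  move=> y2; have y1 : nc y < 1 by apply: le_lt_trans y2 _; case/andP: h01.
  have [d hd] := dpsi y y1; eexists.
  exact: (hasderD (hasder_horner P y) (hasderM hd (hasderX k (hasder_id y)))).
have [d0 hd0] : exists d, hasder psi 0 d by apply: dpsi; rewrite nc0.
have lF := clim_coef half0 sP (fun y => erefl (F y)) (hasder_cont hd0) dF.
have psi0 : psi 0 = - ofR cf by rewrite /psi mulr0 subr0 divr1.
rewrite psi0 in lF; apply: clim_ext lF => M.
apply: circmean_ext => [|y hy]; first exact: ltW.
have y1 : nc y < 1 by rewrite hy; case/andP: h01.
congr (_ / _); rewrite /= blaschke_mapE /blaschke !mxE !eqxx mulr1 /F /P /psi.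
rewrite hornerD hornerN hornerC hornerZ hornerMX.
have := geo y; set S := _.[y] => SE.
have {SE} -> : S = (1 - (b * y) ^+ k.-1) / (1 - b * y) by rewrite -SE mulfK // den.
have dy := den y y1.
have a2 : ofR (1 - a ^+ 2) = 1 - ofR a ^+ 2.
  by apply: complex_ext; rewrite !(reimE, expr2); ring.
have -> : ofR cf = (1 - ofR a ^+ 2) * ofR a ^+ k.-1 * (ofR r ^+ k.-1 * ofR r).
  by rewrite -exprSr prednK // -a2 -!rmorphXn -!rmorphM.
have -> : ofR ((1 - a ^+ 2) * r) = (1 - ofR a ^+ 2) * ofR r.
  by rewrite -a2 -rmorphM.
have yk : y ^+ k = y ^+ k.-1 * y by rewrite -exprSr prednK.
rewrite yk exprMn; move: dy; have -> : b = ofR a * ofR r by rewrite -rmorphM.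
rewrite exprMn => dy; field.
by rewrite [y * _]mulrC mulrA dy.
Qed.

End MoebiusMap.

End ExtremalMaps.

(** * Failure of the inequality beyond the root *)

Section Sharpness.
Variable R : realType.
Local Notation C := (Cplx R).
Local Notation nc := (@Normc.normc R).

(** The form 1/B - 1 is chosen because for B = (a + u)/(1 + a u) it equals (1 - a)(1 - u)/(a + u),
    so that 1 - a splits off exactly. For p <= 1 the tangent bound is applied to 1/B, otherwise
    Bernoulli's inequality to B. *)
Lemma powR_ge_inv (B p : R) : 0 < B <= 1 -> 0 < p -> 1 - p * (B^-1 - 1) <= B `^ p.
Proof.
move=> /andP[B0 B1] p0; have [p1|/ltW p1] := leP p 1.
  have y1 : 1 <= B^-1 by rewrite invf_ge1.
  have yp : 0 < B^-1 `^ p by rewrite powR_gt0 // invr_gt0.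
  have yB : 0 <= B^-1 by rewrite invr_ge0 ltW.
  have p01 : 0 < p <= 1 by rewrite p0.
  have hy := powR_le_affine yB p01.
  have -> : B `^ p = (B^-1 `^ p)^-1.
    have -> : B^-1 = B `^ (- 1) by rewrite powR_inv1 // ltW.
    by rewrite -powRrM mulN1r powRN invrK.
  rewrite -[leRHS]mul1r ler_pdivlMr //.
  have h0 : 0 <= p * (B^-1 - 1) by rewrite mulr_ge0 ?(ltW p0) // subr_ge0.
  move: yp hy h0; move: (B^-1 `^ p) (p * _) => y u y0 hy u0.
  by have [u1|u1] := leP u 1; nra.
apply: le_trans (bernoulli_powR (ltW B0) p1).
rewrite lerD2l -mulrN ler_wpM2l ?(ltW p0) // opprB.
rewrite -(ler_pM2r B0) mulrBl mul1r mulVf ?gt_eqF //; nra.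
Qed.

Lemma poly_pos_left (Q : {poly R}) : 0 < Q.[1] -> exists2 a, 0 < a < 1 & 0 < Q.[a].
Proof.
move=> Q1; have cQ : Q.[x] @[x --> (1 : R)] --> Q.[1] by exact: continuous_horner.
have /cvgrPdist_lt /(_ _ Q1) /nbhs_ballP[e /= e0 He] := cQ.
pose d : R := Num.min (e / 2) (1 / 2).
have d0 : 0 < d by rewrite lt_min !divr_gt0.
have [de d1] : d <= e / 2 /\ d <= 1 / 2 by rewrite !ge_min !lexx orbT.
exists (1 - d); first by apply/andP; split; lra.
have := He (1 - d); rewrite /ball /= subKr gtr0_norm // => /(_ _)/wrap[]; first by lra.
by move=> h; have := le_lt_trans (ler_norm _) h; lra.
Qed.

Variables (p mu nu : R) (q m m1 m2 : nat).
Hypotheses (p_gt0 : 0 < p) (q_gt0 : (0 < q)%N) (m1_gt0 : (0 < m1)%N)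
  (m2_gt0 : (0 < m2)%N) (mu_ge0 : 0 <= mu) (nu_ge0 : 0 <= nu).

(** Cutting the series costs only K (r^q)^M, which tends to 0; the finite sum keeps the later
    comparison polynomial in a. *)
Lemma truncated_bohr_pos (r : R) : 0 < r < 1 -> 0 < bohr_fun p mu nu q m m1 m2 r ->
  exists M, 0 < 2 * mu * (\sum_(1 <= s < M) r ^+ (q * s + m))
    + 2 * nu * (r ^+ m2 / (1 - r ^+ m2)) - p * ((1 - r ^+ m1) / (1 + r ^+ m1)).
Proof.
move=> /andP[r0 r1] gr.
have /andP[x0 x1] := exprn_lt1_pos q_gt0 (introT andP (conj (ltW r0) r1)).
have n1 : 0 < 1 - r ^+ q by lra.
pose K := 2 * mu * (r ^+ (q + m) / (1 - r ^+ q)).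
have K0 : 0 <= K by rewrite !mulr_ge0 ?invr_ge0 ?exprn_ge0 ?(ltW r0) ?(ltW n1).
have K1 : 0 < K + 1 by lra.
have [M hM] : exists M, K * (r ^+ q) ^+ M < bohr_fun p mu nu q m m1 m2 r.
  have : (fun M => (r ^+ q) ^+ M) @ \oo --> (0 : R) by apply: cvg_expr; rewrite ger0_norm.
  move/cvgrPdist_lt => /(_ (bohr_fun p mu nu q m m1 m2 r / (K + 1))).
  rewrite divr_gt0 // => /(_ isT)[M _ hM].
  exists M; have := hM M (leqnn M) => /=; rewrite sub0r normrN ger0_norm ?(exprn_ge0 M x0) //.
  rewrite ltr_pdivlMr // => h; apply: le_lt_trans h.
  by rewrite mulrC; apply: ler_wpM2l; [exact: exprn_ge0|rewrite lerDl].
exists M.+1; move: hM; rewrite /bohr_fun -/K.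
have -> : \sum_(1 <= s < M.+1) r ^+ (q * s + m) =
    r ^+ (q + m) * (1 - r ^+ q ^+ M) / (1 - r ^+ q).
  by apply: geometric_sum => //; rewrite r1 ltW.
have -> : 2 * mu * (r ^+ (q + m) * (1 - r ^+ q ^+ M) / (1 - r ^+ q)) =
    K - K * (r ^+ q) ^+ M by rewrite /K; ring.
by lra.
Qed.

Lemma extremal_parameter (r : R) : 0 < r < 1 -> 0 < bohr_fun p mu nu q m m1 m2 r ->
  exists a M, 0 < a < 1 /\
    1 < ((a + r ^+ m1) / (1 + a * r ^+ m1)) `^ p
      + mu * (\sum_(1 <= s < M) (1 - a ^+ 2) * a ^+ (q * s + m).-1 * r ^+ (q * s + m))
      + nu * ((1 - a ^+ 2) * r ^+ m2 / (1 - a * r ^+ m2)).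
Proof.
move=> r01 gr; have [M hM] := truncated_bohr_pos r01 gr.
case/andP: r01 => r0 r1; have r01 : 0 <= r < 1 by rewrite r1 ltW.
have /andP[u0 u1] := exprn_lt1_pos m1_gt0 r01.
have /andP[w0 w1] := exprn_lt1_pos m2_gt0 r01.
move: (r ^+ m1) (r ^+ m2) u0 u1 w0 w1 hM => u w u0 u1 w0 w1 hM.
pose S : {poly R} := \sum_(1 <= s < M) r ^+ (q * s + m) *: 'X^((q * s + m).-1).
have SE x : S.[x] = \sum_(1 <= s < M) x ^+ (q * s + m).-1 * r ^+ (q * s + m).
  rewrite /S horner_sum; apply: eq_bigr => s _.
  by rewrite hornerZ hornerXn mulrC.
(* The excess over 1 is at least (1 - a) Q(a) / ((a + u)(1 - a w)), and Q(1) is (1 + u)(1 - w) times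
   the expression of [truncated_bohr_pos], hence positive. *)
pose Q : {poly R} := - (p * (1 - u))%:P * (1 - w *: 'X)
  + mu *: ((1 + 'X) * S * ('X + u%:P) * (1 - w *: 'X))
  + nu *: ((1 + 'X) * w%:P * ('X + u%:P)).
have QE x : Q.[x] = - (p * (1 - u)) * (1 - w * x) +
    mu * ((1 + x) * S.[x] * (x + u) * (1 - w * x)) + nu * ((1 + x) * w * (x + u)).
  by rewrite /Q !(hornerD, hornerM, hornerZ, hornerN, hornerC, hornerX).
have [a /andP[a0 a1] Qa] : exists2 a, 0 < a < 1 & 0 < Q.[a].
  apply: poly_pos_left; rewrite QE !mulr1.
  have -> : S.[1] = \sum_(1 <= s < M) r ^+ (q * s + m).
    by rewrite SE; apply: eq_bigr => s _; rewrite expr1n mul1r.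
  move: (\sum_(1 <= s < M) _) hM => T hT.
  have k : 0 < (1 + u) * (1 - w) by rewrite mulr_gt0 //; lra.
  have := mulr_gt0 k hT; congr (0 < _); field.
  by apply/andP; split; rewrite gt_eqF //; lra.
exists a, M; split; first by rewrite a0.
have au : 0 < a + u by lra.
have aw : 0 < 1 - a * w by nra.
have dau : 0 < 1 + a * u by nra.
have B01 : 0 < (a + u) / (1 + a * u) <= 1.
  by rewrite divr_gt0 //= ler_pdivrMr // mul1r; nra.
have hB := powR_ge_inv B01 p_gt0.
apply: lt_le_trans (lerD (lerD hB (lexx _)) (lexx _)).
have -> : \sum_(1 <= s < M) (1 - a ^+ 2) * a ^+ (q * s + m).-1 * r ^+ (q * s + m) =
    (1 - a ^+ 2) * S.[a].
  by rewrite SE mulr_sumr; apply: eq_bigr => s _; rewrite mulrA.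
rewrite -subr_gt0.
have -> : 1 - p * (((a + u) / (1 + a * u))^-1 - 1) + mu * ((1 - a ^+ 2) * S.[a]) +
    nu * ((1 - a ^+ 2) * w / (1 - a * w)) - 1 =
    (1 - a) * Q.[a] / ((a + u) * (1 - a * w)).
  rewrite QE; field; apply/and3P.
  by rewrite !gt_eqF // mulrC.
by rewrite divr_gt0 ?mulr_gt0 // subr_gt0.
Qed.

(** On the axis the maps are explicit: v1 lands at -r^m1, where the Blaschke factor attains the
    bound of [pick_modulus], and v2 at r^m2. The series of nonnegative terms is bounded below by a
    partial sum. *)
Lemma bohr_sum_extremal n (t : \bar R) (i : 'I_n) (a r : R) (M : nat) :
  (1 <= t)%E -> 0 < a < 1 -> 0 < r < 1 ->
  ((((a + r ^+ m1) / (1 + a * r ^+ m1)) `^ p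
      + mu * (\sum_(1 <= s < M) (1 - a ^+ 2) * a ^+ (q * s + m).-1 * r ^+ (q * s + m))
      + nu * ((1 - a ^+ 2) * r ^+ m2 / (1 - a * r ^+ m2)))%:E <=
  bohr_sum p mu nu q m (blaschke_map i a) (monomial_map i m1 (- 1))
    (monomial_map i m2 1) (ofR r *: delta_mx ord0 i))%E.
Proof.
move=> t1 a01 r01; case/andP: (a01) => a0 a1; case/andP: (r01) => r0 r1.
have r01' : 0 <= r < 1 by rewrite r1 ltW.
have /andP[u0 u1] := exprn_lt1_pos m1_gt0 r01'.
have /andP[w0 w1] := exprn_lt1_pos m2_gt0 r01'.
set z := ofR r *: _.
have ax (c : C) : (c *: (delta_mx ord0 i : 'rV[C]_n)) ord0 i = c.
  by rewrite !mxE !eqxx mulr1.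
have rowB (x y : 'rV[C]_n) j : (x - y) ord0 j = x ord0 j - y ord0 j.
  by rewrite !mxE.
have row0 : (0 : 'rV[C]_n) ord0 i = 0 by rewrite mxE.
have E1 : linf (blaschke_map i a (monomial_map i m1 (- 1) z)) =
    (a + r ^+ m1) / (1 + a * r ^+ m1).
  rewrite (@linf_const _ _ i _ (ofR ((a + r ^+ m1) / (1 + a * r ^+ m1)))).
    rewrite nc_ofR ger0_norm // divr_ge0 ?addr_ge0 ?mulr_ge0 ?(ltW a0) //.
  move=> j; rewrite blaschke_mapE (monomial_map_axis i (- 1) m1_gt0) ax /blaschke mulN1r opprK.
  by rewrite mulrN opprK rmorphM fmorphV !rmorphD rmorphM rmorph1.
have E2 : linf (blaschke_map i a (monomial_map i m2 1 z) - blaschke_map i a 0) =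
    (1 - a ^+ 2) * r ^+ m2 / (1 - a * r ^+ m2).
  have d0 : 0 < 1 - a * r ^+ m2 by nra.
  have b1 j : blaschke_map i a (monomial_map i m2 1 z) ord0 j = blaschke a (ofR (r ^+ m2)).
    by rewrite blaschke_mapE (monomial_map_axis i 1 m2_gt0) ax mul1r.
  have b2 j : blaschke_map i a 0 ord0 j = blaschke a 0 by rewrite blaschke_mapE row0.
  rewrite (linf_constB i b1 b2).
  have -> : blaschke a (ofR (r ^+ m2)) - blaschke a 0 =
      - ofR ((1 - a ^+ 2) * r ^+ m2 / (1 - a * r ^+ m2)) :> C.
    have dC : ofR (1 - a * r ^+ m2) != 0 :> C.
      by rewrite -nc_eq0 nc_ofR normr_eq0 gt_eqF.
    have dE : ofR (1 - a * r ^+ m2) = 1 - ofR a * ofR (r ^+ m2) :> C.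
      by apply: complex_ext; rewrite !reimE; ring.
    have bE : blaschke a (ofR (r ^+ m2)) = ofR ((a - r ^+ m2) / (1 - a * r ^+ m2)).
      by rewrite /blaschke -dE [RHS]rmorphM fmorphV [X in _ = X * _]rmorphB.
    rewrite bE /blaschke mulr0 !subr0 divr1 -rmorphB -rmorphN; congr ofR; field.
    by rewrite gt_eqF.
  rewrite ncN nc_ofR ger0_norm // divr_ge0 ?(ltW d0) // mulr_ge0 //.
  by rewrite subr_ge0 expr_le1 // ltW.
rewrite /bohr_sum E1 E2 !EFinD.
apply: leeD => //; apply: leeD => //; rewrite EFinM; apply: lee_wpmul2l; first by rewrite lee_fin.
apply: le_trans (nneseries_lim_ge M _); last first.
  by move=> s _; rewrite lee_fin divr_ge0 ?linf_ge0.
rewrite sumEFin lee_fin le_eqVlt; apply/orP; left; apply/eqP.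
apply: eq_big_nat => s /andP[s1 _].
by rewrite (blaschke_coefficient t1) // addn_gt0 muln_gt0 q_gt0 s1.
Qed.

End Sharpness.

Theorem theorem2p1 (R : realType) (n : nat) (t : \bar R) (p mu nu : R)
    (q m m1 m2 : nat)
    (n_gt0 : (0 < n)%N) (t_ge1 : (1 <= t)%E) (p_gt0 : 0 < p) (p_le2 : p <= 2)
    (q_gt0 : (0 < q)%N) (m1_gt0 : (0 < m1)%N) (m2_gt0 : (0 < m2)%N)
    (mu_ge0 : 0 <= mu) (nu_ge0 : 0 <= nu) (munu_gt0 : 0 < mu + nu) :
  exists R1 : R,
    [/\ minimal_root (bohr_equation p mu nu q m m1 m2) R1,
        bohr_inequality_upto n t p mu nu q m m1 m2 R1 &
        forall rho : R, R1 < rho ->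
          ~ bohr_inequality_upto n t p mu nu q m m1 m2 rho].
Proof.
have [R1 [/andP[R10 R11] gR1]] := bohr_root m p_gt0 q_gt0 m1_gt0 m2_gt0 mu_ge0 nu_ge0 munu_gt0.
exists R1; split.
- split; [by rewrite R10|exact: gR1|move=> x /andP[x0 x1] gx].
  (* [bohr_fun] is strictly increasing, so it has no root below R1. *)
  rewrite leNgt; apply/negP => xR.
  have := bohr_fun_lt m p_gt0 q_gt0 m1_gt0 m2_gt0 mu_ge0 nu_ge0 (ltW x0) xR R11.
  by rewrite gR1 [bohr_fun _ _ _ _ _ _ _ _]gx ltxx.
- move=> f v1 v2 hf ha hv1 hz1 hv2 hz2 z zb zR.
  have hz := bohr_fun_homo m m1 p_gt0 q_gt0 m2_gt0 mu_ge0 nu_ge0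
    (lnorm_ge0 t_ge1 z) zR R11.
  rewrite gR1 in hz.
  exact: (bohr_inequality t_ge1 p_gt0 p_le2 q_gt0 m1_gt0 m2_gt0 mu_ge0 nu_ge0
    hf ha hv1 hz1 hv2 hz2 zb hz).
(* The cap at 1 keeps the test point in the unit ball, as rho may exceed 1. *)
move=> rho R1rho H; pose r := (R1 + Num.min rho 1) / 2.
have [R1r [r1 rrho]] : R1 < r /\ r < 1 /\ r <= rho.
  have h1 : R1 < Num.min rho 1 by rewrite lt_min R1rho.
  have [h2 h3] : Num.min rho 1 <= rho /\ Num.min rho 1 <= 1.
    by rewrite !ge_min !lexx orbT.
  by rewrite /r; split; [lra|split; lra].
have r01 : 0 < r < 1 by rewrite r1 andbT (lt_trans R10).
have gr : 0 < bohr_fun p mu nu q m m1 m2 r.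
  rewrite -gR1; exact: (bohr_fun_lt m p_gt0 q_gt0 m1_gt0 m2_gt0 mu_ge0 nu_ge0 (ltW R10) R1r r1).
have [a [M [a01 big]]] := extremal_parameter p_gt0 q_gt0 m1_gt0 m2_gt0 mu_ge0 r01 gr.
pose i := Ordinal n_gt0.
have zN : lnorm t (ofR r *: delta_mx ord0 i : 'rV[Cplx R]_n) = r.
  by rewrite lnormZ // lnorm_delta // mulr1 nc_ofR gtr0_norm //; case/andP: r01.
have nN1 : Normc.normc (- 1 : Cplx R) = 1 by rewrite ncN nc1.
have nP1 : Normc.normc (1 : Cplx R) = 1 by rewrite nc1.
have f0 j : Normc.normc (blaschke_map i a 0 ord0 j) = linf (blaschke_map i a 0).
  rewrite (@linf_const _ _ i _ (blaschke a 0)) ?blaschke_mapE ?mxE // => k.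
  by rewrite blaschke_mapE mxE.
have := H _ _ _ (blaschke_polydisk t_ge1 i a01) f0
  (monomial_schwarz t_ge1 i m1 nN1) (monomial_zero_of_order t_ge1 i m1_gt0 nN1)
  (monomial_schwarz t_ge1 i m2 nP1) (monomial_zero_of_order t_ge1 i m2_gt0 nP1)
  (ofR r *: delta_mx ord0 i).
rewrite /lball /= zN => /(_ r1 rrho).
move/(le_trans (bohr_sum_extremal p nu m q_gt0 m1_gt0 m2_gt0 mu_ge0 i M t_ge1 a01 r01)).
by rewrite lee_fin leNgt big.
Qed.
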